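(* (Coarse Multiplicative Decomposition) Let $N\ne0$ be an integer, and to each primitive Dirichlet character $\chi$ modulo $\mathfrak{f}$ with $\mathfrak{f}\mid N$ assign the Hilbert space $$\mathcal{H}_N(\chi;\mathfrak{f}):=\bigoplus_{d:\ \mathfrak{f}\mid d\mid N}\mathcal{H}_{N,d}(\chi|_d).$$ Then $\mathcal{H}_N$ has the orthogonal direct sum decomposition $$\mathcal{H}_N=\bigoplus_{\chi,\,\mathfrak{f}}\mathcal{H}_N(\chi;\mathfrak{f}),$$ in which $\chi$ runs over all primitive characters modulo $\mathfrak{f}$ for all $\mathfrak{f}\mid N$. Each Hilbert space $\mathcal{H}_N(\chi;\mathfrak{f})$ is invariant under all two-variable Hecke operators $\{T_m: m\in\mathbb{Z}\setminus\{0\}\}$.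
   Context: $H(\mathbb{R})$ is the real Heisenberg group of triples $[a,c,z]\in\mathbb{R}^3$ with law $[a,c,z]\circ[a',c',z']=[a+a',c+c',z+z'+ca']$ and Haar measure $da\,dc\,dz$; $H(\mathbb{Z})$ is the subgroup of integer triples. $\mathcal{H}_N$ is the Hilbert space of left $H(\mathbb{Z})$-invariant functions $F$ on $H(\mathbb{R})$, square-integrable over $[0,1]^3$, with $F(a,c,z)=e^{2\pi i Nz}F(a,c,0)$ a.e. Divisors are positive; $d\mid N$ means $d$ divides $|N|$. For a (primitive or imprimitive) Dirichlet character $\chi$ mod $d$, $d\mid N$, the twisted Weil–Brezin map $\mathcal{W}_{N,d}(\chi):L^2(\mathbb{R},dx)\to\mathcal{H}_N$ is the isometric extension of $$\mathcal{W}_{N,d}(\chi)(f)(a,c,z)=\sqrt{C_{N,d}}\,e^{2\pi i Nz}\sum_{n\in\mathbb{Z}}\chi\Big(\frac{nd}{N}\Big)f(n+Nc)e^{2\pi i na},\quad C_{N,d}=\frac{N}{\phi(d)}$$ ($f$ Schwartz; $\chi(r)=0$ if $r\notin\mathbb{Z}$; principal square root when $N<0$), and $\mathcal{H}_{N,d}(\chi)$ is its (closed) image. For a primitive character $\chi$ mod $\mathfrak{f}$ and $\mathfrak{f}\mid d$, $\chi|_d$ is the (generally imprimitive) character mod $d$ with $\chi|_d(n)=\chi(n)$ if $\gcd(n,d)=1$ and $0$ otherwise. The bounded operators $T_m$ are $T_m(F)(a,c,z)=\frac1{|m|}\sum_{j=0}^{|m|-1}F(\frac{a+j}{m},mc,z)$.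 *)

(* Defs.v *)
From HB Require Import structures.
From mathcomp Require Import all_boot all_order all_algebra.
From mathcomp Require Import complex.
From mathcomp Require Import all_classical all_reals all_analysis.
Import Order.TTheory GRing.Theory Num.Theory numFieldNormedType.Exports.

Set Implicit Arguments.
Unset Strict Implicit.
Unset Printing Implicit Defensive.

Local Open Scope classical_set_scope.
Local Open Scope complex_scope.
Local Open Scope ring_scope.

Definition expi2pi (R : realType) (x : R) : R[i] :=
  cos (2 * pi * x) +i* sin (2 * pi * x).

Definition sqmod (R : realType) (w : R[i]) : R :=
  complex.Re w ^+ 2 + complex.Im w ^+ 2.

(* A sum over all integers is split as n >= 0 and n < 0 ([Negz n] is -(n+1)),
   and a complex sum is taken componentwise.  It is only applied below to
   absolutely convergent sums. *)
Definition sumZ (R : realType) (u : int -> R) : R :=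
  limn (series (fun n => u (Posz n))) + limn (series (fun n => u (Negz n))).

Definition csumZ (R : realType) (u : int -> R[i]) : R[i] :=
  sumZ (fun n => complex.Re (u n)) +i* sumZ (fun n => complex.Im (u n)).

Definition cmeasurable (R : realType) d (T : measurableType d)
    (F : T -> R[i]) : Prop :=
  measurable_fun setT (fun x => complex.Re (F x) : measurableTypeR R) /\
  measurable_fun setT (fun x => complex.Im (F x) : measurableTypeR R).

Definition L2R (R : realType) (f : measurableTypeR R -> R[i]) : Prop :=
  cmeasurable f /\
  (\int[@lebesgue_measure R]_x (sqmod (f x))%:E < +oo)%E.

Definition L2R_cvg (R : realType) (u : nat -> measurableTypeR R -> R[i])
    (f : measurableTypeR R -> R[i]) : Prop :=
  (fun k => \int[@lebesgue_measure R]_x (sqmod (u k x - f x))%:E)%E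
    @ \oo --> 0%E.

Definition schwartz_real (R : realType) (f : R -> R) : Prop :=
  (forall k x, derivable (derive1n k f) x 1) /\
  (forall k m : nat, exists M : R, forall x, `|x ^+ m * derive1n k f x| <= M).

Definition schwartz (R : realType) (f : R -> R[i]) : Prop :=
  schwartz_real (fun x => complex.Re (f x)) /\
  schwartz_real (fun x => complex.Im (f x)).

(* The triple [a, c, z] is [((a, c), z)]. *)
Definition heis (R : realType) : Type :=
  (measurableTypeR R * measurableTypeR R * measurableTypeR R)%type.

Definition heis_mul (R : realType) (g h : heis R) : heis R :=
  let: (a, c, z) := g in let: (a', c', z') := h in
  (a + a', c + c', z + z' + c * a').

Definition heisZ (R : realType) (p q r : int) : heis R :=
  (p%:~R, q%:~R, r%:~R).

Definition haar (R : realType) :=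
  ((@lebesgue_measure R \x @lebesgue_measure R) \x @lebesgue_measure R)%E.
Arguments haar : clear implicits.

Definition cube (R : realType) : set (heis R) :=
  (`[0, 1]%classic `*` `[0, 1]%classic) `*` `[0, 1]%classic.
Arguments cube : clear implicits.

Definition heis_fun (R : realType) : Type := heis R -> R[i].

Definition ae_same (R : realType) (F G : heis_fun R) : Prop :=
  {ae haar R, forall g, F g = G g}.

Definition heis_sqnorm (R : realType) (F : heis_fun R) : \bar R :=
  (\int[haar R]_(g in cube R) (sqmod (F g))%:E)%E.

Definition heis_inner (R : realType) (F G : heis_fun R) : R[i] :=
  Rintegral (haar R) (cube R) (fun g => complex.Re (F g * (G g)^*)) +i*
  Rintegral (haar R) (cube R) (fun g => complex.Im (F g * (G g)^*)).

Definition heis_cvg (R : realType) (u : nat -> heis_fun R) (F : heis_fun R) :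
    Prop :=
  (fun k => heis_sqnorm (fun g => u k g - F g)) @ \oo --> 0%E.

Record HN_rep (R : realType) (N : int) (F : heis_fun R) : Prop := {
  HN_rep_meas : cmeasurable F;
  HN_rep_inv : forall (p q r : int) g, F (heis_mul (heisZ R p q r) g) = F g;
  HN_rep_sqint : (heis_sqnorm F < +oo)%E;
  HN_rep_char : {ae haar R, forall g : heis R, let: (a, c, z) := g in
    F (a, c, z) = expi2pi (N%:~R * z) * F (a, c, 0)} }.

(* Elements of H_N are classes of functions modulo equality almost everywhere.
   Each subspace of H_N is rendered as the set of all measurable functions whose
   class belongs to it, and equality in H_N is [ae_same].  The value F(a,c,0)
   depends on the function and not only on its class, so the defining conditions
   are imposed on some representative. *)
Definition HN (R : realType) (N : int) : set (heis_fun R) :=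
  [set F | cmeasurable F /\ exists2 G, HN_rep N G & ae_same F G].

Definition HN_closed_subspace (R : realType) (N : int)
    (V : set (heis_fun R)) : Prop :=
  [/\ V `<=` HN N,
      V (fun=> 0),
      forall (b : R[i]) F G, V F -> V G -> V (fun g => b * F g + G g)
    & forall (u : nat -> heis_fun R) F,
        (forall k, V (u k)) -> HN N F -> heis_cvg u F -> V F].

(* The sum, inside H_N, of the subspaces V i for i satisfying A.  All index sets
   used here are finite, so no Hilbert space completion of the algebraic sum is
   taken. *)
Definition HN_sum (R : realType) (N : int) (I : Type) (A : set I)
    (V : I -> set (heis_fun R)) : set (heis_fun R) :=
  [set F | HN N F /\
    exists (n : nat) (i : 'I_n -> I) (G : 'I_n -> heis_fun R),
      (forall k, A (i k) /\ V (i k) (G k)) /\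
      ae_same F (fun g => \sum_(k < n) G k g)].

Definition orthogonal_direct_sum (R : realType) (N : int) (W : set (heis_fun R))
    (I : Type) (A : set I) (V : I -> set (heis_fun R)) : Prop :=
  [/\ HN_closed_subspace N W,
      forall i, A i -> HN_closed_subspace N (V i),
      forall i j, A i -> A j -> i <> j ->
        forall F G, V i F -> V j G -> heis_inner F G = 0
    & W = HN_sum N A V].

Definition dirichlet_char (R : realType) (d : nat) (chi : int -> R[i]) : Prop :=
  [/\ (0 < d)%N,
      chi 1 = 1,
      forall m n : int, chi (m * n) = chi m * chi n,
      forall n : int, chi (n + d%:Z) = chi n
    & forall n : int, (chi n != 0) = coprimez n d%:Z].

Definition char_restr (R : realType) (d : nat) (chi : int -> R[i]) :
    int -> R[i] :=
  fun n => if coprimez n d%:Z then chi n else 0.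

Definition primitive_char (R : realType) (f : nat) (chi : int -> R[i]) : Prop :=
  dirichlet_char f chi /\
  forall (e : nat) (psi : int -> R[i]), (e %| f)%N -> (e < f)%N ->
    dirichlet_char e psi -> chi <> char_restr f psi.

(* chi(nd/N), read as 0 when nd/N is not an integer *)
Definition char_at_quot (R : realType) (N : int) (d : nat)
    (chi : int -> R[i]) (n : int) : R[i] :=
  if (N %| n * d%:Z)%Z then chi ((n * d%:Z) %/ N)%Z else 0.

(* [sqrtC] of a real number has argument 0 or pi/2, hence is the principal
   square root, including for N < 0. *)
Definition weil_brezin (R : realType) (N : int) (d : nat) (chi : int -> R[i])
    (f : R -> R[i]) : heis_fun R :=
  fun g => let: (a, c, z) := g in
    sqrtC (N%:~R / (totient d)%:R) * expi2pi (N%:~R * z) *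
    csumZ (fun n : int =>
      char_at_quot N d chi n * f (n%:~R + N%:~R * c) * expi2pi (n%:~R * a)).

(* F is the image of f under the extension of [weil_brezin] from Schwartz
   functions to L^2(R) by continuity. *)
Definition weil_brezin_ext (R : realType) (N : int) (d : nat)
    (chi : int -> R[i]) (f : measurableTypeR R -> R[i]) (F : heis_fun R) :
    Prop :=
  [/\ L2R f, HN N F
    & exists u : nat -> measurableTypeR R -> R[i],
      [/\ forall k, schwartz (u k),
          L2R_cvg u f
        & heis_cvg (fun k => weil_brezin N d chi (u k)) F]].

Definition HNd (R : realType) (N : int) (d : nat) (chi : int -> R[i]) :
    set (heis_fun R) :=
  [set F | exists f, weil_brezin_ext N d chi f F].

Definition between_divisors (N : int) (f : nat) : set nat :=
  [set d | (f %| d)%N /\ (d %| `|N|)%N].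

Definition HNchi (R : realType) (N : int) (f : nat) (chi : int -> R[i]) :
    set (heis_fun R) :=
  HN_sum N (between_divisors N f) (fun d => HNd N d (char_restr d chi)).

Definition primitive_index (R : realType) (N : int) :
    set (nat * (int -> R[i])) :=
  [set p | (p.1 %| `|N|)%N /\ primitive_char p.1 p.2].

Definition hecke (R : realType) (m : int) (F : heis_fun R) : heis_fun R :=
  fun g => let: (a, c, z) := g in
    (`|m|%N%:R)^-1 *
    \sum_(j < `|m|%N) F ((a + j%:R) / m%:~R, m%:~R * c, z).

(* Main.v *)
Require Import Defs.
From HB Require Import structures.
From mathcomp Require Import all_boot all_order all_algebra.
From mathcomp Require Import complex.
From mathcomp Require Import all_classical all_reals all_analysis.
From mathcomp Require Import measurable_realfun.
From mathcomp Require Import ring lra zify.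
From mathcomp Require cyclic.
Import Order.TTheory GRing.Theory Num.Theory numFieldNormedType.Exports.
Set Implicit Arguments.
Unset Strict Implicit.
Unset Printing Implicit Defensive.
Local Open Scope classical_set_scope.
Local Open Scope complex_scope.
Local Open Scope ring_scope.

(** A function in H_N is e(Nz) g(a,c) with g quasi-periodic: g(a+1,c) = g(a,c) and
    g(a,c+1) = e(-Na) g(a,c).  Write X_r g(a,c) = e(ra) g(a,c+r/N).  Decomposing g
    under the translations a -> a + j/N gives g = sum_(r mod N) X_r g_r, where each g_r
    has period 1/N in a; so H_N looks like C^(Z/N) tensor H_0, with H_0 the space of such
    g_r, and every N-periodic v : Z -> C defines a closed subspace of all
    S_v phi = sum_r v(r) X_r phi.

    The map W_{N,d}(chi) is sqrt(C_{N,d}) S_v W_0 with v(n) = chi(nd/N), where W_0 is a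
    multiple of an isometry of L^2(R) onto H_0: it is an isometry on compactly supported
    functions by Parseval for a discrete average over a, and its range is dense because
    products of a trigonometric polynomial in a and a smooth bump in c are of the form
    X_r W_0 u.  Hence H_{N,d}(chi) is the subspace attached to v, and the theorem becomes a
    statement on N-periodic functions.

    Multiplication by residues prime to N acts on the functions chi(nd/N) by characters,
    which together with their supports gives orthogonality, and averaging over that
    group shows that they span.  Finally T_m S_v phi = S_(v(m.)) phi', and v(m.) is again a
    combination of the functions attached to the same primitive character. *)

(** * Complex-valued measurable functions *)

(** Elements of H_N are classes, and the character condition holds only almost everywhere, whereas
    X_r and T_m move points around. Each class is therefore represented by a g that is
    quasi-periodic at every point; null sets come back only when functions on the group are
    compared. Identifying H_{N,d}(chi) has a soft half and a hard half. Closedness of the attached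
    subspace is soft: it is the kernel of id minus a projection built from finitely many
    translations and multiplications, all bounded. Surjectivity is hard, since a preimage in L^2(R)
    must be produced; isometry and density only give a Cauchy sequence of Schwartz functions, and
    completeness of L^2(R) supplies the limit. Norms enter only squared, so |x + y|^2 <= 2 (|x|^2 +
    |y|^2) stands in for the triangle inequality, and inner products come from norms by
    polarization, so that isometries preserve them automatically. The sign of N is kept: sums run
    over |N| residues while phases have N in the denominator, and |N|/N = sgn N, being an integer,
    disappears inside e(.). *)

Section Complex.
Variable R : realType.
Implicit Types (w : R[i]) (x y : R).

Lemma sqmod_ge0 w : 0 <= sqmod w.
Proof. by rewrite addr_ge0 // sqr_ge0. Qed.

Lemma sqmod0 : sqmod (0 : R[i]) = 0.
Proof. by rewrite /sqmod /= expr0n /= addr0. Qed.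

Lemma sqmod1 : sqmod (1 : R[i]) = 1.
Proof. by rewrite /sqmod /= expr0n /= addr0 expr1n. Qed.

Lemma sqmodM w w' : sqmod (w * w') = sqmod w * sqmod w'.
Proof. by case: w w' => a b [c d]; rewrite /sqmod /=; ring. Qed.

Lemma sqmodN w : sqmod (- w) = sqmod w.
Proof. by case: w => a b; rewrite /sqmod /= !sqrrN. Qed.

Lemma sqmod_eq0 w : sqmod w = 0 -> w = 0.
Proof.
case: w => a b; rewrite /sqmod /= => /eqP.
by rewrite paddr_eq0 ?sqr_ge0 // !sqrf_eq0 => /andP[/eqP-> /eqP->].
Qed.

(** The parallelogram law with |w - w'|^2 dropped. It replaces the triangle inequality wherever
    squared norms are compared. *)
Lemma sqmodD w w' : sqmod (w + w') <= 2 * (sqmod w + sqmod w').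
Proof.
case: w w' => a b [c d]; rewrite /sqmod /=.
have := sqr_ge0 (a - c); have := sqr_ge0 (b - d).
rewrite !expr2; lra.
Qed.

Lemma sqmodB w w' : sqmod (w - w') <= 2 * (sqmod w + sqmod w').
Proof. by rewrite (le_trans (sqmodD _ _)) // sqmodN. Qed.

Lemma sqmod_Re w : complex.Re w ^+ 2 <= sqmod w.
Proof. by rewrite lerDl sqr_ge0. Qed.

Lemma sqmod_Im w : complex.Im w ^+ 2 <= sqmod w.
Proof. by rewrite lerDr sqr_ge0. Qed.

Lemma mul_conj w : w * w^* = (sqmod w)%:C.
Proof. by case: w => a b; rewrite /sqmod; simpc; congr (_ +i* _) => /=; ring. Qed.

(** Polarization: integrals of products reduce to integrals of squared moduli. *)
Lemma complexRe_inv w w' : (complex.Re (w * w'^*)) = 4^-1 * (sqmod (w + w') - sqmod (w - w')).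
Proof. by case: w w' => a b [c d]; rewrite /sqmod; simpc => /=; field. Qed.

Lemma expi2piD x y : expi2pi (x + y) = expi2pi x * expi2pi y.
Proof.
rewrite /expi2pi mulrDr cosD sinD; simpc; congr (_ +i* _).
by rewrite addrC.
Qed.

Lemma expi2pi0 : expi2pi (0 : R) = 1.
Proof. by rewrite /expi2pi mulr0 cos0 sin0. Qed.

Lemma expi2pi_nat (n : nat) : expi2pi (n%:R : R) = 1.
Proof.
elim: n => [|n IH]; first exact: expi2pi0.
rewrite -natr1 expi2piD IH mul1r /expi2pi mulr1.
by rewrite mulr_natl cos2pi sin2pi.
Qed.

Lemma expi2piN x : expi2pi (- x) = (expi2pi x)^*.
Proof. by rewrite /expi2pi mulrN cosN sinN. Qed.

Lemma sqmod_expi x : sqmod (expi2pi x) = 1.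
Proof. by rewrite /sqmod /= cos2Dsin2. Qed.

Lemma expi2piNM x : expi2pi x * expi2pi (- x) = 1.
Proof. by rewrite -expi2piD subrr expi2pi0. Qed.

Lemma expi2pi_neq0 x : expi2pi x != 0.
Proof.
apply/eqP => H; have := sqmod_expi x; rewrite H sqmod0 => /eqP.
by rewrite eq_sym oner_eq0.
Qed.

Lemma expi2pi_int (n : int) : expi2pi (n%:~R : R) = 1.
Proof.
case: n => n; first by rewrite -pmulrn expi2pi_nat.
by rewrite NegzE mulrNz expi2piN -pmulrn expi2pi_nat conjC1.
Qed.

Lemma expi2piDz x (n : int) : expi2pi (x + n%:~R) = expi2pi x.
Proof. by rewrite expi2piD expi2pi_int mulr1. Qed.

Lemma expi2piX x (n : nat) : expi2pi x ^+ n = expi2pi (x * n%:R).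
Proof.
elim: n => [|n IH]; first by rewrite mulr0 expi2pi0 expr0.
by rewrite exprS IH -expi2piD -natr1 mulrDr mulr1 addrC.
Qed.

End Complex.

Section CMeasurable.
Context (R : realType) d (T : measurableType d).
Implicit Types F G : T -> R[i].

Lemma cmeas_cst (w : R[i]) : cmeasurable (fun _ : T => w).
Proof. by split; apply: measurable_cst. Qed.

Lemma cmeasD F G : cmeasurable F -> cmeasurable G -> cmeasurable (fun x => F x + G x).
Proof.
move=> [F1 F2] [G1 G2]; split.
- rewrite (_ : (fun _ => _) = (fun x => complex.Re (F x) + complex.Re (G x))).
    exact: measurable_funD.
  by apply/funext => x; case: (F x) (G x) => ? ? [? ?].
- rewrite (_ : (fun _ => _) = (fun x => complex.Im (F x) + complex.Im (G x))).
    exact: measurable_funD.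
  by apply/funext => x; case: (F x) (G x) => ? ? [? ?].
Qed.

Lemma cmeasM F G : cmeasurable F -> cmeasurable G -> cmeasurable (fun x => F x * G x).
Proof.
move=> [F1 F2] [G1 G2]; split.
- rewrite (_ : (fun _ => _) = (fun x => complex.Re (F x) * complex.Re (G x) - complex.Im (F x) * complex.Im (G x))).
    by apply: measurable_funB; exact: measurable_funM.
  by apply/funext => x; case: (F x) (G x) => ? ? [? ?].
- rewrite (_ : (fun _ => _) = (fun x => complex.Re (F x) * complex.Im (G x) + complex.Im (F x) * complex.Re (G x))).
    by apply: measurable_funD; exact: measurable_funM.
  by apply/funext => x; case: (F x) (G x) => ? ? [? ?].
Qed.

Lemma cmeasN F : cmeasurable F -> cmeasurable (fun x => - F x).
Proof.
move=> mF; rewrite (_ : (fun _ => _) = (fun x => (-1) * F x)); last first.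
  by apply/funext => x; rewrite mulN1r.
exact/cmeasM/mF/cmeas_cst.
Qed.

Lemma cmeasB F G : cmeasurable F -> cmeasurable G -> cmeasurable (fun x => F x - G x).
Proof. by move=> mF mG; apply/cmeasD/cmeasN. Qed.

Lemma cmeas_conj F : cmeasurable F -> cmeasurable (fun x => (F x)^*).
Proof.
move=> [F1 F2]; split.
- by rewrite (_ : (fun _ => _) = (fun x => complex.Re (F x)))//; apply/funext => x; case: (F x).
- rewrite (_ : (fun _ => _) = (fun x => - complex.Im (F x))); first exact: measurable_funN.
  by apply/funext => x; case: (F x).
Qed.

Lemma cmeas_sum (I : Type) (s : seq I) (F : I -> T -> R[i]) :
  (forall i, cmeasurable (F i)) -> cmeasurable (fun x => \sum_(i <- s) F i x).
Proof.
move=> mF; elim: s => [|i s IH].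
  rewrite (_ : (fun _ => _) = (fun _ => 0)); first exact: cmeas_cst.
  by apply/funext => x; rewrite big_nil.
rewrite (_ : (fun _ => _) = (fun x => F i x + \sum_(i <- s) F i x)); first exact: cmeasD.
by apply/funext => x; rewrite big_cons.
Qed.

Lemma cmeas_expi (f : T -> measurableTypeR R) : measurable_fun setT f ->
  cmeasurable (fun x => expi2pi (f x)).
Proof.
move=> mf; split.
- apply: (@measurableT_comp _ _ _ _ _ _ (fun x : R => cos (2 * pi * x))) => //.
  apply: continuous_measurable_fun => x.
  by apply: continuous_comp; [exact: mulrl_continuous|exact: continuous_cos].
- apply: (@measurableT_comp _ _ _ _ _ _ (fun x : R => sin (2 * pi * x))) => //.
  apply: continuous_measurable_fun => x.
  by apply: continuous_comp; [exact: mulrl_continuous|exact: continuous_sin].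
Qed.

Lemma cmeas_comp d' (T' : measurableType d') (f : T' -> T) F :
  cmeasurable F -> measurable_fun setT f -> cmeasurable (fun x => F (f x)).
Proof.
by move=> [F1 F2] mf; split; [exact: (measurableT_comp F1 mf)|exact: (measurableT_comp F2 mf)].
Qed.

Lemma cmeas_sqmod F : cmeasurable F -> measurable_fun setT (fun x => sqmod (F x)).
Proof. by move=> [F1 F2]; apply: measurable_funD; exact: measurable_funX. Qed.

Lemma cmeas_esqmod F : cmeasurable F -> measurable_fun setT (fun x => (sqmod (F x))%:E).
Proof. by move=> mF; apply/measurable_EFinP/cmeas_sqmod. Qed.

Lemma cmeas_if (b : T -> bool) F G : measurable_fun setT b -> cmeasurable F -> cmeasurable G ->
  cmeasurable (fun x => if b x then F x else G x).
Proof.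
move=> mb [F1 F2] [G1 G2]; split.
- rewrite (_ : (fun _ => _) = (fun x => if b x then complex.Re (F x) else complex.Re (G x))).
    exact: measurable_fun_ifT.
  by apply/funext => x; case: ifP.
- rewrite (_ : (fun _ => _) = (fun x => if b x then complex.Im (F x) else complex.Im (G x))).
    exact: measurable_fun_ifT.
  by apply/funext => x; case: ifP.
Qed.

Lemma cmeas_lim (F_ : nat -> T -> R[i]) F : (forall k, cmeasurable (F_ k)) ->
  (forall x, (fun k => complex.Re (F_ k x)) @ \oo --> complex.Re (F x)) ->
  (forall x, (fun k => complex.Im (F_ k x)) @ \oo --> complex.Im (F x)) ->
  cmeasurable F.
Proof.
move=> mF c1 c2; split.
- apply: (@measurable_fun_cvg _ _ _ _ (fun k x => complex.Re (F_ k x))) => //.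
  by move=> m; case: (mF m).
- apply: (@measurable_fun_cvg _ _ _ _ (fun k x => complex.Im (F_ k x))) => //.
  by move=> m; case: (mF m).
Qed.

End CMeasurable.

(** * Affine changes of variables and integration on the torus *)

Section Affine.
Variable R : realType.
Local Notation lam := (@lebesgue_measure R).
Local Notation T1 := (measurableTypeR R).

Lemma measurable_affine (al be : R) :
  measurable_fun setT (fun x : T1 => al * x + be : T1).
Proof. by apply: measurable_funD => //; exact: measurable_funM. Qed.

(** By uniqueness of Lebesgue measure: |al| times the image of [lam] under the affine map gives
    every half-open interval its length. For al < 0 the preimage of such an interval is half-open on
    the other side, which does not change its length. *)
Lemma lebesgue_affine (al be : R) (A : set T1) : al != 0 -> measurable A ->
  lam ((fun x : T1 => al * x + be : T1) @^-1` A) = ((`|al|^-1)%:E * lam A)%E.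
Proof.
move=> al0 mA.
pose h := fun x : T1 => al * x + be : T1.
have ge0 : 0 <= `|al| by [].
pose mu' := mscale (NngNum ge0) (pushforward lam h).
pose mu := mu' (measurable_affine al be).
have E X : measurable X -> lam X = mu X.
  apply: lebesgue_measure_unique => _ [[a b]] /= ab <-.
  rewrite /mu /mu' /mscale /pushforward lebesgue_measure_itv /=.
  case: (ltP al 0) => [an|ap].
    rewrite [pushforward _ _ _](_ : _ = lam `[(b - be) / al, (a - be) / al[%classic); last first.
      rewrite /pushforward; congr (lam _); rewrite /h; apply/seteqP; split=> x /=; rewrite !in_itv /= ?ler_ndivrMr ?ltr_ndivlMr // mulrC ltrBlDr lerBrDr => /andP[-> ->] //.
    rewrite lebesgue_measure_itv /= !lte_fin ltr_ndivlMr // divfK // ltrD2r.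
    case: ifPn => // H; last by rewrite mule0.
    rewrite -!EFinB -EFinM; congr EFin.
    by rewrite ltr0_norm //; field.
  have {}ap : 0 < al by rewrite lt_neqAle eq_sym al0.
  rewrite [pushforward _ _ _](_ : _ = lam `](a - be) / al, (b - be) / al]%classic); last first.
    rewrite /pushforward; congr (lam _); rewrite /h; apply/seteqP; split=> x /=; rewrite !in_itv /= ?ler_pdivlMr ?ltr_pdivrMr // mulrC ltrBlDr lerBrDr => /andP[-> ->] //.
  rewrite lebesgue_measure_itv /= !lte_fin ltr_pdivlMr // divfK // ltrD2r.
  case: ifPn => // H; last by rewrite mule0.
  rewrite -!EFinB -EFinM; congr EFin.
  by rewrite gtr0_norm //; field.
rewrite (E A) // /mu /mscale /pushforward /= muleA -EFinM mulVf ?mul1e //.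
by rewrite normr_eq0.
Qed.

Lemma ge0_integral_affine (al be : R) (f : R -> \bar R) : al != 0 ->
  measurable_fun setT (f : T1 -> \bar R) -> (forall x, (0 <= f x)%E) ->
  (\int[lam]_x f (al * x + be)%R = (`|al|^-1)%:E * \int[lam]_x f x)%E.
Proof.
move=> al0 mf f0.
pose h := fun x : T1 => al * x + be : T1.
have ge0 : 0 <= `|al|^-1 by rewrite invr_ge0.
transitivity (\int[pushforward lam h]_x f x)%E.
  by rewrite (ge0_integral_pushforward (measurable_affine al be)).
transitivity (\int[mscale (NngNum ge0) lam]_x f x)%E; last first.
  by rewrite ge0_integral_mscale.
apply: eq_measure_integral => //; first exact: measurable_affine. move=> mh A mA _.
by rewrite /= /pushforward /mscale /= -(lebesgue_affine be).
Qed.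

Lemma ge0_integral_shift (be : R) (f : R -> \bar R) :
  measurable_fun setT (f : T1 -> \bar R) -> (forall x, (0 <= f x)%E) ->
  (\int[lam]_x f (x + be)%R = \int[lam]_x f x)%E.
Proof.
move=> mf f0; rewrite -[RHS]mul1e -(_ : (`|1|^-1)%:E = 1%E); last by rewrite normr1 invr1.
rewrite -(@ge0_integral_affine 1 be f) ?oner_eq0 //.
by apply: eq_integral => x _; rewrite mul1r.
Qed.

Lemma lebesgue_shift (be : R) (A : set T1) : measurable A ->
  lam ((fun x : T1 => x + be : T1) @^-1` A) = lam A.
Proof.
move=> mA; rewrite -[RHS]mul1e -(_ : (`|1|^-1)%:E = 1%E); last by rewrite normr1 invr1.
rewrite -(@lebesgue_affine 1 be) ?oner_eq0 //; congr (lam _).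
by apply/seteqP; split=> x /=; rewrite mul1r.
Qed.

(** One family containing both the left translations by integer points (al = ga = 1, ka = q) and the
    substitutions ((a + j)/m, m c, z) of the Hecke operators, so that null sets are treated once for
    both. *)
Definition shear_affine (al be ga de ka rh : R) (g : heis R) : heis R :=
  (al * g.1.1 + be, ga * g.1.2 + de, g.2 + (ka * g.1.1 + rh)).

Lemma measurable_shear_affine (al be ga de ka rh : R) :
  measurable_fun setT (shear_affine al be ga de ka rh).
Proof.
have m1 : measurable_fun setT (fun g : heis R => g.1.1 : T1).
  exact: measurableT_comp measurable_fst measurable_fst.
have m2 : measurable_fun setT (fun g : heis R => g.1.2 : T1).
  exact: measurableT_comp measurable_snd measurable_fst.
apply: measurable_fun_pair; first apply: measurable_fun_pair.
- exact: (measurableT_comp (measurable_affine al be) m1).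
- exact: (measurableT_comp (measurable_affine ga de) m2).
- apply: measurable_funD; first exact: measurable_snd.
  exact: (measurableT_comp (measurable_affine ka rh) m1).
Qed.

Lemma haarE (A : set (heis R)) :
  haar R A = (\int[lam \x lam]_p lam (xsection A p))%E.
Proof. by []. Qed.

(** The z-section of the preimage is a translate of a z-section of A. Tonelli then leaves one affine
    substitution in a and one in c, and these only multiply the integral by constants. *)
Lemma haar_null_shear_affine (al be ga de ka rh : R) (A : set (heis R)) :
  al != 0 -> ga != 0 -> measurable A -> haar R A = 0%E ->
  haar R (shear_affine al be ga de ka rh @^-1` A) = 0%E.
Proof.
move=> al0 ga0 mA A0.
pose psi (p : T1 * T1) := lam (xsection A p).
have mpsi : measurable_fun setT psi by exact: measurable_fun_xsection.
have psi0 p : (0 <= psi p)%E by exact: measure_ge0.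
have m2 : measurable_fun setT (fun p : T1 * T1 => ((al * p.1 + be, ga * p.2 + de) : T1 * T1)).
  apply: measurable_fun_pair.
  - exact: (measurableT_comp (measurable_affine al be) measurable_fst).
  - exact: (measurableT_comp (measurable_affine ga de) measurable_snd).
have E : haar R (shear_affine al be ga de ka rh @^-1` A) =
   (\int[lam \x lam]_p psi (al * p.1 + be, ga * p.2 + de)%R)%E.
  rewrite haarE; apply: eq_integral => p _.
  rewrite /psi -[RHS](lebesgue_shift (ka * p.1 + rh)); last exact: measurable_xsection.
  congr (lam _); apply/seteqP; split => z /=; rewrite /xsection /= !inE //.
rewrite E (fubini_tonelli1 (fun p : T1 * T1 => psi (al * p.1 + be, ga * p.2 + de))) //; last first.
  exact: (measurableT_comp mpsi m2).
rewrite /fubini_F /=.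
pose Psi a := (\int[lam]_c psi (a, c))%E.
have mPsi : measurable_fun setT Psi by exact: measurable_fun_fubini_tonelli_F.
have mc a : measurable_fun setT (fun c : T1 => psi (a, c)).
  exact: (measurableT_comp mpsi (pair1_measurable a)).
transitivity (\int[lam]_x ((`|ga|^-1)%:E * Psi (al * x + be)%R))%E.
  by apply: eq_integral => x _; rewrite (@ge0_integral_affine ga de (fun c => psi (al * x + be, c))).
have Psi0 a : (0 <= Psi a)%E by exact: integral_ge0.
rewrite ge0_integralZl //; last exact: (measurableT_comp mPsi (measurable_affine al be)).
rewrite ge0_integral_affine // (_ : (\int[lam]_x Psi x = 0)%E) ?mule0 //.
by rewrite -A0 haarE (fubini_tonelli1 psi).
Qed.

Lemma haar_ae_shear_affine (al be ga de ka rh : R) (P : heis R -> Prop) :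
  al != 0 -> ga != 0 -> {ae haar R, forall g, P g} ->
  {ae haar R, forall g, P (shear_affine al be ga de ka rh g)}.
Proof.
move=> al0 ga0 [A [mA A0 PA]].
exists (shear_affine al be ga de ka rh @^-1` A); split.
- rewrite -[X in measurable X]setTI.
  exact: measurable_shear_affine.
- exact: haar_null_shear_affine.
- by move=> g /= Pg; exact: PA.
Qed.

Lemma haar_ae_heisZ (p q r : int) (P : heis R -> Prop) :
  {ae haar R, forall g, P g} ->
  {ae haar R, forall g, P (heis_mul (heisZ R p q r) g)}.
Proof.
move=> aeP.
have := @haar_ae_shear_affine 1 p%:~R 1 q%:~R q%:~R r%:~R P (oner_neq0 _) (oner_neq0 _) aeP.
apply: filterS => -[[a c] z]; rewrite /shear_affine /= !mul1r.
by rewrite (addrC a) (addrC c) addrCA -addrA addrCA [q%:~R * a + _]addrC (addrA z) (addrC z) -addrA.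
Qed.

End Affine.

Section IteratedIntegrals.
Local Open Scope ereal_scope.
Context d1 d2 (X : measurableType d1) (Y : measurableType d2) (R : realType).
Variables (m1 : {sigma_finite_measure set X -> \bar R})
  (m2 : {sigma_finite_measure set Y -> \bar R}).
Variables (A : set X) (B : set Y) (f : X * Y -> \bar R).
Hypotheses (mA : measurable A) (mB : measurable B).
Hypotheses (mf : measurable_fun setT f) (f0 : forall z, 0 <= f z).

Let fAB : X * Y -> \bar R := f \_ (A `*` B).

Let fABE x y : fAB (x, y) = if x \in A then (if y \in B then f (x, y) else 0) else 0.
Proof.
rewrite /fAB /patch; have [xA|xA] := boolP (x \in A); last first.
  by rewrite memNset // => -[/= xA' _]; move/negP: xA; rewrite inE.
have [yB|yB] := boolP (y \in B); last first.
  by rewrite memNset // => -[/= _ yB']; move/negP: yB; rewrite inE.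
by rewrite mem_set //; split=> /=; apply: set_mem.
Qed.

Let mfAB : measurable_fun setT fAB.
Proof.
by apply/(measurable_restrictT f (measurableX mA mB)); exact: measurable_funS mf.
Qed.

Let fAB0 z : 0 <= fAB z.
Proof. by rewrite /fAB /patch; case: ifP. Qed.

Lemma ge0_integralX1 :
  \int[m1 \x m2]_(z in A `*` B) f z = \int[m1]_(x in A) \int[m2]_(y in B) f (x, y).
Proof.
rewrite integral_mkcond (fubini_tonelli1 fAB) // [RHS]integral_mkcond.
apply: eq_integral => x _; rewrite /fubini_F /patch.
case: ifPn => xA.
  rewrite [RHS]integral_mkcond; apply: eq_integral => y _.
  by rewrite fABE xA /patch.
by rewrite integral0_eq // => y _; rewrite fABE (negbTE xA).
Qed.

Lemma ge0_integralX2 :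
  \int[m1 \x m2]_(z in A `*` B) f z = \int[m2]_(y in B) \int[m1]_(x in A) f (x, y).
Proof.
rewrite integral_mkcond (fubini_tonelli2 fAB) // [RHS]integral_mkcond.
apply: eq_integral => y _; rewrite /fubini_G /patch.
case: ifPn => yB.
  rewrite [RHS]integral_mkcond; apply: eq_integral => x _.
  by rewrite fABE yB /patch; case: ifP.
by rewrite integral0_eq // => x _; rewrite fABE (negbTE yB); case: ifP.
Qed.

End IteratedIntegrals.

Section Torus.
Variable R : realType.
Local Notation lam := (@lebesgue_measure R).
Local Notation T1 := (measurableTypeR R).
Local Notation T2 := (T1 * T1)%type.
Local Notation I01 := (`[0 : R, 1 : R]%classic : set T1).

Lemma lebesgue_I01 : lam I01 = 1%E.
Proof. by rewrite lebesgue_measure_itv /= lte_fin ltr01 oppr0 adde0. Qed.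

Lemma measurable_I01 : measurable I01.
Proof. exact: measurable_itv. Qed.

Lemma integral_interval_shift (a b t : R) (h : R -> \bar R) :
  measurable_fun setT (h : T1 -> \bar R) -> (forall x, (0 <= h x)%E) ->
  (\int[lam]_(x in `[a, b]) h (x + t)%R = \int[lam]_(x in `[(a + t)%R, (b + t)%R]) h x)%E.
Proof.
move=> mh h0; rewrite integral_mkcond [RHS]integral_mkcond.
rewrite -(@ge0_integral_shift R t (h \_ `[(a + t)%R, (b + t)%R])).
- apply: eq_integral => x _; rewrite /patch.
  congr (if _ then _ else _).
  apply/idP/idP; rewrite !inE /= !in_itv /= !lerD2r //.
- apply/(measurable_restrictT h) => //; exact: measurable_funS mh.
- by move=> x; rewrite /patch; case: ifP.
Qed.

Lemma integral_split (a b c : R) (h : R -> \bar R) : a <= b -> b <= c ->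
  measurable_fun setT (h : T1 -> \bar R) -> (forall x, (0 <= h x)%E) ->
  (\int[lam]_(x in `[a, c]) h x = \int[lam]_(x in `[a, b]) h x + \int[lam]_(x in `[b, c]) h x)%E.
Proof.
move=> ab bc mh h0.
rewrite -(@integral_itv_obnd_cbnd R b (BRight c)); last by apply: measurable_funS mh.
rewrite -ge0_integral_setU //=.
- by rewrite -itv_bndbnd_setU // bnd_simp.
- exact: measurable_funS mh.
- apply/disj_setPS => x /= []; rewrite !in_itv /= => /andP[_ xb] /andP[bx _].
  by move: (lt_le_trans bx xb); rewrite ltxx.
Qed.

Lemma periodic_int (h : R -> \bar R) (n : int) x : (forall x, h (x + 1)%R = h x) ->
  h (x + n%:~R)%R = h x.
Proof.
move=> hp; have Hn (k : nat) y : h (y + k%:R)%R = h y.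
  elim: k y => [|k IH] y; first by rewrite addr0.
  by rewrite -natr1 addrA hp.
case: n => n; first by rewrite -pmulrn.
by rewrite NegzE mulrNz -pmulrn -[LHS](Hn n.+1) subrK.
Qed.

Lemma integral_periodic_shift (t : R) (h : R -> \bar R) :
  measurable_fun setT (h : T1 -> \bar R) -> (forall x, (0 <= h x)%E) ->
  (forall x, h (x + 1)%R = h x) ->
  (\int[lam]_(x in I01) h (x + t)%R = \int[lam]_(x in I01) h x)%E.
Proof.
move=> mh h0 hp.
wlog /andP[t0 t1] : t / 0 <= t <= 1.
  move=> H; have /andP[f1 f2] := Num.Theory.floor_itv t.
  rewrite -(H (t - (Num.floor t)%:~R)); last first.
    rewrite subr_ge0 f1 /= lerBlDr addrC ltW //.
    by rewrite -[1]/(1%:~R) -intrD.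
  apply: eq_integral => x _.
  rewrite -[in RHS](periodic_int (Num.floor t)) //; congr h; ring.
rewrite integral_interval_shift // add0r.
(* The interval [t, 1 + t] is cut at 1, and its right piece is moved back by one period onto
   [0, t]. *)
rewrite (@integral_split t 1) ?lerDl // [RHS](@integral_split 0 t) //.
rewrite addeC; congr (_ + _)%E.
have := @integral_interval_shift 0 t 1 h mh h0.
rewrite add0r [(t + 1)%R]addrC => <-.
by apply: eq_integral => x _; rewrite hp.
Qed.

Definition unit_sq : set T2 := I01 `*` I01.

Lemma measurable_unit_sq : measurable unit_sq.
Proof. exact: measurableX. Qed.

(* The library declares a canonical sigma-finite structure only for products of
   subprobabilities, hence this named copy of the product measure. *)
Definition lam2 : set T2 -> \bar R := (lam \x lam)%E.

HB.instance Definition _ := Measure.on lam2.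

Lemma sigma_finite_lam2 : sigma_finite setT lam2.
Proof.
have /sigma_finiteP[F [TF ndF Foo]] := sigma_finiteT lam.
exists (fun n => F n `*` F n).
  rewrite -setXTT {1 2}TF predeqE => -[x y]; split.
    move=> [/= [n _ Fnx] [k _ Fky]]; exists (maxn n k) => //; split.
    - by move: x Fnx; exact/subsetPset/ndF/leq_maxl.
    - by move: y Fky; exact/subsetPset/ndF/leq_maxr.
  by move=> [n _ []/= ? ?]; split; exists n.
move=> k; have [? ?] := Foo k.
split; first exact: measurableX.
rewrite (_ : lam2 _ = (lam (F k) * lam (F k))%E); last exact: product_measure1E.
by rewrite lte_mul_pinfty // ge0_fin_numE.
Qed.

HB.instance Definition _ := Measure_isSigmaFinite.Build _ _ _ lam2 sigma_finite_lam2.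

Lemma lam2_unit_sq : lam2 unit_sq = 1%E.
Proof.
transitivity (lam I01 * lam I01)%E; last by rewrite lebesgue_I01 mule1.
exact: product_measure1E.
Qed.

Lemma integral_lam21 (A B : set T1) (h : T2 -> \bar R) :
  measurable A -> measurable B ->
  measurable_fun setT h -> (forall p, (0 <= h p)%E) ->
  (\int[lam2]_(p in A `*` B) h p = \int[lam]_(a in A) \int[lam]_(c in B) h (a, c))%E.
Proof. by move=> mA mB mh h0; exact: (ge0_integralX1 lam lam mA mB mh h0). Qed.

Lemma integral_lam22 (A B : set T1) (h : T2 -> \bar R) :
  measurable A -> measurable B ->
  measurable_fun setT h -> (forall p, (0 <= h p)%E) ->
  (\int[lam2]_(p in A `*` B) h p = \int[lam]_(c in B) \int[lam]_(a in A) h (a, c))%E.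
Proof. by move=> mA mB mh h0; exact: (ge0_integralX2 lam lam mA mB mh h0). Qed.

Lemma integral_shift_fst (t : R) (h : T2 -> \bar R) :
  measurable_fun setT h -> (forall p, (0 <= h p)%E) ->
  (forall a c, h (a + 1, c)%R = h (a, c)) ->
  (\int[lam2]_(p in unit_sq) h (p.1 + t, p.2)%R = \int[lam2]_(p in unit_sq) h p)%E.
Proof.
move=> mh h0 hp; have mI := measurable_I01.
have ms : measurable_fun setT (fun p : T2 => (p.1 + t, p.2)%R : T2).
  apply: measurable_fun_pair; last exact: measurable_snd.
  by apply: measurable_funD => //; exact: measurable_fst.
have mhs := measurableT_comp mh ms.
rewrite (integral_lam22 mI mI mh h0) (integral_lam22 mI mI mhs (fun p => h0 _)).
apply: eq_integral => c _ /=.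
apply: (@integral_periodic_shift t (fun a => h (a, c))) => //.
exact: (measurableT_comp mh (pair2_measurable c)).
Qed.

Lemma integral_shift_snd (t : R) (h : T2 -> \bar R) :
  measurable_fun setT h -> (forall p, (0 <= h p)%E) ->
  (forall a c, h (a, c + 1)%R = h (a, c)) ->
  (\int[lam2]_(p in unit_sq) h (p.1, p.2 + t)%R = \int[lam2]_(p in unit_sq) h p)%E.
Proof.
move=> mh h0 hp; have mI := measurable_I01.
have ms : measurable_fun setT (fun p : T2 => (p.1, p.2 + t)%R : T2).
  apply: measurable_fun_pair; first exact: measurable_fst.
  by apply: measurable_funD => //; exact: measurable_snd.
have mhs := measurableT_comp mh ms.
rewrite (integral_lam21 mI mI mh h0) (integral_lam21 mI mI mhs (fun p => h0 _)).
apply: eq_integral => a _ /=.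
apply: (@integral_periodic_shift t (fun c => h (a, c))) => //.
exact: (measurableT_comp mh (pair1_measurable a)).
Qed.

Lemma cubeE : cube R = unit_sq `*` I01.
Proof. by []. Qed.

Lemma measurable_cube : measurable (cube R).
Proof. by rewrite cubeE; apply: measurableX => //; exact: measurable_unit_sq. Qed.

Lemma integral_cube_cylinder (h : T2 -> \bar R) :
  measurable_fun setT h -> (forall p, (0 <= h p)%E) ->
  (\int[haar R]_(g in cube R) h g.1 = \int[lam2]_(p in unit_sq) h p)%E.
Proof.
move=> mh h0.
pose f (g : T2 * T1) := h g.1.
have mf : measurable_fun setT f by exact: (measurableT_comp mh measurable_fst).
have f0 g : (0 <= f g)%E by exact: h0.
transitivity (\int[(lam2 \x lam)]_(z in unit_sq `*` I01) f z)%E; first by [].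
rewrite (ge0_integralX1 lam2 lam measurable_unit_sq measurable_I01 mf f0).
apply: eq_integral => p _; rewrite /f.
rewrite -[RHS]mule1 -lebesgue_I01.
exact: (integral_cst lam measurable_I01 (h p)).
Qed.

Definition tsq (g : T2 -> R[i]) : \bar R :=
  (\int[lam2]_(p in unit_sq) (sqmod (g p))%:E)%E.

Lemma tsq_ge0 g : (0 <= tsq g)%E.
Proof. by apply: integral_ge0 => p _; rewrite lee_fin sqmod_ge0. Qed.

Lemma tsqD g h : cmeasurable g -> cmeasurable h ->
  (tsq (fun p => (g p + h p)%R) <= 2%:E * (tsq g + tsq h))%E.
Proof.
move=> mg mh.
have m1 : measurable_fun unit_sq (fun p => (sqmod (g p))%:E).
  by apply: measurable_funS (cmeas_esqmod mg).
have m2 : measurable_fun unit_sq (fun p => (sqmod (h p))%:E).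
  by apply: measurable_funS (cmeas_esqmod mh).
have ms := measurable_unit_sq.
rewrite /tsq -ge0_integralD //; last 2 first.
- by move=> p _; rewrite lee_fin sqmod_ge0.
- by move=> p _; rewrite lee_fin sqmod_ge0.
rewrite -ge0_integralZl //; last 2 first.
- exact: emeasurable_funD.
- by move=> p _; rewrite -EFinD lee_fin addr_ge0 // sqmod_ge0.
apply: ge0_le_integral => //.
- by move=> p _; rewrite lee_fin sqmod_ge0.
- by apply: measurable_funS (cmeas_esqmod (cmeasD mg mh)).
- by apply: measurable_funeM; exact: emeasurable_funD.
- by move=> p _; rewrite -EFinD -EFinM lee_fin sqmodD.
Qed.

Lemma tsqM g (w : R[i]) : cmeasurable g ->
  tsq (fun p => w * g p) = ((sqmod w)%:E * tsq g)%E.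
Proof.
move=> mg; rewrite /tsq -ge0_integralZl //.
- by apply: eq_integral => p _; rewrite sqmodM EFinM.
- exact: measurable_unit_sq.
- by apply: measurable_funS (cmeas_esqmod mg).
- by move=> p _; rewrite lee_fin sqmod_ge0.
- by rewrite lee_fin sqmod_ge0.
Qed.

Lemma eq_tsq g h : (forall p, sqmod (g p) = sqmod (h p)) -> tsq g = tsq h.
Proof. by move=> E; apply: eq_integral => p _; rewrite E. Qed.

Lemma tsqB g h : cmeasurable g -> cmeasurable h ->
  (tsq (fun p => (g p - h p)%R) <= 2%:E * (tsq g + tsq h))%E.
Proof.
move=> mg mh; apply: le_trans (tsqD mg (cmeasN mh)) _.
by rewrite (@eq_tsq (fun p => - h p) h) // => p; rewrite sqmodN.
Qed.

Lemma tsq0 : tsq (fun=> 0) = 0%E.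
Proof. by apply: integral0_eq => p _; rewrite sqmod0. Qed.

(** The constant comes from iterating [tsqD]; the bound is used only for its finiteness. *)
Lemma tsq_sum (I : Type) (s : seq I) (F : I -> T2 -> R[i]) :
  (forall i, cmeasurable (F i)) ->
  (tsq (fun p => (\sum_(i <- s) F i p)%R) <= (2 ^+ size s)%:E * \sum_(i <- s) tsq (F i))%E.
Proof.
move=> mF; elim: s => [|i s IH].
  rewrite (_ : (fun _ => _) = (fun=> 0)) ?tsq0 ?mule_ge0 //; last first.
    by apply/funext => p; rewrite big_nil.
  by apply: sume_ge0 => i _; exact: tsq_ge0.
rewrite (_ : (fun _ => _) = (fun p => F i p + \sum_(i <- s) F i p)); last first.
  by apply/funext => p; rewrite big_cons.
apply: le_trans (tsqD (mF i) (cmeas_sum _ mF)) _.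
rewrite big_cons exprS EFinM -muleA lee_pmul2l // ge0_muleDr ?tsq_ge0 //; last first.
  by apply: sume_ge0 => j _; exact: tsq_ge0.
apply: leeD => //; rewrite -[X in (X <= _)%E]mul1e.
apply: lee_wpmul2r; first exact: tsq_ge0.
by rewrite lee_fin exprn_ege1 // ler1n.
Qed.

End Torus.

(** * Quasi-periodic functions *)

Section QuasiPeriodic.
Variables (R : realType) (N : int).
Hypothesis N0 : N != 0.
Local Notation T1 := (measurableTypeR R).
Local Notation T2 := (T1 * T1)%type.
Local Notation NR := (N%:~R : R).
Local Notation n := (`|N|%N).
Implicit Types (g h : T2 -> R[i]) (v w : int -> R[i]).

Lemma NR0 : NR != 0.
Proof. by rewrite intr_eq0. Qed.

Lemma nR0 : (n%:R : R[i]) != 0.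
Proof. by rewrite pnatr_eq0 absz_eq0. Qed.

(* If F in H_N then F(a,c,z) = e(Nz) g(a,c) with g satisfying these identities. *)
Definition qp g := [/\ cmeasurable g,
  forall a c, g (a + 1, c) = g (a, c) &
  forall a c, g (a, c + 1) = expi2pi (- (NR * a)) * g (a, c)].

Definition opX (s : int) g : T2 -> R[i] := fun p =>
  expi2pi (s%:~R * p.1) * g (p.1, p.2 + s%:~R / NR).

Definition opY (t : int) g : T2 -> R[i] := fun p => g (p.1 + t%:~R / NR, p.2).

(** The projection onto the functions that pick up the factor e(r/N) under a -> a + 1/N: a finite
    Fourier transform over the group of order |N| which this translation generates on 1-periodic
    functions. *)
Definition opP (r : int) g : T2 -> R[i] := fun p =>
  (n%:R)^-1 * \sum_(j < n) expi2pi (- (r%:~R * j%:R / NR)) * opY j g p.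

(* The component g_r of g = sum_r X_r g_r. *)
Definition opA (r : int) g := opX (- r) (opP r g).

Definition qp0 g := qp g /\ forall a c, g (a + NR^-1, c) = g (a, c).

Definition opS v g : T2 -> R[i] := fun p => \sum_(r < n) v r * opX r g p.

(** Bounded linear operators. The bound is asked on quasi-periodic functions only, because moving
    the unit square preserves the integral of a squared modulus only when this modulus is periodic.
    The kernel of such an operator is closed. *)
Record good_op (B : (T2 -> R[i]) -> T2 -> R[i]) : Prop := GoodOp {
  good_qp : forall g, qp g -> qp (B g);
  good_lin : forall b g h, B (fun p => b * g p + h p) = (fun p => b * B g p + B h p);
  good_bdd : exists2 K : R, 0 <= K & forall g, qp g -> (tsq (B g) <= K%:E * tsq g)%E }.

Lemma qp_lin b g h : qp g -> qp h -> qp (fun p => b * g p + h p).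
Proof.
move=> [mg g1 g2] [mh h1 h2]; split.
- by apply: cmeasD => //; apply: cmeasM => //; exact: cmeas_cst.
- by move=> a c; rewrite g1 h1.
- by move=> a c; rewrite g2 h2 mulrDr mulrCA.
Qed.

Lemma qp_zero : qp (fun=> 0).
Proof. by split; [exact: cmeas_cst|by []|move=> a c; rewrite mulr0]. Qed.

Lemma qpZ b g : qp g -> qp (fun p => b * g p).
Proof.
move=> /(qp_lin b)/(_ qp_zero); congr qp; apply/funext => p.
by rewrite addr0.
Qed.

Lemma qpD g h : qp g -> qp h -> qp (fun p => g p + h p).
Proof.
move=> qg /(qp_lin 1 qg); congr qp; apply/funext => p.
by rewrite mul1r.
Qed.

Lemma qpB g h : qp g -> qp h -> qp (fun p => g p - h p).
Proof.
move=> qg /(qpZ (-1)) /(qpD qg); congr qp; apply/funext => p.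
by rewrite mulN1r.
Qed.

Lemma qp_sum (I : Type) (s : seq I) (F : I -> T2 -> R[i]) :
  (forall i, qp (F i)) -> qp (fun p => \sum_(i <- s) F i p).
Proof.
move=> qF; elim: s => [|i s IH].
  rewrite (_ : (fun _ => _) = (fun=> 0)); first exact: qp_zero.
  by apply/funext => p; rewrite big_nil.
rewrite (_ : (fun _ => _) = (fun p => F i p + \sum_(i <- s) F i p)); first exact: qpD.
by apply/funext => p; rewrite big_cons.
Qed.

Lemma good_id : good_op id.
Proof. by split => //; exists 1 => // g _; rewrite mul1e. Qed.

Lemma good_scale (b0 : R[i]) B : good_op B -> good_op (fun g p => b0 * B g p).
Proof.
move=> [B1 B2 [K K0 B3]]; split.
- by move=> g qg; apply: qpZ; exact: B1.
- by move=> b g h; apply/funext => p; rewrite B2 mulrDr mulrCA.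
- exists (sqmod b0 * K); first by rewrite mulr_ge0 // sqmod_ge0.
  move=> g qg; have [mBg _ _] := B1 g qg.
  by rewrite tsqM // EFinM -muleA lee_wpmul2l ?lee_fin ?sqmod_ge0 // B3.
Qed.

Lemma good_zero : good_op (fun _ _ => 0).
Proof.
have := good_scale 0 good_id; congr good_op.
by apply/funext => g; apply/funext => p; rewrite mul0r.
Qed.

Lemma good_add B B' : good_op B -> good_op B' -> good_op (fun g p => B g p + B' g p).
Proof.
move=> [B1 B2 [K K0 B3]] [B1' B2' [K' K0' B3']]; split.
- by move=> g qg; apply: qpD; [exact: B1|exact: B1'].
- by move=> b g h; apply/funext => p; rewrite B2 B2' mulrDr addrACA.
- exists (2 * (K + K')); first by rewrite mulr_ge0 // addr_ge0.
  move=> g qg; have [mBg _ _] := B1 g qg; have [mBg' _ _] := B1' g qg.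
  apply: le_trans (tsqD mBg mBg') _.
  rewrite EFinM -muleA lee_pmul2l // EFinD ge0_muleDl ?lee_fin //.
  by apply: leeD; [exact: B3|exact: B3'].
Qed.

Lemma good_sum (I : Type) (s : seq I) (B : I -> (T2 -> R[i]) -> T2 -> R[i]) :
  (forall i, good_op (B i)) -> good_op (fun g p => \sum_(i <- s) B i g p).
Proof.
move=> gB; elim: s => [|i s IH].
  have := good_zero; congr good_op.
  by apply/funext => g; apply/funext => p; rewrite big_nil.
have := good_add (gB i) IH; congr good_op.
by apply/funext => g; apply/funext => p; rewrite big_cons.
Qed.

Lemma good_comp B B' : good_op B -> good_op B' -> good_op (fun g => B (B' g)).
Proof.
move=> [B1 B2 [K K0 B3]] [B1' B2' [K' K0' B3']]; split.
- by move=> g qg; apply: B1; exact: B1'.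
- by move=> b g h; rewrite B2' B2.
- exists (K * K'); first by rewrite mulr_ge0.
  move=> g qg; apply: le_trans (B3 _ (B1' _ qg)) _.
  by rewrite EFinM -muleA lee_wpmul2l ?lee_fin // B3'.
Qed.

Lemma good_linsum B (I : Type) (s : seq I) (b : I -> R[i]) (F : I -> T2 -> R[i]) :
  good_op B ->
  B (fun p => \sum_(i <- s) b i * F i p) = (fun p => \sum_(i <- s) b i * B (F i) p).
Proof.
move=> [_ B2 _]; elim: s => [|i s IH].
  have := B2 (-1) (fun=> 0) (fun=> 0); rewrite mulr0 addr0 => E0.
  transitivity (B (fun=> 0)); first by congr B; apply/funext => p; rewrite big_nil.
  by rewrite E0; apply/funext => p; rewrite big_nil mulN1r addNr.
transitivity (B (fun p => b i * F i p + \sum_(i <- s) b i * F i p)).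
  by congr B; apply/funext => p; rewrite big_cons.
by rewrite B2 IH; apply/funext => p; rewrite big_cons.
Qed.

Lemma measurable_shift2 (s t : R) :
  measurable_fun setT (fun p : T2 => (p.1 + s, p.2 + t) : T2).
Proof.
by apply: measurable_fun_pair; apply: measurable_funD.
Qed.

Lemma cmeas_expi_fst (s : R) : cmeasurable (fun p : T2 => expi2pi (s * p.1)).
Proof.
apply: cmeas_expi; apply: measurable_funM => //; exact: measurable_fst.
Qed.

Lemma qp_sqmod_snd g : qp g -> forall a c, sqmod (g (a, c + 1)) = sqmod (g (a, c)).
Proof. by move=> [_ _ g2] a c; rewrite g2 sqmodM sqmod_expi mul1r. Qed.

Lemma tsq_opX s g : qp g -> tsq (opX s g) = tsq g.
Proof.
move=> qg; have [mg g1 g2] := qg.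
rewrite /tsq -(@integral_shift_snd R (s%:~R / NR) (fun p => (sqmod (g p))%:E)).
- by apply: eq_integral => p _; rewrite /opX sqmodM sqmod_expi mul1r.
- exact: cmeas_esqmod.
- by move=> p; rewrite lee_fin sqmod_ge0.
- by move=> a c; rewrite qp_sqmod_snd.
Qed.

Lemma good_opX s : good_op (opX s).
Proof.
split.
- move=> g [mg g1 g2]; split.
  + apply: cmeasM; first exact: cmeas_expi_fst.
    have := cmeas_comp mg (measurable_shift2 0 (s%:~R / NR)); congr cmeasurable.
    by apply/funext => p; rewrite addr0.
  + move=> a c; rewrite /opX /= g1; congr (_ * _).
    by rewrite mulrDr mulr1 expi2piDz.
  + by move=> a c; rewrite /opX /= addrAC g2 mulrCA.
- by move=> b g h; apply/funext => p; rewrite /opX mulrDr mulrCA.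
- by exists 1 => // g qg; rewrite mul1e tsq_opX.
Qed.

Lemma good_opY t : good_op (opY t).
Proof.
split.
- move=> g [mg g1 g2]; split.
  + have := cmeas_comp mg (measurable_shift2 (t%:~R / NR) 0); congr cmeasurable.
    by apply/funext => p; rewrite addr0.
  + by move=> a c; rewrite /opY /= addrAC g1.
  + move=> a c; rewrite /opY /= g2; congr (_ * _).
    rewrite mulrDr opprD expi2piD [X in _ * expi2pi X](_ : _ = (- t)%:~R) ?expi2pi_int ?mulr1 //.
    by rewrite mulrNz mulrCA mulfV ?mulr1 // NR0.
- by [].
- exists 1 => // g [mg g1 g2]; rewrite mul1e.
  rewrite /tsq -(@integral_shift_fst R (t%:~R / NR) (fun p => (sqmod (g p))%:E)) //.
  + exact: cmeas_esqmod.
  + by move=> p; rewrite lee_fin sqmod_ge0.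
  + by move=> a c; rewrite g1.
Qed.

Lemma good_opP r : good_op (opP r).
Proof.
apply: good_scale; apply: good_sum => j; apply: good_scale; exact: good_opY.
Qed.

Lemma good_opA r : good_op (opA r).
Proof. by apply: good_comp; [exact: good_opX|exact: good_opP]. Qed.

Lemma good_opS v : good_op (opS v).
Proof. by apply: good_sum => r; apply: good_scale; exact: good_opX. Qed.

Lemma opX_add s t g : opX s (opX t g) = opX (s + t) g.
Proof.
apply/funext => -[a c]; rewrite /opX /= mulrA -expi2piD; congr (_ * g (_, _)).
  by rewrite rmorphD /= mulrDl.
by rewrite rmorphD /= mulrDl addrA.
Qed.

Lemma opX0 g : opX 0 g = g.
Proof. by apply/funext => -[a c]; rewrite /opX /= !mul0r expi2pi0 mul1r addr0. Qed.

(** This is quasi-periodicity in c, restated: X_N is the identity. Hence X_s depends only on s mod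
    N, and sums over residues make sense. *)
Lemma opXN g : qp g -> opX N g = g.
Proof.
move=> [_ _ g2]; apply/funext => -[a c]; rewrite /opX /= mulfV ?NR0 // g2.
by rewrite mulrA expi2piNM mul1r.
Qed.

Lemma opX_mod s t g : qp g -> (N %| s - t)%Z -> opX s g = opX t g.
Proof.
move=> qg /dvdzP[q /eqP]; rewrite subr_eq => /eqP ->.
have Hn (k : nat) u : opX (k%:Z * N + u) g = opX u g.
  elim: k u => [|k IH] u; first by rewrite mul0r add0r.
  by rewrite intS mulrDl mul1r -addrA addrCA -opX_add addrC -opX_add opXN ?opX_add.
case: q => k; first exact: Hn.
by rewrite -(Hn k.+1 (Negz k * N + t)) addrA -mulrDl NegzE subrr mul0r add0r.
Qed.

(** For the fractional part y of x, cos(2 pi y) = 1 forces sin(pi y) = 0, and the sine is positive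
    for 0 < y < 1. *)
Lemma expi2pi_eq1 (x : R) : expi2pi x = 1 -> exists q : int, x = q%:~R.
Proof.
move=> ex; pose y := x - (Num.floor x)%:~R.
have /andP[f1 f2] := Num.Theory.floor_itv x.
have y0 : 0 <= y by rewrite subr_ge0.
have y1 : y < 1 by rewrite ltrBlDr addrC -[1]/(1%:~R) -intrD.
have /(congr1 (@complex.Re R)) /= : expi2pi y = 1.
  by rewrite /y -mulrNz expi2piDz.
rewrite -mulrA mulr_natl cos_mulr2n cos2sin2 => H.
have {}H : sin (pi * y) = 0 by apply/eqP; rewrite -sqrf_eq0; apply/eqP; lra.
exists (Num.floor x); apply/eqP; rewrite -subr_eq0 -/y.
move: y0; rewrite le_eqVlt eq_sym => /orP[//|y0].
have := @sin_gt0_pi R (pi * y).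
by rewrite H ltxx mulr_gt0 ?pi_gt0 // gtr_pMr ?pi_gt0 // y1 => /(_ isT).
Qed.

Lemma sum_root (k : int) : \sum_(r < n) expi2pi (k%:~R * r%:R / NR) =
  if (N %| k)%Z then n%:R else 0 :> R[i].
Proof.
have E (r : nat) : expi2pi (k%:~R * r%:R / NR) = expi2pi (k%:~R / NR) ^+ r.
  by rewrite expi2piX mulrAC.
under eq_bigr do rewrite E.
case: ifPn => [/dvdzP[q ->]|ndv].
  rewrite intrM mulfK ?NR0 // expi2pi_int.
  by under eq_bigr do rewrite expr1n; rewrite sumr_const card_ord.
have zn : expi2pi (k%:~R / NR) ^+ n = 1.
  (* The exponent k |N| / N is the integer k sgn N, so a negative N does no harm. *)
  rewrite expi2piX [X in expi2pi X](_ : _ = (k * sgz N)%:~R) ?expi2pi_int //.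
  rewrite intrM -mulrA; congr (_ * _).
  apply: (mulfI NR0); rewrite mulrA mulfV ?NR0 // mul1r -intrM mulrC -abszEsg.
  by rewrite -pmulrn.
have z1 : expi2pi (k%:~R / NR) != 1 :> R[i].
  apply: contra ndv => /eqP /expi2pi_eq1[q /(congr1 ( *%R^~ NR))].
  by rewrite divfK ?NR0 // -intrM => /eqP; rewrite eqr_int => /eqP ->; exact: dvdz_mull.
apply/eqP; have : (expi2pi (k%:~R / NR) - 1) * (\sum_(r < n) expi2pi (k%:~R / NR) ^+ r) == 0.
  by rewrite -subrX1 zn subrr.
by rewrite mulf_eq0 subr_eq0 (negbTE z1).
Qed.

Lemma opY_nat (t : nat) g : qp g -> opY (t + n)%N g = opY t g.
Proof.
move=> [_ g1 _]; apply/funext => -[a c]; rewrite /opY /=.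
rewrite PoszD intrD mulrDl addrA.
have -> : (n%:Z)%:~R / NR = (sgz N)%:~R.
  apply: (mulIf NR0); rewrite divfK ?NR0 // -intrM.
  by rewrite -abszEsg.
have Hq (q : int) x : g (x + q%:~R, c) = g (x, c).
  have Hn (k : nat) y : g (y + k%:R, c) = g (y, c).
    elim: k y => [|k IH] y; first by rewrite addr0.
    by rewrite -natr1 addrA g1.
  case: q => k; first by rewrite -pmulrn.
  by rewrite NegzE mulrNz -pmulrn -[LHS](Hn k.+1) subrK.
exact: Hq.
Qed.

Lemma opP_eigen r g a c : qp g ->
  opP r g (a + NR^-1, c) = expi2pi (r%:~R / NR) * opP r g (a, c).
Proof.
move=> qg; rewrite /opP mulrCA; congr (_ * _).
pose t (j : nat) := expi2pi (- (r%:~R * j%:R / NR)) * opY j g (a, c).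
(* Translating a by 1/N turns the j-th summand into the (j+1)-st times e(r/N). The last index wraps
   around to the first, so the sum is only permuted. *)
have tn : t n = t 0%N.
  rewrite /t; have := opY_nat 0 qg; rewrite add0n => ->; congr (_ * _).
  rewrite mulr0 mul0r oppr0 expi2pi0.
  have -> : r%:~R * n%:R / NR = (r * sgz N)%:~R.
    rewrite intrM -mulrA; congr (_ * _); apply: (mulIf NR0); rewrite divfK ?NR0 //.
    by rewrite -intrM pmulrn abszEsg mulrC.
  by rewrite -mulrNz expi2pi_int.
transitivity (expi2pi (r%:~R / NR) * \sum_(j < n) t j.+1).
  rewrite mulr_sumr; apply: eq_bigr => j _; rewrite /t mulrA -expi2piD.
  congr (expi2pi _ * _).
    by rewrite -natr1; field; exact: NR0.
  rewrite /opY /=; congr (g (_, _)).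
  by rewrite intS rmorphD /= mulrDl div1r addrA.
congr (_ * _); rewrite -(big_mkord xpredT (fun j => t j.+1)) -(big_mkord xpredT t).
apply: (addrI (t 0%N)); rewrite -big_nat_recl // [RHS]addrC -[in RHS]tn -big_nat_recr //.
Qed.

(** The factor e(-r/N) produced by [opX (- r)] cancels the eigenvalue of [opP_eigen]. *)
Lemma opA_qp0 r g : qp g -> qp0 (opA r g).
Proof.
move=> qg; split; first exact: (good_qp (good_opA r)).
move=> a c; rewrite /opA /opX /= opP_eigen // mulrA -expi2piD; congr (expi2pi _ * _).
by rewrite mulrNz; field; exact: NR0.
Qed.

(** If g has period 1/N in a, then X_s g has eigenvalue e(s/N) under that translation, and the
    average in [opP r] is a sum of |N|-th roots of unity. *)
Lemma opP_X r s g : qp0 g -> opP r (opX s g) = if (N %| s - r)%Z then opX s g else (fun=> 0).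
Proof.
move=> [qg g0].
have gk (k : nat) a c : g (a + k%:R / NR, c) = g (a, c).
  elim: k a => [|k IH] a; first by rewrite mul0r addr0.
  by rewrite -natr1 mulrDl div1r addrA g0.
have E (j : nat) p : opY j (opX s g) p = expi2pi (s%:~R * j%:R / NR) * opX s g p.
  rewrite /opY /opX /= -pmulrn gk mulrA -expi2piD; congr (expi2pi _ * _).
  by rewrite mulrDr addrC mulrA.
apply/funext => p; rewrite /opP.
transitivity ((n%:R)^-1 * (\sum_(j < n) expi2pi ((s - r)%:~R * j%:R / NR)) * opX s g p).
  rewrite -mulrA; congr (_ * _); rewrite mulr_suml; apply: eq_bigr => j _.
  rewrite E mulrA -expi2piD; congr (expi2pi _ * _).
  by rewrite intrB; field; exact: NR0.
rewrite sum_root; case: ifP => _; last by rewrite mulr0 mul0r.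
by rewrite mulVf ?nR0 // mul1r.
Qed.

Lemma opA_X r s g : qp0 g -> opA r (opX s g) = if (N %| s - r)%Z then g else (fun=> 0).
Proof.
move=> q0; have [qg _] := q0; rewrite /opA opP_X //; case: ifP => H.
  rewrite opX_add -[RHS]opX0; apply: opX_mod => //.
  by rewrite subr0 addrC.
by apply/funext => p; rewrite /opX mulr0.
Qed.

Lemma dvdz_ord (i j : 'I_n) : (N %| i%:Z - j%:Z)%Z = (i == j).
Proof.
apply/idP/eqP => [|->]; last by rewrite subrr dvdz0.
rewrite dvdzE distnC => H; apply/val_inj => /=.
wlog ij : i j H / (i <= j)%N.
  move=> W; case: (leqP i j) => ij; first exact: W.
  have ji := ltnW ij; by apply/esym/W => //; rewrite distnC.
move: H; rewrite distnEl // => /dvdn_leq; rewrite subn_gt0.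
case: ltngtP ij => // ij _ /(_ isT); rewrite leqNgt.
by rewrite (leq_ltn_trans (leq_subr _ _) (ltn_ord j)).
Qed.

(** [opA r] undoes X_r and kills X_s for every other residue s, so it reads off the coefficient of
    index r. *)
Lemma opA_S v g (r : 'I_n) : qp0 g -> opA r (opS v g) = (fun p => v r * g p).
Proof.
move=> q0; have [qg _] := q0.
have -> : opA r (opS v g) = fun p => \sum_(s < n) v s * opA r (opX s g) p.
  exact: (good_linsum _ (fun s : 'I_n => v s) (fun s : 'I_n => opX s g) (good_opA r)).
apply/funext => p; rewrite (bigD1 r) //= opA_X // subrr dvdz0 big1 ?addr0 // => s sr.
by rewrite opA_X // dvdz_ord (negbTE sr) mulr0.
Qed.

(** After exchanging the sums, the sum over r of e(-rj/N) vanishes except at j = 0, where the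
    translation is trivial. *)
Lemma sum_opP g p : qp g -> \sum_(r < n) opP r g p = g p.
Proof.
move=> qg; rewrite /opP -mulr_sumr exchange_big /=.
under eq_bigr do rewrite -mulr_suml.
have n0 : (0 < n)%N by rewrite absz_gt0.
rewrite (bigD1 (Ordinal n0)) //= [X in _ + X]big1 ?addr0 => [|j j0].
  under eq_bigr do rewrite mulr0 mul0r oppr0 expi2pi0.
  rewrite sumr_const card_ord mulrA mulVf ?nR0 // mul1r.
  by rewrite /opY mul0r addr0; case: p.
rewrite [X in X * _](_ : _ = 0) ?mul0r //.
transitivity (\sum_(r < n) expi2pi ((- j%:Z)%:~R * r%:R / NR) : R[i]); last first.
  by rewrite sum_root rpredN -[X in (_ %| X)%Z]subr0 (dvdz_ord j (Ordinal n0)) (negbTE j0).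
apply: eq_bigr => r _; congr expi2pi.
by rewrite intrN !mulNr -!pmulrn; congr (- (_ / _)); rewrite mulrC.
Qed.

Lemma sum_opXA g p : qp g -> \sum_(r < n) opX r (opA r g) p = g p.
Proof.
move=> qg; rewrite -[RHS]sum_opP //; apply: eq_bigr => r _.
by rewrite /opA opX_add subrr opX0.
Qed.

End QuasiPeriodic.

(** * Representing the classes of H_N by quasi-periodic functions *)

Lemma ae_forall_count d (T : measurableType d) (R : realType)
    (mu : {measure set T -> \bar R}) (I : countType) (P : I -> T -> Prop) :
  (forall i, {ae mu, forall x, P i x}) -> {ae mu, forall x, forall i, P i x}.
Proof.
move=> H.
have : {ae mu, forall x, forall k, (if unpickle k is Some i then P i x else True)}.
  apply: ae_foralln => k; case: (unpickle k) => [i|]; first exact: H.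
  exact: aeW.
by apply: filterS => x Hx i; have := Hx (pickle i); rewrite pickleK.
Qed.

Lemma cvg0_lt (R : realType) (u : nat -> \bar R) (e : R) :
  u @ \oo --> 0%E -> 0 < e -> \forall k \near \oo, (u k < e%:E)%E.
Proof.
move=> uc e0; apply: (uc [set x | (x < e%:E)%E]).
by apply: open_nbhs_nbhs; split; [exact: open_ereal_lt_ereal|rewrite /= lte_fin].
Qed.

Section Lift.
Variables (R : realType) (N : int).
Hypothesis N0 : N != 0.
Local Notation T1 := (measurableTypeR R).
Local Notation T2 := (T1 * T1)%type.
Local Notation NR := (N%:~R : R).
Local Notation n := (`|N|%N).
Local Notation lam2 := (@lam2 R).
Implicit Types (g h : T2 -> R[i]) (F G : heis_fun R).

Definition hlift g : heis_fun R := fun q => expi2pi (NR * q.2) * g q.1.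

Definition lq g := qp N g /\ (tsq g < +oo)%E.

Lemma hlift_meas g : cmeasurable g -> cmeasurable (hlift g).
Proof.
move=> mg; apply: cmeasM.
  apply: cmeas_expi; apply: measurable_funM => //; exact: measurable_snd.
exact: cmeas_comp mg measurable_fst.
Qed.

Lemma eq_heis_sqnorm F G : cmeasurable F -> cmeasurable G -> ae_same F G ->
  heis_sqnorm F = heis_sqnorm G.
Proof.
move=> mF mG FG; apply: ge0_ae_eq_integral.
- exact: measurable_cube.
- exact: measurable_funS (cmeas_esqmod mF).
- exact: measurable_funS (cmeas_esqmod mG).
- by move=> x _; rewrite lee_fin sqmod_ge0.
- by move=> x _; rewrite lee_fin sqmod_ge0.
- by apply: filterS FG => x -> _.
Qed.

Lemma heis_sqnorm_hlift g : cmeasurable g -> heis_sqnorm (hlift g) = tsq g.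
Proof.
move=> mg; rewrite /tsq -integral_cube_cylinder; last 2 first.
- exact: cmeas_esqmod.
- by move=> p; rewrite lee_fin sqmod_ge0.
by apply: eq_integral => x _; rewrite /hlift sqmodM sqmod_expi mul1r.
Qed.

Lemma qp_int g a c (p q : int) : qp N g ->
  g (a + p%:~R, c + q%:~R) = expi2pi (- (NR * q%:~R * a)) * g (a, c).
Proof.
move=> qg; have [_ g1 _] := qg.
have H1 y : g (a + p%:~R, y) = g (a, y).
  have Hn (k : nat) b : g (b + k%:R, y) = g (b, y).
    elim: k b => [|k IH] b; first by rewrite addr0.
    by rewrite -natr1 addrA g1.
  case: p => k; first by rewrite -pmulrn.
  by rewrite NegzE mulrNz -pmulrn -[LHS](Hn k.+1) subrK.
rewrite H1; have := @opX_mod R N N0 (q * N) 0 g qg.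
rewrite subr0 dvdz_mull // opX0 => /(_ isT) /(congr1 (@^~ (a, c))).
rewrite /opX /= intrM mulfK ?NR0 // => <-.
by rewrite mulrA -expi2piD (mulrC NR) addNr expi2pi0 mul1r.
Qed.

Lemma hlift_inv g (p q r : int) x : qp N g ->
  hlift g (heis_mul (heisZ R p q r) x) = hlift g x.
Proof.
move=> qg; case: x => [[a c] z]; rewrite /hlift /=.
rewrite (addrC p%:~R) (addrC q%:~R) qp_int // mulrA -expi2piD; congr (_ * _).
rewrite -[RHS](expi2piDz _ (N * r)); congr expi2pi; rewrite intrM; ring.
Qed.

Lemma HN_lift g : lq g -> HN N (hlift g).
Proof.
move=> [qg g1]; have [mg _ _] := qg.
split; first exact: hlift_meas.
exists (hlift g); last exact: aeW.
split.
- exact: hlift_meas.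
- by move=> p q r x; exact: hlift_inv.
- by rewrite heis_sqnorm_hlift.
- apply: aeW => -[[a c] z]; rewrite /hlift /=.
  by rewrite mulr0 expi2pi0 mul1r.
Qed.

Lemma HN_of_lift F g : cmeasurable F -> lq g -> ae_same F (hlift g) -> HN N F.
Proof.
move=> mF lg Fg; split=> //; have [_ [G repG gG]] := HN_lift lg.
exists G => //; apply: filterS2 Fg gG => x -> ->.
by [].
Qed.

Lemma measurable_floorR : measurable_fun setT (fun x : T1 => (Num.floor x)%:~R : T1).
Proof.
apply: nondecreasing_measurable => // x y xy.
by rewrite ler_int; exact: Num.Theory.le_floor.
Qed.

Lemma HN_liftP F : HN N F -> cmeasurable F /\ exists2 g, lq g & ae_same F (hlift g).
Proof.
move=> [mF [G [mG invG sqG charG] FG]]; split=> //.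
pose fl (x : R) : R := (Num.floor x)%:~R.
(* The floors bring (a, c) into the unit square, and the exponential is the cocycle of that integer
   translation. This g is quasi-periodic at every point, whatever G does on a null set. *)
pose g (p : T2) : R[i] := expi2pi (- (NR * fl p.2 * p.1)) * G (p.1 - fl p.1, p.2 - fl p.2, 0).
have m1 : measurable_fun setT (fun p : T2 => p.1 : T1) by exact: measurable_fst.
have m2 : measurable_fun setT (fun p : T2 => p.2 : T1) by exact: measurable_snd.
have mf1 : measurable_fun setT (fun p : T2 => fl p.1 : T1).
  exact: measurableT_comp measurable_floorR m1.
have mf2 : measurable_fun setT (fun p : T2 => fl p.2 : T1).
  exact: measurableT_comp measurable_floorR m2.
have mg : cmeasurable g.
  apply: cmeasM.
    apply: cmeas_expi; apply: measurable_funN; apply: measurable_funM => //.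
    by apply: measurable_funM.
  apply: (cmeas_comp mG); apply: measurable_fun_pair => //.
  by apply: measurable_fun_pair; apply: measurable_funB.
have fl1 x : fl (x + 1) = fl x + 1.
  by rewrite /fl -[1 in LHS]/(1%:~R) Num.Theory.floorDrz ?Num.Theory.intr_int // Num.Theory.intrKfloor intrD.
have qg : qp N g.
  split=> //.
  - move=> a c; rewrite /g /= fl1 (addrC (fl a)) addrKA.
    congr (_ * _); rewrite mulrDr mulr1 opprD expi2piD.
    have -> : - (NR * fl c) = (- (N * Num.floor c))%:~R by rewrite mulrNz intrM.
    by rewrite expi2pi_int mulr1.
  - move=> a c; rewrite /g /= fl1 [fl c + 1]addrC addrKA mulrA -expi2piD; congr (expi2pi _ * _).
    ring.
have Gg : ae_same G (hlift g).
  (* There are countably many integer translations, so almost every point satisfies the character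
     relation at all its translates, in particular at the one over the unit square. *)
  have : {ae haar R, forall x, forall pq : int * int,
      let y := heis_mul (heisZ R pq.1 pq.2 0) x in
      G y = expi2pi (NR * y.2) * G (y.1, 0)}.
    apply: ae_forall_count => pq.
    apply: (haar_ae_heisZ pq.1 pq.2 0
      (P := fun y => G y = expi2pi (NR * y.2) * G (y.1, 0))).
    by apply: filterS charG => -[[a c] z].
  apply: filterS => -[[a c] z] /(_ (- Num.floor a, - Num.floor c)).
  rewrite /= -/(heisZ _ _ _ _) => H.
  have := invG (- Num.floor a) (- Num.floor c) 0 (a, c, z).
  rewrite {}H /= => <-; rewrite /hlift /g /= mulrA -expi2piD !mulrNz /fl.
  rewrite (addrC (- _)) (addrC (- _) c); congr (expi2pi _ * _); ring.
exists g; first split => //.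
  by rewrite -heis_sqnorm_hlift // -(eq_heis_sqnorm mG (hlift_meas mg) Gg).
by apply: filterS2 FG Gg => x -> ->.
Qed.

Lemma hlift_ae0 g : qp N g -> tsq g = 0%E -> {ae haar R, forall x, hlift g x = 0}.
Proof.
move=> qg g0; have [mg _ _] := qg.
have mfg : measurable_fun (cube R) (fun x => (sqmod (hlift g x))%:E).
  exact: measurable_funS (cmeas_esqmod (hlift_meas mg)).
have /(ae_eq_integral_abs _ (@measurable_cube R) mfg) H :
    (\int[haar R]_(x in cube R) `|(sqmod (hlift g x))%:E| = 0)%E.
  rewrite -g0 -heis_sqnorm_hlift //; apply: eq_integral => x _.
  by rewrite gee0_abs // lee_fin sqmod_ge0.
have {H} : {ae haar R, forall x, forall pqr : int * int * int,
    cube R (heis_mul (heisZ R pqr.1.1 pqr.1.2 pqr.2) x) -> hlift g x = 0}.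
  apply: ae_forall_count => -[[p q] r].
  have := haar_ae_heisZ p q r H.
  apply: filterS => x /= Hx cx.
  have := Hx cx; rewrite hlift_inv // => -[/sqmod_eq0].
  by [].
apply: filterS => -[[a c] z] H.
(* The translation by (-p, -q, -r) has third coordinate z - q a - r because of the shear, hence the
   floor of z - q a. *)
pose p := Num.floor a; pose q := Num.floor c; pose r := Num.floor (z - q%:~R * a).
apply: (H (- p, - q, - r)); rewrite /cube /= !mulrNz mulNr.
have fl01 (x : R) : (- (Num.floor x)%:~R + x) \in `[0, 1].
  have /andP[f1 f2] := Num.Theory.floor_itv x.
  rewrite in_itv /= addrC subr_ge0 f1 lerBlDr addrC ltW //.
  by rewrite -[1]/(1%:~R) -intrD.
split; first split; try exact: fl01.
have := fl01 (z - q%:~R * a); rewrite -/r addrA //.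
Qed.

Lemma hlift_ae_same g h : qp N g -> qp N h -> tsq (fun p => g p - h p) = 0%E ->
  ae_same (hlift g) (hlift h).
Proof.
move=> qg qh gh; have := hlift_ae0 (qpB qg qh) gh.
apply: filterS => x /eqP; rewrite /hlift mulf_eq0 (negbTE (expi2pi_neq0 _)) /=.
by rewrite subr_eq0 => /eqP ->.
Qed.

Lemma lq_lin b g h : lq g -> lq h -> lq (fun p => b * g p + h p).
Proof.
move=> [qg fg] [qh fh]; split; first exact: qp_lin.
have [mg _ _] := qg; have [mh _ _] := qh.
apply: le_lt_trans (tsqD (cmeasM (cmeas_cst _ b) mg) mh) _.
rewrite tsqM // lte_mul_pinfty ?lee_fin // lte_add_pinfty //.
by rewrite lte_mul_pinfty ?lee_fin ?sqmod_ge0.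
Qed.

Lemma lq_zero : lq (fun=> 0).
Proof. by split; [exact: qp_zero|rewrite tsq0]. Qed.

Lemma lqD g h : lq g -> lq h -> lq (fun p => g p + h p).
Proof.
move=> lg /(lq_lin 1 lg); congr lq; apply/funext => p.
by rewrite mul1r.
Qed.

Lemma lqZ b g : lq g -> lq (fun p => b * g p).
Proof.
move=> /(lq_lin b)/(_ lq_zero); congr lq; apply/funext => p.
by rewrite addr0.
Qed.

Lemma lqB g h : lq g -> lq h -> lq (fun p => g p - h p).
Proof.
move=> lg /(lqZ (-1)) /(lqD lg); congr lq; apply/funext => p.
by rewrite mulN1r.
Qed.

Lemma lq_good B g : good_op N B -> lq g -> lq (B g).
Proof.
move=> [B1 _ [K K0 B3]] [qg fg]; split; first exact: B1.
by apply: le_lt_trans (B3 _ qg) _; rewrite lte_mul_pinfty ?lee_fin.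
Qed.

Lemma lq_sum (I : Type) (s : seq I) (F : I -> T2 -> R[i]) :
  (forall i, lq (F i)) -> lq (fun p => \sum_(i <- s) F i p).
Proof.
move=> qF; elim: s => [|i s IH].
  rewrite (_ : (fun _ => _) = (fun=> 0)); first exact: lq_zero.
  by apply/funext => p; rewrite big_nil.
rewrite (_ : (fun _ => _) = (fun p => F i p + \sum_(i <- s) F i p)); first exact: lqD.
by apply/funext => p; rewrite big_cons.
Qed.

(** The kernel of B on classes. The name refers to the case B = id - P with P a projection, where
    the kernel consists of the fixed points of P. *)
Definition fixed_by (B : (T2 -> R[i]) -> T2 -> R[i]) : set (heis_fun R) :=
  [set F | cmeasurable F /\ exists g, [/\ lq g, ae_same F (hlift g) & tsq (B g) = 0%E]].

Lemma fixed_by_closed B : good_op N B -> HN_closed_subspace N (fixed_by B).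
Proof.
move=> gB; have [B1 B2 [K K0 B3]] := gB; split.
- by move=> F [mF [g [lg Fg _]]]; exact: HN_of_lift Fg.
- split; first exact: cmeas_cst.
  exists (fun=> 0); split; first exact: lq_zero.
    by apply: aeW => x; rewrite /hlift mulr0.
  apply/eqP; rewrite eq_le tsq_ge0 andbT.
  by apply: le_trans (B3 _ (qp_zero _ _)) _; rewrite tsq0 mule0.
- move=> b F G [mF [g [lg Fg g0]]] [mG [h [lh Gh h0]]]; split.
    by apply: cmeasD => //; apply: cmeasM => //; exact: cmeas_cst.
  exists (fun p => b * g p + h p); split; first exact: lq_lin.
    apply: filterS2 Fg Gh => x -> ->; rewrite /hlift mulrDr; congr (_ + _).
    by rewrite mulrCA.
  rewrite B2; apply/eqP; rewrite eq_le tsq_ge0 andbT.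
  have [mBg _ _] := B1 _ lg.1; have [mBh _ _] := B1 _ lh.1.
  apply: le_trans (tsqD (cmeasM (cmeas_cst _ b) mBg) mBh) _.
  by rewrite tsqM // g0 h0 mule0 adde0 mule0.
- move=> u F Vu HF uF; have [mF [g lg Fg]] := HN_liftP HF.
  split=> //; exists g; split=> //.
  apply/eqP; rewrite eq_le tsq_ge0 andbT; apply/lee_addgt0Pr => e e0.
  rewrite add0e.
  (* Since B (gk k) vanishes in norm, the squared norm of B g is at most 2 K d; this d makes it at
     most e, and K + 1 guards against K = 0. *)
  pose d := e / (2 * (K + 1)).
  have K1 : 0 < 2 * (K + 1) by rewrite mulr_gt0 // ltr_wpDl.
  have d0 : 0 < d by rewrite divr_gt0.
  have [k _ /(_ k (leqnn k)) Hk] := cvg0_lt uF d0.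
  have [muk [gk [lgk ukg Bgk]]] := Vu k.
  have [mg _ _] := lg.1; have [mgk _ _] := lgk.1.
  have qgB := qpB lgk.1 lg.1; have [mgB _ _] := qgB.
  have E : heis_sqnorm (fun x => u k x - F x) = tsq (fun p => gk p - g p).
    rewrite -heis_sqnorm_hlift //; apply: eq_heis_sqnorm.
    - exact: cmeasB.
    - exact: hlift_meas.
    - by apply: filterS2 ukg Fg => x -> ->; rewrite /hlift mulrBr.
  have [mBgk _ _] := B1 _ lgk.1; have [mBgB _ _] := B1 _ qgB.
  have -> : B g = fun p => B gk p - B (fun p => gk p - g p) p.
    have -> : (fun p => gk p - g p) = (fun p => (-1) * g p + gk p).
      by apply/funext => p; rewrite mulN1r addrC.
    by rewrite B2; apply/funext => p; rewrite mulN1r addrC opprD opprK subrK.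
  apply: le_trans (tsqB mBgk mBgB) _; rewrite Bgk add0e.
  apply: (@le_trans _ _ (2%:E * (K%:E * d%:E))%E).
    rewrite lee_pmul2l //; apply: le_trans (B3 _ qgB) _.
    by rewrite lee_wpmul2l ?lee_fin // -E ltW.
  rewrite -!EFinM lee_fin /d mulrA mulrCA ler_piMr ?(ltW e0) //.
  by rewrite ler_pdivrMr // mul1r ler_pM2l // lerDl.
Qed.

End Lift.

(** * Inner products by polarization *)

Section RealInner.
Variables (R : realType) (N : int).
Hypothesis N0 : N != 0.
Local Notation T1 := (measurableTypeR R).
Local Notation T2 := (T1 * T1)%type.
Local Notation NR := (N%:~R : R).
Local Notation n := (`|N|%N).
Local Notation lam2 := (@lam2 R).
Local Notation hlift := (hlift N).
Local Notation lq := (@lq R N).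
Implicit Types (g h k : T2 -> R[i]) (F G : heis_fun R).

(** The real part of the inner product over the unit square. In this form an operator preserving
    [tsq] preserves it at once ([rin_isom]); the imaginary part is recovered by replacing h by i h.
    [fine] loses nothing for square-integrable arguments. *)
Definition rin g h : R :=
  4^-1 * (fine (tsq (fun p => g p + h p)) - fine (tsq (fun p => g p - h p))).

Let re g h (p : T2) : R := complex.Re (g p * (h p)^*).

Lemma re_integrable g h : lq g -> lq h ->
  lam2.-integrable (@unit_sq R) (EFin \o re g h).
Proof.
move=> lg lh; have [[mg _ _] fg] := lg; have [[mh _ _] fh] := lh.
have [mre _] := cmeasM mg (cmeas_conj mh).
have ss p : 0 <= sqmod (g p) + sqmod (h p) by apply: addr_ge0; exact: sqmod_ge0.
apply: (@le_integrable _ _ _ lam2 _ (@measurable_unit_sq R) _ (fun p => (sqmod (g p) + sqmod (h p))%:E)).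
- by apply/measurable_EFinP; exact: measurable_funS mre.
- move=> p _ /=; rewrite lee_fin [leRHS]ger0_norm //.
  rewrite /re; case: (g p) (h p) => a b [c d]; rewrite /sqmod /=.
  have := sqr_ge0 (a + c); have := sqr_ge0 (a - c).
  have := sqr_ge0 (b + d); have := sqr_ge0 (b - d).
  have := sqr_ge0 a; have := sqr_ge0 b; have := sqr_ge0 c; have := sqr_ge0 d.
  rewrite ler_norml !expr2 => *; apply/andP; split; lra.
- apply/integrableP; split.
    apply/measurable_EFinP; apply: measurable_funD.
      exact: measurable_funS (cmeas_sqmod mg).
    exact: measurable_funS (cmeas_sqmod mh).
  under eq_integral do rewrite /= ger0_norm // EFinD.
  rewrite ge0_integralD //.
  + by rewrite lte_add_pinfty.
  + exact: measurable_unit_sq.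
  + by move=> p _; rewrite lee_fin sqmod_ge0.
  + exact: measurable_funS (cmeas_esqmod mg).
  + by move=> p _; rewrite lee_fin sqmod_ge0.
  + exact: measurable_funS (cmeas_esqmod mh).
Qed.

Lemma sq_integrable g : lq g -> lam2.-integrable (@unit_sq R) (EFin \o (fun p => sqmod (g p))).
Proof.
move=> [[mg _ _] fg]; apply/integrableP; split.
  by apply/measurable_EFinP; exact: measurable_funS (cmeas_sqmod mg).
by under eq_integral do rewrite /= ger0_norm ?sqmod_ge0 //.
Qed.

Lemma rinE g h : lq g -> lq h -> rin g h = Rintegral lam2 (@unit_sq R) (re g h).
Proof.
move=> lg lh; have ms := @measurable_unit_sq R.
have ip := sq_integrable (lqD lg lh); have im := sq_integrable (lqB lg lh).
rewrite /rin /tsq -/(Rintegral _ _ _) -/(Rintegral _ _ (fun p => sqmod (g p - h p))).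
rewrite -RintegralB // -RintegralZl //.
  by apply: eq_Rintegral => p _; rewrite /re complexRe_inv.
exact: (integrableB ms ip im).
Qed.

Lemma rinD g g' h : lq g -> lq g' -> lq h ->
  rin (fun p => g p + g' p) h = rin g h + rin g' h.
Proof.
move=> lg lg' lh; rewrite !rinE //; last exact: lqD.
rewrite -RintegralD //; [|exact: measurable_unit_sq|exact: re_integrable..].
apply: eq_Rintegral => p _; rewrite /re mulrDl.
by case: (g p * _) (g' p * _) => ? ? [].
Qed.

Lemma eq_rin g g' h : g =1 g' -> rin g h = rin g' h.
Proof. by move=> /funext ->. Qed.

Lemma eq_rin2 g g' h h' : g =1 g' -> h =1 h' -> rin g h = rin g' h'.
Proof. by move=> /funext -> /funext ->. Qed.

Lemma rinC g h : rin g h = rin h g.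
Proof.
rewrite /rin; congr (_ * (_ - _)); congr fine; apply: eq_tsq => p.
  by rewrite addrC.
by rewrite -sqmodN opprB.
Qed.

Lemma rin0 h : rin (fun=> 0) h = 0.
Proof.
rewrite /rin (@eq_tsq _ _ h) ?[X in _ - fine X](@eq_tsq _ _ h) ?subrr ?mulr0 // => p.
  by rewrite sub0r sqmodN.
by rewrite add0r.
Qed.

Lemma rin_sum (I : Type) (s : seq I) (g : I -> T2 -> R[i]) h :
  (forall i, lq (g i)) -> lq h ->
  rin (fun p => \sum_(i <- s) g i p) h = \sum_(i <- s) rin (g i) h.
Proof.
move=> lg lh; elim: s => [|i s IH].
  have -> : (fun p => \sum_(i <- [::]) g i p) = (fun=> 0).
    by apply/funext => p; rewrite big_nil.
  by rewrite big_nil rin0.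
rewrite big_cons -IH -rinD //; last exact: lq_sum.
by apply: eq_rin => p; rewrite big_cons.
Qed.

Lemma rin_isom B g h : lq g -> lq h -> good_op N B ->
  (forall k, lq k -> tsq (B k) = tsq k) -> rin (B g) (B h) = rin g h.
Proof.
move=> lg lh [_ B2 _] iB; rewrite /rin; congr (_ * (fine _ - fine _)).
  rewrite -[RHS]iB; last exact: lqD.
  apply: eq_tsq => p; have := B2 1 g h => /(congr1 (@^~ p)); rewrite mul1r => <-.
  by congr (sqmod (B _ p)); apply/funext => q; rewrite mul1r.
rewrite -[RHS]iB; last exact: lqB.
apply: eq_tsq => p; have := B2 (-1) h g => /(congr1 (@^~ p)); rewrite mulN1r addrC => <-.
by congr (sqmod (B _ p)); apply/funext => q; rewrite mulN1r addrC.
Qed.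

Lemma rinZ (b b' : R[i]) g h : lq g -> lq h ->
  rin (fun p => b * g p) (fun p => b' * h p) = rin (fun p => b * b'^* * g p) h.
Proof.
move=> lg lh; rewrite !rinE //; try exact: lqZ.
apply: eq_Rintegral => p _; rewrite /re; congr complex.Re.
by rewrite rmorphM /= mulrACA mulrA.
Qed.

Lemma lq_opX (b : R[i]) (t : int) g : lq g -> lq (fun p => b * opX N t g p).
Proof. by move=> lg; apply: lqZ; exact: (lq_good (good_opX R N t)). Qed.

(** Translation by 1/N is an isometry that scales the two arguments by e(r/N) and e(s/N), so the
    pairing is unchanged when the first is multiplied by z = e((r - s)/N). The pairing is only real
    bilinear, so z cannot be pulled out; instead the pairings with all powers z^k, k < |N|, are
    equal, and their sum is 0 because the sum of the z^k is 0. *)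
Lemma rin_opX_neq (r s : int) (b b' : R[i]) g h : qp0 N g -> qp0 N h -> lq g -> lq h ->
  ~~ (N %| r - s)%Z ->
  rin (fun p => b * opX N r g p) (fun p => b' * opX N s h p) = 0.
Proof.
move=> g0 h0 lg lh ndv.
set G := fun p => b * _; set H := fun p => b' * _.
have lG : lq G by exact: lq_opX.
have lH : lq H by exact: lq_opX.
pose B := @opY R N 1; have gB : good_op N B := good_opY R N0 1.
have iB k : lq k -> tsq (B k) = tsq k.
  move=> [[mk k1 _] _].
  rewrite /tsq -(@integral_shift_fst R ((1%:Z)%:~R / NR) (fun p => (sqmod (k p))%:E)) //.
  - exact: cmeas_esqmod.
  - by move=> p; rewrite lee_fin sqmod_ge0.
  - by move=> a c; rewrite k1.
have BX t k : qp0 N k -> B (opX N t k) = fun p => expi2pi (t%:~R / NR) * opX N t k p.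
  move=> [_ k0]; apply/funext => -[a c]; rewrite /B /opY /opX /= mulr1z div1r k0.
  by rewrite mulrA -expi2piD mulrDr addrC.
pose z : R[i] := expi2pi ((r - s)%:~R / NR).
have step (k : nat) : rin (fun p => z ^+ k * G p) H = rin G H.
  elim: k => [|k IH].
    by apply: eq_rin => p; rewrite expr0 mul1r.
  rewrite -IH -(@rin_isom B (fun p => z ^+ k * G p)) //; last exact: lqZ.
  have EG : B (fun p => z ^+ k * G p) = fun p => expi2pi (r%:~R / NR) * (z ^+ k * G p).
    apply/funext => p; rewrite /G /B /opY /=.
    have := BX r g g0 => /(congr1 (@^~ p)); rewrite /B /opY /= => ->.
    by rewrite (mulrCA b) (mulrCA (z ^+ k)).
  have EH : B H = fun p => expi2pi (s%:~R / NR) * H p.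
    apply/funext => p; rewrite /H /B /opY /=.
    have := BX s h h0 => /(congr1 (@^~ p)); rewrite /B /opY /= => ->.
    by rewrite mulrCA.
  rewrite EG EH rinZ //; last exact: lqZ.
  apply: eq_rin => p; rewrite mulrA -expi2piN -expi2piD exprS.
  by congr (expi2pi _ * _ * _); rewrite intrB mulrBl.
have : \sum_(k < n) rin (fun p => z ^+ k * G p) H = 0.
  rewrite -rin_sum // => [|k]; last exact: lqZ.
  rewrite [X in rin X H](_ : _ = (fun=> 0)) ?rin0 //; apply/funext => p.
  rewrite -mulr_suml; have := @sum_root R N N0 (r - s); rewrite (negbTE ndv).
  under eq_bigr do rewrite mulrAC -expi2piX.
  by move=> ->; rewrite mul0r.
under eq_bigr do rewrite step.
rewrite sumr_const card_ord => /eqP; rewrite mulrn_eq0 absz_eq0 (negbTE N0) /=.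
by move/eqP.
Qed.

Definition dotv (v w : int -> R[i]) : R[i] := \sum_(r < n) v r * (w r)^*.

(** Only equal residues survive, and there X_r cancels as an isometry. What remains is the pairing
    of [dotv v w] times g with h. *)
Lemma rin_opS v w g h : qp0 N g -> qp0 N h -> lq g -> lq h -> dotv v w = 0 ->
  rin (opS N v g) (opS N w h) = 0.
Proof.
move=> g0 h0 lg lh vw.
have lw : lq (opS N w h) := lq_good (@good_opS R N w) lh.
rewrite {1}/opS rin_sum //; last by move=> r; exact: lq_opX.
transitivity (\sum_(r < n) rin (fun p => v r * (w r)^* * g p) h).
  apply: eq_bigr => r _; rewrite rinC /opS rin_sum; last 2 first.
  - by move=> s; exact: lq_opX.
  - exact: lq_opX.
  rewrite (bigD1 r) //= big1 ?addr0 => [|s sr]; last first.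
    by rewrite rin_opX_neq // dvdz_ord.
  rewrite rinC -(@rinZ (v r)) // -[RHS](@rin_isom (opX N r)).
  - rewrite /opX; apply: eq_rin2 => p; exact: mulrCA.
  - exact: lqZ.
  - exact: lqZ.
  - exact: good_opX.
  - by move=> k [qk _]; exact: tsq_opX.
rewrite -rin_sum // => [|r]; last exact: lqZ.
rewrite [X in rin X h](_ : _ = (fun=> 0)) ?rin0 //; apply/funext => p.
by rewrite -mulr_suml -/(dotv v w) vw mul0r.
Qed.

Lemma heis_inner_lift F G g h : cmeasurable F -> cmeasurable G -> lq g -> lq h ->
  ae_same F (hlift g) -> ae_same G (hlift h) ->
  heis_inner F G = rin g h +i* rin g (fun p => 'i * h p).
Proof.
move=> mF mG lg lh Fg Gh.
have key k H : cmeasurable H -> lq k -> ae_same H (hlift k) ->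
    Rintegral (haar R) (cube R) (fun x => complex.Re (F x * (H x)^*)) = rin g k.
  move=> mH lk Hk; have [mg _ _] := lg.1; have [mk _ _] := lk.1.
  have hint K : cmeasurable K -> (heis_sqnorm K < +oo)%E ->
      (haar R).-integrable (cube R) (EFin \o (fun x => sqmod (K x))).
    move=> mK fK; apply/integrableP; split.
      by apply/measurable_EFinP; exact: measurable_funS (cmeas_sqmod mK).
    by under eq_integral do rewrite /= ger0_norm ?sqmod_ge0 //.
  have EP : heis_sqnorm (fun x => F x + H x) = tsq (fun p => g p + k p).
    rewrite -(@heis_sqnorm_hlift R N); last exact: cmeasD.
    apply: eq_heis_sqnorm; [exact: cmeasD|apply/hlift_meas; exact: cmeasD|].
    by apply: filterS2 Fg Hk => x -> ->; rewrite /hlift mulrDr.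
  have EM : heis_sqnorm (fun x => F x - H x) = tsq (fun p => g p - k p).
    rewrite -(@heis_sqnorm_hlift R N); last exact: cmeasB.
    apply: eq_heis_sqnorm; [exact: cmeasB|apply/hlift_meas; exact: cmeasB|].
    by apply: filterS2 Fg Hk => x -> ->; rewrite /hlift mulrBr.
  rewrite /rin -EP -EM.
  have mc := @measurable_cube R.
  have ip : (haar R).-integrable (cube R) (EFin \o (fun x => sqmod (F x + H x))).
    by apply: hint; [exact: cmeasD|rewrite EP; have [] := lqD lg lk].
  have im : (haar R).-integrable (cube R) (EFin \o (fun x => sqmod (F x - H x))).
    by apply: hint; [exact: cmeasB|rewrite EM; have [] := lqB lg lk].
  transitivity (Rintegral (haar R) (cube R) (fun x => 4^-1 * (sqmod (F x + H x) - sqmod (F x - H x)))).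
    by apply: eq_Rintegral => x _; rewrite complexRe_inv.
  rewrite RintegralZl //; last exact: (integrableB mc ip im).
  by rewrite RintegralB.
rewrite /heis_inner (key h) //; congr (_ +i* _).
(* The imaginary part of F times conj G is the real part of F times conj (i G). *)
rewrite -(key (fun p => 'i * h p) (fun x => 'i * G x)).
- by apply: eq_Rintegral => x _; case: (F x) (G x) => a b [c d] /=; ring.
- by apply: cmeasM => //; exact: cmeas_cst.
- exact: lqZ.
- by apply: filterS Gh => x ->; rewrite /hlift mulrCA.
Qed.

End RealInner.

(** * Subspaces attached to finite lists of periodic functions *)

Section SynthesisSpaces.
Variables (R : realType) (N : int).
Hypothesis N0 : N != 0.
Local Notation T1 := (measurableTypeR R).
Local Notation T2 := (T1 * T1)%type.
Local Notation n := (`|N|%N).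
Local Notation hlift := (@hlift R N).
Local Notation lq := (@lq R N).
Local Notation qp0 := (@qp0 R N).
Local Notation opS := (@opS R N).
Local Notation dotv := (@dotv R N).
Implicit Types (g h : T2 -> R[i]) (F G : heis_fun R) (v w : int -> R[i])
  (L : seq (int -> R[i])).

Definition cf L (i : nat) : int -> R[i] := nth (fun=> 0) L i.

Definition synth L (phi : nat -> T2 -> R[i]) : T2 -> R[i] :=
  fun p => \sum_(i < size L) opS (cf L i) (phi i) p.

(* Each of the closed subspaces in the decomposition has this form: H_{N,d}(chi)
   is [VS [:: v]] for v(n) = chi(nd/N). *)
Definition VS L : set (heis_fun R) :=
  [set F | cmeasurable F /\ exists phi : nat -> T2 -> R[i],
    (forall i, qp0 (phi i) /\ lq (phi i)) /\ ae_same F (hlift (synth L phi))].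

Definition vortho L := forall i j : nat, (i < size L)%N -> (j < size L)%N ->
  if i == j then dotv (cf L i) (cf L j) != 0 : Prop else dotv (cf L i) (cf L j) = 0.

Lemma lq_opS v g : lq g -> lq (opS v g).
Proof. by move=> lg; exact (lq_good (@good_opS R N v) lg). Qed.

Lemma lq_synth L phi : (forall i, lq (phi i)) -> lq (synth L phi).
Proof. by move=> lp; apply: lq_sum => i; exact: lq_opS. Qed.

(** The adjoint of [opS w] on functions of period 1/N: it collects the components g_r with the
    weights conj (w r), so that composing with [opS v] multiplies by a scalar product. *)
Definition opPi w g : T2 -> R[i] := fun p => \sum_(r < n) (w r)^* * opA N r g p.

Lemma good_opPi w : good_op N (opPi w).
Proof. by apply: good_sum => r; apply: good_scale; exact: good_opA. Qed.

Lemma qp0_lin b g h : qp0 g -> qp0 h -> qp0 (fun p => b * g p + h p).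
Proof.
by move=> [qg g0] [qh h0]; split; [exact: qp_lin|move=> a c; rewrite g0 h0].
Qed.

Lemma qp0_zero : qp0 (fun=> 0).
Proof. by split=> //; exact: qp_zero. Qed.

Lemma qp0_sum (I : Type) (s : seq I) (F : I -> T2 -> R[i]) :
  (forall i, qp0 (F i)) -> qp0 (fun p => \sum_(i <- s) F i p).
Proof.
move=> qF; split; first by apply: qp_sum => i; case: (qF i).
by move=> a c; apply: eq_bigr => i _; case: (qF i).
Qed.

Lemma qp0Z b g : qp0 g -> qp0 (fun p => b * g p).
Proof.
move=> /(qp0_lin b)/(_ qp0_zero); congr qp0; apply/funext => p.
by rewrite addr0.
Qed.

Lemma opPi_qp0 w g : qp N g -> qp0 (opPi w g).
Proof. by move=> qg; apply: qp0_sum => r; apply: qp0Z; exact: opA_qp0. Qed.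

Lemma opPi_S w v g : qp0 g -> opPi w (opS v g) = fun p => dotv v w * g p.
Proof.
move=> g0; apply/funext => p; rewrite /opPi /dotv mulr_suml.
by apply: eq_bigr => r _; rewrite opA_S // mulrCA mulrA.
Qed.

Lemma opS_lin v b g h : opS v (fun p => b * g p + h p) = fun p => b * opS v g p + opS v h p.
Proof. exact: (good_lin (@good_opS R N v)). Qed.

(** The orthogonal projection in an orthogonal, not necessarily normalized, system: each term is
    divided by the squared length of its vector. *)
Definition opProj L g : T2 -> R[i] := fun p =>
  \sum_(i < size L) (dotv (cf L i) (cf L i))^-1 * opS (cf L i) (opPi (cf L i) g) p.

Lemma good_opProj L : good_op N (opProj L).
Proof.
apply: good_sum => i; apply: good_scale; apply: good_comp; first exact: good_opS.
exact: good_opPi.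
Qed.

Lemma opProj_synth L phi : vortho L -> (forall i, qp0 (phi i)) ->
  opProj L (synth L phi) = synth L phi.
Proof.
move=> oL p0; apply/funext => p; rewrite /opProj; apply: eq_bigr => i _.
have -> : opPi (cf L i) (synth L phi) = fun p => dotv (cf L i) (cf L i) * phi i p.
  have -> : synth L phi = fun p => \sum_(j < size L) 1 * opS (cf L j) (phi j) p.
    by apply/funext => q; apply: eq_bigr => j _; rewrite mul1r.
  rewrite (good_linsum _ (fun=> 1) (fun j : 'I_(size L) => opS (cf L j) (phi j)) (good_opPi _)).
  apply/funext => q; rewrite (bigD1 i) //= big1 ?addr0 => [|j ji].
    by rewrite mul1r opPi_S.
  have := oL j i (ltn_ord j) (ltn_ord i); rewrite ifN // => dji.
  by rewrite opPi_S // dji mul0r mulr0.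
have := oL i i (ltn_ord i) (ltn_ord i); rewrite eqxx => dii.
have -> : (fun q => dotv (cf L i) (cf L i) * phi i q) =
    (fun q => dotv (cf L i) (cf L i) * phi i q + 0).
  by apply/funext => q; rewrite addr0.
rewrite (opS_lin _ _ (phi i) (fun=> 0)).
have -> : opS (cf L i) (fun=> 0) = fun=> 0.
  by apply/funext => q; rewrite /opS /opX big1 // => r _; rewrite !mulr0.
by rewrite addr0 mulKf.
Qed.

(** The projection fixes every synthesis, and whatever it fixes is a synthesis. The space becomes
    the kernel of a bounded operator, which is what closedness needs. *)
Lemma VS_fixed L : vortho L -> VS L = fixed_by N (fun g p => g p - opProj L g p).
Proof.
move=> oL; apply/seteqP; split=> F.
  move=> [mF [phi [p0 Fphi]]]; split=> //; exists (synth L phi); split=> //.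
    by apply: lq_synth => i; case: (p0 i).
  rewrite opProj_synth //; last by move=> i; case: (p0 i).
  by rewrite (_ : (fun _ => _) = (fun=> 0)) ?tsq0 //; apply/funext => p; rewrite subrr.
move=> [mF [g [lg Fg g0]]]; split=> //.
exists (fun i p => (dotv (cf L i) (cf L i))^-1 * opPi (cf L i) g p); split.
  move=> i; split; first by apply: qp0Z; apply: opPi_qp0; case: lg.
  by apply: lqZ; exact: (lq_good (good_opPi _)).
have qP := good_qp (good_opProj L) lg.1.
have := hlift_ae_same N0 lg.1 qP g0.
apply: filterS2 Fg => x -> ->; congr (hlift _ x).
apply/funext => p; rewrite /opProj /synth; apply: eq_bigr => i _.
have := opS_lin (cf L i) (dotv (cf L i) (cf L i))^-1 (opPi (cf L i) g) (fun=> 0).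
have -> : opS (cf L i) (fun=> 0) = fun=> 0.
  by apply/funext => q; rewrite /opS /opX big1 // => r _; rewrite !mulr0.
move=> /(congr1 (@^~ p)); rewrite addr0 => <-; congr (opS _ _ p).
by apply/funext => q; rewrite addr0.
Qed.

Lemma VS_closed L : vortho L -> HN_closed_subspace N (VS L).
Proof.
move=> oL; rewrite VS_fixed //; apply: fixed_by_closed => //.
have := good_add (good_id R N) (good_scale (-1) (good_opProj L)); congr good_op.
by apply/funext => g; apply/funext => p; rewrite mulN1r.
Qed.

Lemma VS_HN L F : VS L F -> HN N F.
Proof.
move=> [mF [phi [p0 Fphi]]]; apply: (HN_of_lift N0 mF _ Fphi).
by apply: lq_synth => i; case: (p0 i).
Qed.

Lemma VS_ae L F G : VS L F -> cmeasurable G -> ae_same G F -> VS L G.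
Proof.
move=> [mF [phi [p0 Fphi]]] mG GF; split=> //; exists phi; split=> //.
by apply: filterS2 GF Fphi => x -> ->.
Qed.

Lemma VS_mem L v i : (i < size L)%N -> cf L i = v -> VS [:: v] `<=` VS L.
Proof.
move=> iL <- F [mF [phi [p0 Fphi]]]; split=> //.
exists (fun j => if j == i then phi 0%N else fun=> 0); split.
  by move=> j; case: ifP => // _; split; [exact: qp0_zero|exact: lq_zero].
apply: filterS Fphi => x ->; congr (hlift _ x); apply/funext => p.
rewrite /synth big_ord1 (bigD1 (Ordinal iL)) //= eqxx big1 ?addr0 // => j.
rewrite -val_eqE /= => /negbTE ->.
by rewrite /opS /opX big1 // => r _; rewrite !mulr0.
Qed.

Lemma closed_subspace_sum (V : set (heis_fun R)) (I : Type) (s : seq I)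
    (G : I -> heis_fun R) :
  HN_closed_subspace N V -> (forall i, V (G i)) -> V (fun x => \sum_(i <- s) G i x).
Proof.
move=> [_ V0 VD _] VG; elim: s => [|i s IH].
  rewrite (_ : (fun _ => _) = (fun=> 0)) //.
  by apply/funext => x; rewrite big_nil.
rewrite (_ : (fun _ => _) = fun x => 1 * G i x + \sum_(j <- s) G j x); first exact: VD.
by apply/funext => x; rewrite big_cons mul1r.
Qed.

(** The indices of an [HN_sum] may repeat, so one inclusion uses that the space of the whole list is
    closed under addition; the other uses one summand for each entry of s. *)
Lemma HN_sum_VS (I : eqType) (A : set I) (V : I -> set (heis_fun R))
    (v : I -> int -> R[i]) (s : seq I) :
  vortho (map v s) -> (forall i, A i <-> i \in s) ->
  (forall i, A i -> V i = VS [:: v i]) ->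
  HN_sum N A V = VS (map v s).
Proof.
move=> os As EV; apply/seteqP; split=> F.
  move=> [HF [m [i [G [AG FG]]]]].
  apply: (@VS_ae _ (fun x => \sum_(k < m) G k x)) => //; last by case: HF.
  apply: closed_subspace_sum; first exact: VS_closed.
  move=> k; have [Ak] := AG k; rewrite EV //.
  have ks : (index (i k) s < size s)%N by rewrite index_mem; apply/As.
  apply: (@VS_mem _ _ (index (i k) s)); first by rewrite size_map.
  by rewrite /cf (nth_map (i k)) // nth_index // -index_mem.
move=> VF; split; first exact: VS_HN VF.
have [mF [phi [p0 Fphi]]] := VF.
(* An empty list offers no default element for [nth]; F is then almost everywhere the empty sum. *)
case: s os As VF Fphi => [|i0 s] os As VF Fphi.
  exists 0%N, (fun k : 'I_0 => False_rect I (ltac:(by case: k))), (fun k _ => 0).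
  split; first by case.
  apply: filterS Fphi => x ->; rewrite big_ord0 /hlift /synth big_ord0 mulr0 //.
pose s' := i0 :: s.
exists (size s'), (fun k => nth i0 s' k), (fun k => hlift (opS (v (nth i0 s' k)) (phi k))).
split.
  move=> k; have Ak : A (nth i0 s' k) by apply/As; rewrite mem_nth.
  split=> //; rewrite EV //; split.
    by apply: hlift_meas; have [[]] := lq_opS (v (nth i0 s' k)) (p0 k).2.
  exists (fun j => phi k); split=> //.
  by apply: aeW => x; congr (hlift _ x); apply/funext => p; rewrite /synth big_ord1.
apply: filterS Fphi => x ->; rewrite /hlift /synth mulr_sumr size_map.
by apply: eq_bigr => k _; rewrite /cf (nth_map i0).
Qed.

Lemma VS_orthogonal L L' F G :
  (forall i j, (i < size L)%N -> (j < size L')%N -> dotv (cf L i) (cf L' j) = 0) ->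
  VS L F -> VS L' G -> heis_inner F G = 0.
Proof.
move=> d0 [mF [phi [p0 Fphi]]] [mG [psi [q0 Gpsi]]].
have lF : lq (synth L phi) by apply: lq_synth => i; case: (p0 i).
have lG : lq (synth L' psi) by apply: lq_synth => i; case: (q0 i).
rewrite (heis_inner_lift mF mG lF lG Fphi Gpsi).
have key psi' : (forall i, qp0 (psi' i) /\ lq (psi' i)) ->
    rin (synth L phi) (synth L' psi') = 0.
  move=> q0'; rewrite /synth (@rin_sum R N); last 2 first.
  - by move=> i; apply: lq_opS; case: (p0 i).
  - by apply: lq_synth => i; case: (q0' i).
  apply: big1 => i _; rewrite rinC (@rin_sum R N); last 2 first.
  - by move=> j; apply: lq_opS; case: (q0' j).
  - by apply: lq_opS; case: (p0 i).
  apply: big1 => j _; rewrite rinC; have [] := p0 i; have [] := q0' j => *.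
  by apply: (rin_opS N0) => //; exact: d0.
rewrite key // (@eq_rin2 _ _ (synth L phi) _ (synth L' (fun i p => 'i * psi i p))) //.
  rewrite key // => i; have [qi li] := q0 i.
  by split; [exact: qp0Z|exact: lqZ].
move=> p; rewrite /synth mulr_sumr; apply: eq_bigr => i _.
by rewrite /opS mulr_sumr; apply: eq_bigr => r _; rewrite /opX mulrCA (mulrCA 'i).
Qed.

End SynthesisSpaces.

(** * Sums over the integers and the Weil--Brezin map *)

Section SumZ.
Variable R : realType.

(** [sumZ] adds two values of [limn], which carry no information without convergence. This relation
    keeps convergence and value together. *)
Definition has_sumZ (u : int -> R) (l : R) := exists l1 l2,
  [/\ series (fun n => u (Posz n)) @ \oo --> l1,
      series (fun n => u (Negz n)) @ \oo --> l2 & l = l1 + l2].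

Lemma has_sumZ_eq u l : has_sumZ u l -> sumZ u = l.
Proof. by move=> [l1 [l2 [c1 c2 ->]]]; congr (_ + _); apply/cvg_lim. Qed.

Lemma eq_cvgn (f g : nat -> R) (l : R) : f =1 g -> f @ \oo --> l -> g @ \oo --> l.
Proof. by move=> /funext ->. Qed.

Lemma has_sumZD u v l m : has_sumZ u l -> has_sumZ v m ->
  has_sumZ (fun n => u n + v n) (l + m).
Proof.
move=> [l1 [l2 [c1 c2 ->]]] [m1 [m2 [d1 d2 ->]]].
exists (l1 + m1), (l2 + m2); split; last by rewrite addrACA.
- by apply: eq_cvgn (cvgD c1 d1) => k; rewrite /series /= big_split.
- by apply: eq_cvgn (cvgD c2 d2) => k; rewrite /series /= big_split.
Qed.

Lemma has_sumZM (b : R) u l : has_sumZ u l -> has_sumZ (fun n => b * u n) (b * l).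
Proof.
move=> [l1 [l2 [c1 c2 ->]]]; exists (b * l1), (b * l2); split; last by rewrite mulrDr.
- by apply: eq_cvgn (cvgM (cvg_cst b) c1) => k; rewrite /series /= mulr_sumr.
- by apply: eq_cvgn (cvgM (cvg_cst b) c2) => k; rewrite /series /= mulr_sumr.
Qed.

(** A shift by one moves a single term across the cut at 0: here u 0 leaves the nonnegative half and
    joins the negative one. *)
Lemma has_sumZ_succ u l : has_sumZ u l -> has_sumZ (fun n => u (n + 1)) l.
Proof.
move=> [l1 [l2 [c1 c2 ->]]]; exists (l1 - u 0), (u 0 + l2); split; last by rewrite addrA subrK.
- have c1' : (fun k => series (fun n => u (Posz n)) k.+1) @ \oo --> l1 by rewrite cvg_shiftS.
  apply: eq_cvgn (cvgB c1' (cvg_cst (u 0))) => k.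
  rewrite fctE /series /= big_nat_recl // addrAC subrr add0r.
  by apply: eq_bigr => i _; rewrite -PoszD addn1.
- rewrite -cvg_shiftS.
  apply: eq_cvgn (cvgD (cvg_cst (u 0)) c2) => k.
  rewrite fctE /series /= [RHS]big_nat_recl //; congr (_ + _).
  by apply: eq_bigr => i _; congr u; rewrite !NegzE; lia.
Qed.

Lemma has_sumZ_pred u l : has_sumZ u l -> has_sumZ (fun n => u (n - 1)) l.
Proof.
move=> [l1 [l2 [c1 c2 ->]]]; exists (u (-1) + l1), (l2 - u (-1)); split; last by ring.
- rewrite -cvg_shiftS.
  apply: eq_cvgn (cvgD (cvg_cst (u (-1))) c1) => k.
  rewrite fctE /series /= [RHS]big_nat_recl //; congr (_ + _).
  by apply: eq_bigr => i _; congr u; lia.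
- have c2' : (fun k => series (fun n => u (Negz n)) k.+1) @ \oo --> l2 by rewrite cvg_shiftS.
  apply: eq_cvgn (cvgB c2' (cvg_cst (u (-1)))) => k.
  rewrite fctE /series /= big_nat_recl //= addrAC subrr add0r.
  by apply: eq_bigr => i _; congr u; rewrite !NegzE; lia.
Qed.

Lemma has_sumZ_shift (k : int) u l : has_sumZ u l -> has_sumZ (fun n => u (n + k)) l.
Proof.
move=> ul; case: k => k.
- elim: k => [|k IH]; first by under eq_fun do rewrite addr0.
  have := has_sumZ_succ IH; congr has_sumZ; apply/funext => i; congr u; lia.
- rewrite NegzE; elim: k => [|k IH]; first exact: has_sumZ_pred.
  have := has_sumZ_pred IH; congr has_sumZ; apply/funext => i; congr u; lia.
Qed.

Lemma series_finite (u : nat -> R) M : (forall k, (M <= k)%N -> u k = 0) ->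
  series u @ \oo --> \sum_(i < M) u i.
Proof.
move=> u0; apply: cvg_near_cst; exists M => // k /= Mk.
rewrite /series /= (@big_cat_nat _ _ _ M 0%N k) //= big_mkord.
by rewrite [X in _ + X]big_nat_cond [X in _ + X]big1 ?addr0 // => i /andP[/andP[Mi _] _]; exact: u0.
Qed.

Lemma has_sumZ_finite u (M : nat) : (forall k : int, (M <= `|k|)%N -> u k = 0) ->
  has_sumZ u (\sum_(i < M) u (Posz i) + \sum_(i < M) u (Negz i)).
Proof.
move=> u0; exists (\sum_(i < M) u (Posz i)), (\sum_(i < M) u (Negz i)); split=> //.
- by apply: (@series_finite (fun i => u (Posz i))) => k Mk; apply: u0.
- apply: (@series_finite (fun i => u (Negz i))) => k Mk; apply: u0.
  by rewrite (leq_trans Mk) //= leqnSn.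
Qed.

Lemma series_inv_sq_cvg : cvgn (series (fun k => (1 + k%:R ^+ 2 : R)^-1)).
Proof.
apply: nondecreasing_is_cvgn.
  by apply/nondecreasing_seqP => k; rewrite /series /= big_nat_recr //= lerDl invr_ge0 addr_ge0 // sqr_ge0.
exists 3 => _ [k _ <-]; case: k => [|k]; first by rewrite /series /= big_geq.
(* Telescoping: 1/(1 + x^2) <= 2/x - 2/(x + 1), and the constant 3 makes the first partial sum,
   equal to 1, an equality. *)
apply: (@le_trans _ _ (3 - 2 * (k.+1%:R)^-1)); last by rewrite gerBl mulr_ge0 // invr_ge0.
elim: k => [|k IH].
  by rewrite /series /= big_nat1 expr0n /= addr0 invr1; lra.
rewrite /series /= big_nat_recr //=; rewrite /series /= in IH.
apply: le_trans (lerD IH (lexx _)) _.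
set x : R := k.+1%:R; have x1 : 1 <= x by rewrite ler1n.
have -> : k.+2%:R = x + 1 :> R by rewrite /x -natr1.
have x0 : 0 < x by rewrite (lt_le_trans ltr01).
have y0 : 0 < x + 1 by rewrite addr_gt0.
have z0 : 0 < 1 + x ^+ 2 by rewrite ltr_pwDl // sqr_ge0.
have : (1 + x ^+ 2)^-1 <= 2 * x^-1 - 2 * (x + 1)^-1.
  have -> : 2 * x^-1 - 2 * (x + 1)^-1 = 2 / (x * (x + 1)).
    by field; rewrite !gt_eqF.
  rewrite -[leLHS]div1r ler_pdivrMr // mulrAC ler_pdivlMr ?mulr_gt0 //.
  rewrite expr2; nra.
by move=> H; rewrite -addrA lerD2l addrC lerBlDr [leRHS]addrC.
Qed.

Lemma has_sumZ_dom u (C : R) : (forall k : int, `|u k| <= C / (1 + k%:~R ^+ 2)) ->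
  exists l, has_sumZ u l.
Proof.
move=> uC.
have cC : cvgn (series (fun k => C / (1 + k%:R ^+ 2 : R))).
  apply/cvg_ex; exists (C * limn (series (fun k => (1 + k%:R ^+ 2 : R)^-1))).
  apply: eq_cvgn (cvgM (cvg_cst C) series_inv_sq_cvg) => k.
  by rewrite /series /= mulr_sumr.
have C0 : 0 <= C.
  by have := uC 0; rewrite expr0n /= addr0 divr1; exact: le_trans.
have D0 (k : nat) : 0 < 1 + k%:R ^+ 2 :> R by rewrite ltr_pwDl // sqr_ge0.
have CD (k : nat) : 0 <= C / (1 + k%:R ^+ 2 : R) by rewrite divr_ge0 // ltW.
have h1 : cvgn (series (fun k => u (Posz k))).
  apply: normed_cvg; apply: (series_le_cvg _ CD _ cC) => k; first exact: normr_ge0.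
  exact: (uC (Posz k)).
have h2 : cvgn (series (fun k => u (Negz k))).
  apply: normed_cvg; apply: (series_le_cvg _ CD _ cC) => k; first exact: normr_ge0.
  apply: le_trans (uC (Negz k)) _.
  (* [Negz k] is -(k+1), and 1 + k^2 <= 1 + (k+1)^2, so the majorant of the nonnegative half also
     serves here. *)
  rewrite ler_wpM2l // NegzE mulrNz sqrrN -pmulrn.
  by rewrite lef_pV2 ?posrE ?D0 // lerD2l ler_pXn2r ?nnegrE // ler_nat.
move/cvg_ex: h1 => [l1 c1]; move/cvg_ex: h2 => [l2 c2].
by exists (l1 + l2), l1, l2.
Qed.

Lemma Re_sum (I : Type) (s : seq I) (F : I -> R[i]) :
  complex.Re (\sum_(i <- s) F i) = \sum_(i <- s) complex.Re (F i).
Proof. by apply: (big_morph (@complex.Re R)) => // -[? ?] [? ?]. Qed.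

Lemma Im_sum (I : Type) (s : seq I) (F : I -> R[i]) :
  complex.Im (\sum_(i <- s) F i) = \sum_(i <- s) complex.Im (F i).
Proof. by apply: (big_morph (@complex.Im R)) => // -[? ?] [? ?]. Qed.

Definition has_csumZ (u : int -> R[i]) (l : R[i]) :=
  has_sumZ (fun n => complex.Re (u n)) (complex.Re l) /\
  has_sumZ (fun n => complex.Im (u n)) (complex.Im l).

Lemma has_csumZ_eq u l : has_csumZ u l -> csumZ u = l.
Proof.
by move=> [/has_sumZ_eq h1 /has_sumZ_eq h2]; rewrite /csumZ h1 h2; case: l {h1 h2}.
Qed.

Lemma has_csumZD u v l m : has_csumZ u l -> has_csumZ v m ->
  has_csumZ (fun n => u n + v n) (l + m).
Proof.
move=> [u1 u2] [v1 v2]; split.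
- have := has_sumZD u1 v1; congr has_sumZ; last by case: l m {u1 u2 v1 v2} => ? ? [].
  by apply/funext => k; case: (u k) (v k) => ? ? [].
- have := has_sumZD u2 v2; congr has_sumZ; last by case: l m {u1 u2 v1 v2} => ? ? [].
  by apply/funext => k; case: (u k) (v k) => ? ? [].
Qed.

Lemma has_csumZM (b : R[i]) u l : has_csumZ u l -> has_csumZ (fun n => b * u n) (b * l).
Proof.
move=> [u1 u2]; case: b => b1 b2; split.
- have := has_sumZD (has_sumZM b1 u1) (has_sumZM (- b2) u2).
  congr has_sumZ; last by case: l {u1 u2} => ? ? /=; rewrite mulNr.
  by apply/funext => k; case: (u k) => ? ? /=; rewrite mulNr.
- have := has_sumZD (has_sumZM b1 u2) (has_sumZM b2 u1).
  congr has_sumZ; last by case: l {u1 u2}.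
  by apply/funext => k; case: (u k).
Qed.

Lemma has_csumZ_shift (k : int) u l : has_csumZ u l -> has_csumZ (fun n => u (n + k)) l.
Proof.
by move=> [u1 u2]; split; [exact: (has_sumZ_shift k u1)|exact: (has_sumZ_shift k u2)].
Qed.

Lemma has_csumZ0 : has_csumZ (fun=> 0) 0.
Proof.
have : has_sumZ (fun _ : int => 0 : R) 0.
  have := @has_sumZ_finite (fun=> 0) 0%N (fun _ _ => erefl).
  by rewrite !big_ord0 addr0.
by move=> h; split.
Qed.

Lemma has_csumZ_sum (I : Type) (s : seq I) (u : I -> int -> R[i]) (l : I -> R[i]) :
  (forall i, has_csumZ (u i) (l i)) ->
  has_csumZ (fun n => \sum_(i <- s) u i n) (\sum_(i <- s) l i).
Proof.
move=> ul; elim: s => [|i s IH].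
  rewrite big_nil; have := has_csumZ0; congr has_csumZ; apply/funext => k.
  by rewrite big_nil.
rewrite big_cons; have := has_csumZD (ul i) IH; congr has_csumZ; apply/funext => k.
by rewrite big_cons.
Qed.

Lemma has_csumZ_finite u (M : nat) : (forall k : int, (M <= `|k|)%N -> u k = 0) ->
  has_csumZ u (\sum_(i < M) u (Posz i) + \sum_(i < M) u (Negz i)).
Proof.
move=> u0.
split.
- have := @has_sumZ_finite (fun k => complex.Re (u k)) M.
  rewrite -!Re_sum => H; rewrite [X in has_sumZ _ X](_ : _ = complex.Re (\sum_(i < M) u (Posz i)) + complex.Re (\sum_(i < M) u (Negz i))).
    by apply: H => k Mk; rewrite u0.
  by case: (\sum_(i < M) _) (\sum_(i < M) _) => ? ? [].
- have := @has_sumZ_finite (fun k => complex.Im (u k)) M.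
  rewrite -!Im_sum => H; rewrite [X in has_sumZ _ X](_ : _ = complex.Im (\sum_(i < M) u (Posz i)) + complex.Im (\sum_(i < M) u (Negz i))).
    by apply: H => k Mk; rewrite u0.
  by case: (\sum_(i < M) _) (\sum_(i < M) _) => ? ? [].
Qed.

Lemma has_csumZ_single u (k0 : int) : (forall k, k != k0 -> u k = 0) -> has_csumZ u (u k0).
Proof.
move=> u0.
have := @has_csumZ_finite (fun k => u (k + k0)) 1%N.
rewrite !big_ord1 add0r [u (Negz 0 + k0)]u0 ?addr0 => [H|]; last by apply/eqP; lia.
have {H}H : has_csumZ (fun k => u (k + k0)) (u k0).
  by apply: H => k k1; apply: u0; apply/eqP; lia.
have := has_csumZ_shift (- k0) H; congr has_csumZ; apply/funext => k.
by rewrite subrK.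
Qed.

Lemma has_csumZ_dom (u : int -> R[i]) (C : R) :
  (forall k : int, sqmod (u k) <= (C / (1 + k%:~R ^+ 2)) ^+ 2) -> 0 <= C ->
  exists l, has_csumZ u l.
Proof.
move=> uC C0.
have D0 (k : int) : 0 <= C / (1 + k%:~R ^+ 2) by rewrite divr_ge0 // addr_ge0 // sqr_ge0.
have aux (x y : R) : x ^+ 2 <= y ^+ 2 -> 0 <= y -> `|x| <= y.
  by move=> xy y0; rewrite -(ger0_norm y0) -ler_sqr ?nnegrE // !real_normK ?num_real.
have [l1 h1] : exists l, has_sumZ (fun n => complex.Re (u n)) l.
  apply: (@has_sumZ_dom _ C) => k; apply: aux => //.
  exact: le_trans (sqmod_Re _) (uC k).
have [l2 h2] : exists l, has_sumZ (fun n => complex.Im (u n)) l.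
  apply: (@has_sumZ_dom _ C) => k; apply: aux => //.
  exact: le_trans (sqmod_Im _) (uC k).
by exists (l1 +i* l2).
Qed.

Lemma has_csumZ_lim (u : int -> R[i]) l : has_csumZ u l ->
  (fun k => complex.Re (\sum_(i < k) (u (Posz i) + u (Negz i)))) @ \oo --> complex.Re l /\
  (fun k => complex.Im (\sum_(i < k) (u (Posz i) + u (Negz i)))) @ \oo --> complex.Im l.
Proof.
move=> [[l1 [l2 [c1 c2 e1]]] [m1 [m2 [d1 d2 e2]]]]; rewrite e1 e2; split.
- apply: eq_cvgn (cvgD c1 c2) => k; rewrite fctE /series /= !big_mkord -big_split Re_sum.
  by apply: eq_bigr => i _; case: (u i) (u (Negz i)) => ? ? [].
- apply: eq_cvgn (cvgD d1 d2) => k; rewrite fctE /series /= !big_mkord -big_split Im_sum.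
  by apply: eq_bigr => i _; case: (u i) (u (Negz i)) => ? ? [].
Qed.

End SumZ.

(** * Weil--Brezin sums with periodic coefficients *)

Section WeilBrezin.
Variables (R : realType) (N : int).
Hypothesis N0 : N != 0.
Local Notation T1 := (measurableTypeR R).
Local Notation T2 := (T1 * T1)%type.
Local Notation NR := (N%:~R : R).
Local Notation n := (`|N|%N).
Implicit Types (g h : T2 -> R[i]) (F G : heis_fun R) (b v w : int -> R[i])
  (u : R -> R[i]).

Definition decay u := exists2 C : R, 0 <= C & forall x, sqmod (u x) <= (C / (1 + x ^+ 2)) ^+ 2.

Definition nice u := decay u /\ cmeasurable (u : T1 -> R[i]).

Definition bdd b := exists2 B : R, 0 <= B & forall k, sqmod (b k) <= B ^+ 2.

Definition wterm b u (p : T2) (k : int) : R[i] :=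
  b k * u (k%:~R + NR * p.2) * expi2pi (k%:~R * p.1).

(* The Weil--Brezin sum with chi(nd/N) replaced by b n. *)
Definition WB b u : T2 -> R[i] := fun p => csumZ (wterm b u p).

(** The values chi(nd/N) for d = 1 and the trivial character, so [W0] is W_{N,1} without its
    constant and the factor e(Nz). *)
Definition dlt (k : int) : R[i] := if (N %| k)%Z then 1 else 0.

Definition W0 u := WB dlt u.

Lemma wterm_summable b u p : bdd b -> decay u -> has_csumZ (wterm b u p) (WB b u p).
Proof.
move=> [B B0 bB] [C C0 uC].
suff [l hl] : exists l, has_csumZ (wterm b u p) l by rewrite /WB (has_csumZ_eq hl).
set y := NR * p.2.
apply: (@has_csumZ_dom _ _ (B * C * (2 * (1 + y ^+ 2)))); last first.
  by rewrite !mulr_ge0 // addr_ge0 // sqr_ge0.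
move=> k; rewrite /wterm !sqmodM sqmod_expi mulr1 -/y.
set x : R := k%:~R.
have x0 : 0 < 1 + x ^+ 2 by rewrite ltr_pwDl // sqr_ge0.
have xy0 : 0 < 1 + (x + y) ^+ 2 by rewrite ltr_pwDl // sqr_ge0.
apply: (@le_trans _ _ ((B * (C / (1 + (x + y) ^+ 2))) ^+ 2)).
  by rewrite exprMn ler_pM ?sqmod_ge0.
(* Peetre's inequality 1 + x^2 <= 2 (1 + y^2)(1 + (x + y)^2): translating u by y costs only a factor
   depending on y. *)
have key : (1 + (x + y) ^+ 2)^-1 <= 2 * (1 + y ^+ 2) / (1 + x ^+ 2).
  rewrite ler_pdivlMr // mulrC ler_pdivrMr //.
  have := sqr_ge0 (x + y); have := sqr_ge0 y; have := sqr_ge0 ((x + y) + y).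
  rewrite !expr2; nra.
rewrite ler_pXn2r ?nnegrE //.
- by rewrite mulrA -!mulrA ler_wpM2l // ler_wpM2l // mulrA.
- by rewrite !mulr_ge0 // invr_ge0 ltW.
- by rewrite !mulr_ge0 ?invr_ge0 ?(ltW x0) // addr_ge0 // sqr_ge0.
Qed.

Lemma bdd_dlt (r : int) : bdd (fun k => dlt (k - r)).
Proof.
exists 1 => // k; rewrite /dlt expr1n.
by case: ifP => _; rewrite ?sqmod1 ?sqmod0.
Qed.

Lemma bdd_dlt0 : bdd dlt.
Proof. by have := bdd_dlt 0; congr bdd; apply/funext => k; rewrite subr0. Qed.

Definition per b := forall k, b (k + N) = b k.

Lemma per_mod b j k : per b -> (N %| j - k)%Z -> b j = b k.
Proof.
move=> pb /dvdzP[q /eqP]; rewrite subr_eq addrC => /eqP ->.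
have Hn (m : nat) i : b (i + m%:Z * N) = b i.
  elim: m i => [|m IH] i; first by rewrite mul0r addr0.
  by rewrite intS mulrDl mul1r addrA IH pb.
case: q => m; first exact: Hn.
by rewrite -[LHS](Hn m.+1) NegzE mulNr subrK.
Qed.

Lemma ord_residue (k : int) : exists r : 'I_n, (N %| k - r%:Z)%Z.
Proof.
have rn : (`|(k %% N)%Z| < n)%N.
  by rewrite -ltz_nat gez0_abs ?modz_ge0 // abszE ltz_mod.
exists (Ordinal rn) => /=.
rewrite gez0_abs ?modz_ge0 //; apply/dvdzP; exists (k %/ N)%Z.
by rewrite {1}(divz_eq k N) addrK.
Qed.

Lemma per_sum b k : per b -> b k = \sum_(r < n) b r * dlt (k - r%:Z).
Proof.
move=> pb; have [r kr] := ord_residue k.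
rewrite (bigD1 r) //= /dlt kr mulr1 big1 ?addr0 => [|s sr]; first exact: per_mod.
case: ifPn => [ks|]; last by rewrite mulr0.
move: sr; rewrite -dvdz_ord // -[_ - _](_ : (k - r%:Z) - (k - s%:Z) = _); last by ring.
by rewrite rpredB.
Qed.

(** Multiplying by e(ra) and moving c by r/N shifts the summation index by r, so the sum over
    multiples of N becomes the sum over the class of r. *)
Lemma opX_W0 (r : int) u p : decay u ->
  has_csumZ (wterm (fun k => dlt (k - r)) u p) (opX N r (W0 u) p).
Proof.
move=> du.
have := wterm_summable (p.1, p.2 + r%:~R / NR) bdd_dlt0 du.
move=> /(has_csumZM (expi2pi (r%:~R * p.1))) /(has_csumZ_shift (- r)).
congr has_csumZ; apply/funext => k; rewrite /wterm /=.
rewrite [LHS]mulrCA; congr (_ * _ * _).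
  congr u; rewrite intrB; field; exact: NR0.
by rewrite -expi2piD; congr expi2pi; rewrite intrB; ring.
Qed.

Lemma WB_opS b u : per b -> decay u -> WB b u = opS N b (W0 u).
Proof.
move=> pb du; apply/funext => p; apply: has_csumZ_eq.
have := @has_csumZ_sum _ _ (index_enum 'I_n) (fun r k => b r * wterm (fun k => dlt (k - r%:Z)) u p k) _
  (fun r => has_csumZM (b r) (opX_W0 r p du)).
congr has_csumZ; apply/funext => k.
by rewrite /wterm (per_sum k pb) !mulr_suml; apply: eq_bigr => r _; rewrite !mulrA.
Qed.

Lemma WB_lin b (c : R[i]) u u' : bdd b -> decay u -> decay u' ->
  WB b (fun x => c * u x + u' x) = fun p => c * WB b u p + WB b u' p.
Proof.
move=> bb du du'; apply/funext => p; apply: has_csumZ_eq.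
have := has_csumZD (has_csumZM c (wterm_summable p bb du)) (wterm_summable p bb du').
by congr has_csumZ; apply/funext => k; rewrite /wterm; ring.
Qed.

Lemma W0_qp0 u : nice u -> qp0 N (W0 u).
Proof.
move=> [du mu]; split; last first.
  move=> a c; rewrite /W0 /WB; congr csumZ; apply/funext => k; rewrite /wterm /dlt /=.
  case: ifP => [/dvdzP[q ->]|_]; last by rewrite !mul0r.
  by rewrite mulrDr intrM mulfK ?NR0 // expi2piDz.
split.
- have h p := has_csumZ_lim (wterm_summable p bdd_dlt0 du).
  apply: (cmeas_lim _ (fun p => (h p).1) (fun p => (h p).2)) => k.
  have mt (j : int) : cmeasurable (fun p => wterm dlt u p j).
    apply: cmeasM; last exact: cmeas_expi_fst.
    apply: cmeasM; first exact: cmeas_cst.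
    apply: (cmeas_comp mu); apply: measurable_funD => //.
    by apply: measurable_funM => //; exact: measurable_snd.
  by apply: cmeas_sum => i; exact: cmeasD.
- move=> a c; rewrite /W0 /WB; congr csumZ; apply/funext => k; rewrite /wterm /=.
  by rewrite mulrDr mulr1 expi2piDz.
- move=> a c; apply: has_csumZ_eq.
  have := wterm_summable (a, c) bdd_dlt0 du.
  move=> /(has_csumZM (expi2pi (- (NR * a)))) /(has_csumZ_shift N).
  congr has_csumZ; apply/funext => k; rewrite /wterm /=.
  rewrite [LHS]mulrCA; congr (_ * _ * _).
  - by rewrite /dlt rpredDr ?dvdzz.
  - by congr u; rewrite intrD; ring.
  - by rewrite -expi2piD; congr expi2pi; rewrite intrD; ring.
Qed.

Definition wconst (d : nat) : R[i] := sqrtC (N%:~R / (totient d)%:R).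

Lemma weil_brezinE d chi u : weil_brezin N d chi u =
  hlift N (fun p => wconst d * WB (char_at_quot N d chi) u p).
Proof.
apply/funext => -[[a c] z]; rewrite /weil_brezin /hlift /WB /wterm /=.
by rewrite -mulrA mulrCA.
Qed.

Lemma wconst_neq0 d : (0 < d)%N -> wconst d != 0.
Proof.
move=> d0; rewrite sqrtC_eq0 mulf_neq0 ?invr_eq0 ?intr_eq0 //.
by rewrite pnatr_eq0 -lt0n totient_gt0.
Qed.

(** On Schwartz functions the map is S_v applied to a multiple of [W0], and the space attached to v
    is closed. *)
Lemma HNd_sub_VS d chi : per (char_at_quot N d chi) ->
  dotv N (char_at_quot N d chi) (char_at_quot N d chi) != 0 ->
  (forall u, schwartz u -> nice u) ->
  HNd N d chi `<=` VS N [:: char_at_quot N d chi].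
Proof.
set v := char_at_quot N d chi => pv vv sn F [f [_ HF [u [su _ uF]]]].
have ov : vortho N [:: v] by move=> [|i] [|j].
have [_ _ _ cl] := VS_closed N0 ov.
have [mF [g lg Fg]] := HN_liftP HF.
pose gk k : T2 -> R[i] := fun p => wconst d * WB v (u k) p.
have Wk k : weil_brezin N d chi (u k) = hlift N (gk k) := weil_brezinE d chi (u k).
have q0 k : qp0 N (fun p => wconst d * W0 (u k) p).
  by apply: qp0Z; apply: W0_qp0; apply: sn; exact: su.
have gkE k : gk k = synth N [:: v] (fun _ p => wconst d * W0 (u k) p).
  rewrite /gk WB_opS //; last by have [] := sn _ (su k).
  apply/funext => p; rewrite /synth big_ord1 /opS mulr_sumr.
  by apply: eq_bigr => r _; rewrite /opX !(mulrCA (wconst d)).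
have qgk k : qp N (gk k).
  rewrite gkE; apply: qp_sum => i; apply: good_qp; first exact: good_opS.
  by case: (q0 k).
have E k : heis_sqnorm (fun x => weil_brezin N d chi (u k) x - F x) =
    tsq (fun p => gk k p - g p).
  have [mgk _ _] := qgk k; have [mg _ _] := lg.1.
  rewrite -(@heis_sqnorm_hlift R N); last exact: cmeasB.
  apply: eq_heis_sqnorm.
  - by apply: cmeasB => //; rewrite Wk; exact: hlift_meas.
  - by apply: hlift_meas; exact: cmeasB.
  - by apply: filterS Fg => x ->; rewrite Wk /hlift mulrBr.
(* Square integrability of [gk k] is deduced from its distance to F being less than 1, so the
   sequence is started at K. *)
have [K _ HK] := cvg0_lt uF ltr01.
pose s k := heis_sqnorm (fun x => weil_brezin N d chi (u k) x - F x).
have cv : heis_cvg (fun k => weil_brezin N d chi (u (k + K)%N)) F.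
  have : (fun k => s (k + K)%N) @ \oo --> 0%E by rewrite cvg_shiftn.
  exact.
suff VSk k : VS N [:: v] (weil_brezin N d chi (u (k + K)%N)) by exact: (cl _ F VSk HF cv).
rewrite Wk.
have lgk : lq N (gk (k + K)%N).
  split=> //; have [mgk _ _] := qgk (k + K)%N; have [mg _ _] := lg.1.
  rewrite (@eq_tsq _ (gk (k + K)%N) (fun p => (gk (k + K)%N p - g p) + g p)); last first.
    by move=> p; rewrite subrK.
  apply: le_lt_trans (tsqD (cmeasB mgk mg) mg) _.
  rewrite lte_mul_pinfty ?lee_fin // lte_add_pinfty //; last by case: lg.
  by rewrite -E; apply: lt_trans (HK _ (leq_addl _ _)) _; rewrite ltry.
split; first by apply: hlift_meas; have [[]] := lgk.
(* A nonzero coefficient v r lets [opA] recover [W0 (u k)] from the synthesis, which shows that it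
   is square integrable. *)
have r0 : exists r : 'I_n, v r != 0.
  apply: contrapT => H; move/eqP: vv; apply; apply: big1 => r _.
  apply: contrapT => H'; apply: H; exists r; apply/eqP => vr0.
  by apply: H'; rewrite vr0 mul0r.
have [r vr] := r0.
exists (fun _ => fun p => wconst d * W0 (u (k + K)%N) p); split; last first.
  by apply: aeW => x; rewrite -gkE.
move=> _; split; first exact: q0.
have -> : (fun p => wconst d * W0 (u (k + K)%N) p) = (fun p => (v r)^-1 * opA N r (gk (k + K)%N) p).
  apply/funext => p; rewrite gkE /synth.
  rewrite (_ : (fun p => _) = opS N v (fun p => wconst d * W0 (u (k + K)%N) p)); last first.
    by apply/funext => q; rewrite big_ord1.
  by rewrite opA_S // mulKf.
by apply: lqZ; exact: lq_good (good_opA R N0 r) lgk.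
Qed.

End WeilBrezin.

(** * Density of the range of the Weil--Brezin map *)

Section SchwartzNice.
Variable R : realType.
Local Notation T1 := (measurableTypeR R).

Lemma schwartz_real_cont (f : R -> R) : schwartz_real f -> continuous f.
Proof.
move=> [df _] x; apply: differentiable_continuous.
by apply/derivable1_diffP; have := df 0%N x; rewrite derive1n0.
Qed.

Lemma schwartz_real_decay (f : R -> R) : schwartz_real f ->
  exists2 C : R, 0 <= C & forall x, `|f x| <= C / (1 + x ^+ 2).
Proof.
move=> [_ bf]; have [M0 h0] := bf 0%N 0%N; have [M2 h2] := bf 0%N 2%N.
exists (M0 + M2).
  by apply: addr_ge0; [apply: le_trans (h0 0)|apply: le_trans (h2 0)].
move=> x; have x0 : 0 < 1 + x ^+ 2 by rewrite ltr_pwDl // sqr_ge0.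
rewrite ler_pdivlMr // mulrDr mulr1 lerD //.
  by have := h0 x; rewrite derive1n0 expr0 mul1r.
have := h2 x; rewrite derive1n0 normrM ger0_norm ?sqr_ge0 //.
by rewrite mulrC.
Qed.

Lemma schwartz_nice (u : R -> R[i]) : schwartz u -> nice u.
Proof.
move=> [s1 s2]; split; last first.
  by split; apply: continuous_measurable_fun; exact: schwartz_real_cont.
have [C1 C10 h1] := schwartz_real_decay s1; have [C2 C20 h2] := schwartz_real_decay s2.
exists (C1 + C2); first exact: addr_ge0.
move=> x; have x0 : 0 < 1 + x ^+ 2 by rewrite ltr_pwDl // sqr_ge0.
have D0 : 0 <= (1 + x ^+ 2)^-1 by rewrite invr_ge0 ltW.
rewrite /sqmod.
have a1 : complex.Re (u x) ^+ 2 <= (C1 / (1 + x ^+ 2)) ^+ 2.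
  by rewrite -real_normK ?num_real // ler_pXn2r ?nnegrE // mulr_ge0.
have a2 : complex.Im (u x) ^+ 2 <= (C2 / (1 + x ^+ 2)) ^+ 2.
  by rewrite -real_normK ?num_real // ler_pXn2r ?nnegrE // mulr_ge0.
apply: le_trans (lerD a1 a2) _; rewrite mulrDl.
have : 0 <= C1 / (1 + x ^+ 2) by rewrite mulr_ge0.
have : 0 <= C2 / (1 + x ^+ 2) by rewrite mulr_ge0.
rewrite !expr2; nra.
Qed.

End SchwartzNice.

(** * Smooth functions of compact support *)

Section Bump.
Variable R : realType.
Implicit Types p q : {poly R}.

Definition hp p (x : R) : R := if 0 < x then p.[x^-1] * expR (- x^-1) else 0.

Lemma horner_expR_bound p : exists2 C : R, 0 <= C &
  forall y, 0 <= y -> `|p.[y] * expR (- y)| <= C.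
Proof.
elim/poly_ind: p => [|p c [C C0 hC]].
  by exists 0 => // y _; rewrite horner0 mul0r normr0.
(* Monomials suffice, and y^m exp(-y) <= m! follows from one term of the exponential series. *)
suff key m : exists2 K : R, 0 <= K & forall y, 0 <= y -> y ^+ m * expR (- y) <= K.
  clear C C0 hC.
  exists (\sum_(i < size (p * 'X + c%:P)) `|(p * 'X + c%:P)`_i| * sval (cid2 (key i))).
    by apply: sumr_ge0 => i _; rewrite mulr_ge0 //; case: (cid2 _).
  move=> y y0; rewrite horner_coef mulr_suml.
  apply: le_trans (ler_norm_sum _ _ _) _; apply: ler_sum => i _.
  rewrite -mulrA normrM ler_wpM2l //; case: (cid2 _) => K K0 hK /=.
  by rewrite ger0_norm ?mulr_ge0 ?exprn_ge0 ?expR_ge0 //; exact: hK.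
case: m => [|m].
  exists 1 => // y y0; rewrite expr0 mul1r.
  by rewrite -[leRHS]expR0 ler_expR oppr_le0.
exists (m.+1)`!%:R => // y y0.
rewrite expRN ler_pdivrMr ?expR_gt0 //.
have := expR_ge1Dxn m y0; have f0 : 0 < (m.+1)`!%:R :> R by rewrite ltr0n fact_gt0.
move=> h; rewrite mulrC -ler_pdivrMr //; apply: le_trans h.
by rewrite lerDr.
Qed.

Lemma hp_bound p : exists2 C : R, 0 <= C & forall x, `|hp p x| <= C.
Proof.
have [C C0 h] := horner_expR_bound p; exists C => // x; rewrite /hp.
by case: ifP => x0; [apply: h; rewrite invr_ge0 ltW|rewrite normr0].
Qed.

Lemma hp_bound_sq p : exists2 C : R, 0 <= C & forall x, `|hp p x| <= C * x ^+ 2.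
Proof.
have [C C0 h] := horner_expR_bound ('X^2 * p); exists C => // x; rewrite /hp.
case: ifP => x0; last by rewrite normr0 mulr_ge0 // sqr_ge0.
have /h : 0 <= x^-1 by rewrite invr_ge0 ltW.
rewrite hornerM hornerXn -mulrA normrM ger0_norm ?sqr_ge0 // exprVn mulrC.
by rewrite ler_pdivrMr // exprn_gt0.
Qed.

(** With y = 1/x > 0 the derivative is (p(y) - p'(y)) y^2 exp(-y), hence the new polynomial. At 0
    the bound [hp_bound_sq] makes the difference quotient tend to 0. *)
Lemma is_derive_hp p (x : R) : is_derive x 1 (hp p) (hp ((p - p^`()) * 'X^2) x).
Proof.
case: (ltgtP 0 x) => [x0|x0|<-].
- have x1 : x != 0 by rewrite gt_eqF.
  apply: (@near_eq_is_derive R R R (fun x : R => p.[x^-1] * expR (- x^-1))).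
    near=> y; rewrite /hp ifT //.
    by near: y; exact: lt_nbhsr.
  have dV : is_derive x 1 (fun y : R => y^-1) (- x ^- 2).
    by have := is_deriveV x1 (is_derive_id x 1); rewrite [_ *: _]mulr1.
  have d1 : is_derive x 1 (fun y : R => p.[y^-1]) (p^`().[x^-1] * - x ^- 2).
    exact: (@is_derive1_comp _ (horner p) (fun y : R => y^-1) _ _ _ (is_derive_poly p _) dV).
  have d2 : is_derive x 1 (fun y : R => expR (- y^-1)) (expR (- x^-1) * x ^- 2).
    have dN : is_derive x 1 (fun y : R => - y^-1) (x ^- 2).
      by have := is_deriveN dV; rewrite opprK.
    exact: (@is_derive1_comp _ expR (fun y : R => - y^-1) _ _ _ (is_derive_expR _) dN).
  apply: is_derive_eq (is_deriveM d1 d2) _.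
  rewrite /hp x0 hornerM hornerXn hornerD hornerN exprVn /GRing.scale /=; ring.
- apply: (@near_eq_is_derive R R R (cst 0)).
    near=> y; rewrite /hp ifF //; apply/negbTE; rewrite -leNgt ltW //.
    by near: y; exact: lt_nbhsl.
  rewrite /hp ifF; first exact: is_derive_cst.
  by apply/negbTE; rewrite -leNgt ltW.
- have [C C0 hC] := hp_bound_sq p.
  apply/is_derive1_caratheodory.
  exists (fun z => hp p z / z); split.
  + move=> z; rewrite /hp ltxx !subr0.
    have [->|z0] := eqVneq z 0; first by rewrite ltxx mulr0.
    by rewrite divfK.
  + suff : hp p z / z @[z --> (0 : R)] --> (0 : R).
      by rewrite /prop_for /continuous_at invr0 mulr0.
    apply/cvgr0Pnorm_le => e e0.
    near=> z.
    have [->|z0] := eqVneq z 0; first by rewrite invr0 mulr0 normr0 ltW.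
    rewrite normrM normfV ler_pdivrMr ?normr_gt0 //.
    apply: le_trans (hC z) _; rewrite -real_normK ?num_real // expr2 mulrA.
    rewrite ler_wpM2r //.
    have : `|z| <= e / (C + 1).
      near: z; exists (e / (C + 1)) => /=; first by rewrite divr_gt0 // ltr_wpDl.
      by move=> y /=; rewrite sub0r normrN => /ltW.
    rewrite ler_pdivlMr ?ltr_wpDl // => h; apply: le_trans h.
    by rewrite mulrC ler_wpM2l // lerDl.
  + by rewrite /hp ltxx mul0r.
Unshelve. all: by end_near. Qed.

(* The condition s * s' < 0 makes supports compact, and the class is stable under
   differentiation because (p(1/x) exp(-1/x))' has the same form. *)
Inductive bumpy : (R -> R) -> Prop :=
| bumpy_atom p q s t s' t' : s * s' < 0 -> bumpy (fun x => hp p (s * x + t) * hp q (s' * x + t'))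
| bumpy_lin c f g : bumpy f -> bumpy g -> bumpy (fun x => c * f x + g x)
| bumpy_zero : bumpy (fun=> 0).

Lemma is_derive_hp_affine p (s t x : R) :
  is_derive x 1 (fun x => hp p (s * x + t)) (hp ((p - p^`()) * 'X^2) (s * x + t) * s).
Proof.
have d : is_derive x 1 (fun x => s * x + t) s.
  have d0 : is_derive x 1 (fun x : R => s * x) s.
    by have := is_deriveZ s (is_derive_id x 1); rewrite [_ *: _]mulr1.
  by have := is_deriveD d0 (is_derive_cst t x 1); rewrite addr0.
have := is_derive_hp p (s * x + t) => dh.
exact: (@is_derive1_comp _ (hp p) (fun x : R => s * x + t) _ _ _ dh d).
Qed.

Lemma bumpy_derive f : bumpy f -> exists2 f', bumpy f' & forall x : R, is_derive x 1 f (f' x).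
Proof.
elim => {f} [p q s t s' t' ss|c f g _ [f' bf df] _ [g' bg dg]|].
- exists (fun x => s * (hp ((p - p^`()) * 'X^2) (s * x + t) * hp q (s' * x + t')) +
    (s' * (hp p (s * x + t) * hp ((q - q^`()) * 'X^2) (s' * x + t')) + 0)).
    do 2 (apply: bumpy_lin; first exact: bumpy_atom); exact: bumpy_zero.
  move=> x; apply: is_derive_eq (is_deriveM (is_derive_hp_affine p s t x) (is_derive_hp_affine q s' t' x)) _.
  rewrite /GRing.scale /=; ring.
- exists (fun x => c * f' x + g' x); first exact: bumpy_lin.
  move=> x; exact: (is_deriveD (is_deriveZ c (df x)) (dg x)).
- exists (fun=> 0); first exact: bumpy_zero.
  by move=> x; exact: is_derive_cst.
Qed.

Lemma bumpy_derive1n f k : bumpy f -> bumpy (derive1n k f).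
Proof.
move=> bf; elim: k => [|k IH]; first by rewrite derive1n0.
rewrite derive1nS; have [f' bf' df] := bumpy_derive IH.
rewrite (_ : derive1 _ = f') //; apply/funext => x.
by rewrite derive1E; have [_ ->] := df x.
Qed.

Lemma bumpy_support f : bumpy f -> exists2 M : R, 0 <= M & forall x, M <= `|x| -> f x = 0.
Proof.
elim => {f} [p q s t s' t' ss|c f g _ [M M0 hM] _ [M' M0' hM']|]; last by exists 0.
(* Where both factors are nonzero, x lies strictly between -t/s and -t'/s', since s and s' have
   opposite signs. *)
- exists (`|t / s| + `|t' / s'|); first exact: addr_ge0.
  move=> x; rewrite leNgt => xM; rewrite /hp.
  case: ifPn => [h1|]; last by rewrite mul0r.
  case: ifPn => [h2|]; last by rewrite mulr0.
  exfalso; move/negP: xM; apply.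
  have s0 : s != 0 by apply: contraTneq ss => ->; rewrite mul0r ltxx.
  have s0' : s' != 0 by apply: contraTneq ss => ->; rewrite mulr0 ltxx.
  have := ler_norm (t / s); have := ler_norm (- (t / s)).
  have := ler_norm (t' / s'); have := ler_norm (- (t' / s')); rewrite !normrN.
  have e1 : s * (x + t / s) = s * x + t by rewrite mulrDr mulrCA mulfV ?mulr1.
  have e2 : s' * (x + t' / s') = s' * x + t' by rewrite mulrDr mulrCA mulfV ?mulr1.
  rewrite -e1 in h1; rewrite -e2 in h2.
  set y := t / s in h1 *; set y' := t' / s' in h2 *.
  have n1 := normr_ge0 y; have n2 := normr_ge0 y'.
  case: (ltP 0 s) => [sp|sn] *.
    have sn' : s' < 0 by move: ss; rewrite pmulr_rlt0.
    move: h1 h2; rewrite pmulr_rgt0 // nmulr_rgt0 // => h1 h2.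
    rewrite ltr_norml; apply/andP; split; lra.
  have {}sn : s < 0 by rewrite lt_neqAle s0.
  have sp' : 0 < s' by move: ss; rewrite nmulr_rlt0.
  move: h1 h2; rewrite nmulr_rgt0 // pmulr_rgt0 // => h1 h2.
  rewrite ltr_norml; apply/andP; split; lra.
- exists (Num.max M M'); first by rewrite le_max M0.
  by move=> x; rewrite ge_max => /andP[h h']; rewrite hM // hM' // mulr0 addr0.
Qed.

Lemma bumpy_bound f : bumpy f -> exists2 C : R, 0 <= C & forall x, `|f x| <= C.
Proof.
elim => {f} [p q s t s' t' ss|c f g _ [M M0 hM] _ [M' M0' hM']|].
- have [C C0 hC] := hp_bound p; have [C' C0' hC'] := hp_bound q.
  exists (C * C'); first exact: mulr_ge0.
  by move=> x; rewrite normrM ler_pM.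
- exists (`|c| * M + M'); first by rewrite addr_ge0 // mulr_ge0.
  by move=> x; rewrite (le_trans (ler_normD _ _)) // lerD // normrM ler_wpM2l.
- by exists 0 => // x; rewrite normr0.
Qed.

Lemma bumpy_schwartz f : bumpy f -> schwartz_real f.
Proof.
move=> bf; split=> [k x|k m].
  by have [f' _ /(_ x) []] := bumpy_derive (bumpy_derive1n k bf).
have bk := bumpy_derive1n k bf.
have [C C0 hC] := bumpy_bound bk; have [M M0 hM] := bumpy_support bk.
exists (M ^+ m * C) => x; rewrite normrM.
have [xM|/ltW xM] := leP M `|x|; first by rewrite hM // normr0 mulr0 mulr_ge0 // exprn_ge0.
by rewrite ler_pM // normrX lerXn2r ?nnegrE.
Qed.

Definition cbumpy (u : R -> R[i]) :=
  bumpy (fun x => complex.Re (u x)) /\ bumpy (fun x => complex.Im (u x)).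

Lemma cbumpy_schwartz u : cbumpy u -> schwartz u.
Proof. by move=> [b1 b2]; split; exact: bumpy_schwartz. Qed.

Lemma cbumpy_lin (c : R[i]) u u' : cbumpy u -> cbumpy u' -> cbumpy (fun x => c * u x + u' x).
Proof.
case: c => a b [u1 u2] [v1 v2]; split.
- have := bumpy_lin a u1 (bumpy_lin (- b) u2 v1); congr bumpy.
  by apply/funext => x; case: (u x) (u' x) => ? ? [? ?] /=; ring.
- have := bumpy_lin a u2 (bumpy_lin b u1 v2); congr bumpy.
  by apply/funext => x; case: (u x) (u' x) => ? ? [? ?] /=; ring.
Qed.

Lemma cbumpy_support u : cbumpy u -> exists2 M : R, 0 <= M & forall x, M <= `|x| -> u x = 0.
Proof.
move=> [/bumpy_support[M M0 hM] /bumpy_support[M' M0' hM']].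
exists (Num.max M M'); first by rewrite le_max M0.
move=> x; rewrite ge_max => /andP[/hM h /hM' h'].
by apply/eqP; rewrite eq_complex /= h h' !eqxx.
Qed.

(** The factor k + 1 steepens both edges: exp(-1/((k+1) y)) tends to 1 for each y > 0, while the
    support stays in [al, be]. *)
Definition bumpf (al be : R) (k : nat) (x : R) : R :=
  hp 1 (k.+1%:R * (x - al)) * hp 1 (k.+1%:R * (be - x)).

Lemma hp1_01 x : 0 <= hp 1 x <= 1.
Proof.
rewrite /hp; case: ifP => x0; last by rewrite lexx ler01.
rewrite hornerC mul1r expR_ge0 -[X in _ <= X]expR0 ler_expR oppr_le0 invr_ge0 ltW //.
Qed.

Lemma bump_01 al be k x : 0 <= bumpf al be k x <= 1.
Proof.
rewrite /bumpf; have /andP[a0 a1] := hp1_01 (k.+1%:R * (x - al)).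
have /andP[b0 b1] := hp1_01 (k.+1%:R * (be - x)).
by apply/andP; split; [exact: mulr_ge0|exact: mulr_ile1].
Qed.

Lemma bump_out al be k x : ~~ (al < x < be) -> bumpf al be k x = 0.
Proof.
rewrite negb_and -!leNgt /bumpf /hp !pmulr_rgt0 // !subr_gt0 => /orP[h|h].
  by rewrite ltNge h mul0r.
by rewrite [X in _ * X]ifF ?mulr0 // ltNge h.
Qed.

Lemma hp1_cvg (y : R) : 0 < y -> hp 1 (k.+1%:R * y) @[k --> \oo] --> (1 : R).
Proof.
move=> y0.
have E k : hp 1 (k.+1%:R * y) = expR (- (k.+1%:R^-1 * y^-1)).
  by rewrite /hp pmulr_rgt0 // y0 hornerC mul1r invfM.
under eq_fun do rewrite E.
have : (k.+1%:R^-1 * y^-1) @[k --> \oo] --> (0 * y^-1 : R).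
  by apply: cvgM; [exact: (@cvg_harmonic R)|exact: cvg_cst].
move=> /cvgN; rewrite mul0r oppr0 => h.
have : expR (- (k.+1%:R^-1 * y^-1)) @[k --> \oo] --> expR (0 : R).
  by apply: continuous_cvg => //; exact: continuous_expR.
by rewrite expR0.
Qed.

Lemma bump_cvg al be x : bumpf al be k x @[k --> \oo] --> (if al < x < be then 1 else 0 : R).
Proof.
case: ifPn => [/andP[h1 h2]|h]; last first.
  by under eq_fun do rewrite bump_out //; exact: cvg_cst.
have := cvgM (@hp1_cvg (x - al) _) (@hp1_cvg (be - x) _).
by rewrite mulr1 !subr_gt0; apply.
Qed.

End Bump.

(** * Mean-square approximation, from rectangles to all functions *)

Section Approx.
Variable R : realType.
Local Notation T1 := (measurableTypeR R).
Local Notation T2 := (T1 * T1)%type.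
Local Notation lam2 := (@lam2 R).
Local Notation sq := (@unit_sq R).
Implicit Types (g h : T2 -> R[i]).

Variable S : set (T2 -> R[i]).
Hypothesis S_meas : forall g, S g -> cmeasurable g.
Hypothesis S_lin : forall b g h, S g -> S h -> S (fun p => b * g p + h p).
Hypothesis S_zero : S (fun=> 0).

Definition tapprox h := forall e : R, 0 < e ->
  exists2 g, S g & (tsq (fun p => (h p - g p)%R) < e%:E)%E.

Lemma approx_lin b g h : cmeasurable g -> cmeasurable h -> tapprox g -> tapprox h ->
  tapprox (fun p => b * g p + h p).
Proof.
move=> mg mh ag ah e e0.
have B0 : 0 < 2 * (sqmod b + 1) by rewrite mulr_gt0 // ltr_wpDl ?sqmod_ge0.
have eb0 : 0 < e / (2 * (2 * (sqmod b + 1))) by rewrite divr_gt0 // mulr_gt0.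
have e40 : 0 < e / 4 by rewrite divr_gt0.
have [g' Sg' g'e] := ag _ eb0; have [h' Sh' h'e] := ah _ e40.
exists (fun p => b * g' p + h' p); first exact: S_lin.
have mg' := S_meas Sg'; have mh' := S_meas Sh'.
rewrite (@eq_tsq _ _ (fun p => b * (g p - g' p) + (h p - h' p))); last first.
  by move=> p; congr sqmod; ring.
apply: le_lt_trans (tsqD (cmeasM (cmeas_cst _ b) (cmeasB mg mg')) (cmeasB mh mh')) _.
rewrite tsqM; last exact: cmeasB.
have b0 := sqmod_ge0 b.
have h1 : ((sqmod b)%:E * tsq (fun p => (g p - g' p)%R) < (e / 4)%:E)%E.
  apply: (@le_lt_trans _ _ ((sqmod b)%:E * (e / (2 * (2 * (sqmod b + 1))))%:E)%E).
    by rewrite lee_wpmul2l ?lee_fin // ltW.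
  rewrite -EFinM lte_fin [ltLHS]mulrA ltr_pdivrMr; last by rewrite mulr_gt0.
  have -> : e / 4 * (2 * (2 * (sqmod b + 1))) = e * (sqmod b + 1) by field.
  by rewrite mulrC ltr_pM2l // ltrDl.
apply: (@lt_le_trans _ _ (2%:E * ((e / 4)%:E + (e / 4)%:E))%E).
  by rewrite lte_pmul2l // lteD.
by rewrite -EFinD -EFinM lee_fin; lra.
Qed.

Lemma approxS g : S g -> tapprox g.
Proof.
move=> Sg e e0; exists g => //.
by rewrite (_ : (fun _ => _) = (fun=> 0)) ?tsq0 ?lte_fin //; apply/funext => p; rewrite subrr.
Qed.

Lemma approx_sum (I : Type) (s : seq I) (F : I -> T2 -> R[i]) :
  (forall i, cmeasurable (F i)) -> (forall i, tapprox (F i)) ->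
  tapprox (fun p => \sum_(i <- s) F i p).
Proof.
move=> mF aF; elim: s => [|i s IH].
  rewrite (_ : (fun _ => _) = (fun=> 0)); first exact: approxS.
  by apply/funext => p; rewrite big_nil.
rewrite (_ : (fun _ => _) = (fun p => 1 * F i p + \sum_(i <- s) F i p)).
  by apply: approx_lin => //; exact: cmeas_sum.
by apply/funext => p; rewrite big_cons mul1r.
Qed.

Lemma approx_eq_sq g h : (forall p, sq p -> g p = h p) -> tapprox g -> tapprox h.
Proof.
move=> gh ag e e0; have [g' Sg' g'e] := ag e e0; exists g' => //.
apply: le_lt_trans g'e; rewrite le_eqVlt; apply/orP; left; apply/eqP.
by apply: eq_integral => p; rewrite inE => /gh ->.
Qed.

Lemma approx_lim (h_ : nat -> T2 -> R[i]) h : (forall k, cmeasurable (h_ k)) ->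
  cmeasurable h -> (forall k, tapprox (h_ k)) ->
  (fun k => tsq (fun p => h_ k p - h p)) @ \oo --> 0%E -> tapprox h.
Proof.
move=> mh_ mh ah_ hc e e0.
have e4 : 0 < e / 4 by rewrite divr_gt0.
have [k _ /(_ k (leqnn k)) Hk] := cvg0_lt hc e4.
have [g Sg ge] := ah_ k _ e4; exists g => //.
have mg := S_meas Sg.
rewrite (@eq_tsq _ _ (fun p => (h_ k p - g p) - (h_ k p - h p))); last first.
  by move=> p; congr sqmod; ring.
apply: le_lt_trans (tsqB (cmeasB (mh_ k) mg) (cmeasB (mh_ k) mh)) _.
apply: (@lt_le_trans _ _ (2%:E * ((e / 4)%:E + (e / 4)%:E))%E).
  by rewrite lte_pmul2l // lteD.
by rewrite -EFinD -EFinM lee_fin; lra.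
Qed.

Lemma tsq_dominated (h_ : nat -> T2 -> R[i]) h (G : T2 -> R) :
  (forall k, cmeasurable (h_ k)) -> cmeasurable h ->
  lam2.-integrable sq (EFin \o G) ->
  (forall k p, sq p -> sqmod (h_ k p - h p) <= G p) ->
  {ae lam2, forall p, sq p -> sqmod (h_ k p - h p) @[k --> \oo] --> (0 : R)} ->
  (fun k => tsq (fun p => h_ k p - h p)) @ \oo --> 0%E.
Proof.
move=> mh_ mh iG hG hc.
have := @dominated_convergence _ _ _ lam2 _ (@measurable_unit_sq R)
  (fun k p => (sqmod (h_ k p - h p))%:E) (fun=> 0%E) (EFin \o G).
case=> //.
- by move=> k; exact: measurable_funS (cmeas_esqmod (cmeasB (mh_ k) mh)).
- by apply: filterS hc => p /= hp sp; apply/fine_cvgP; split; [exact: nearW|exact: hp].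
- by apply: aeW => p k sp; rewrite gee0_abs ?lee_fin ?sqmod_ge0 //; exact: hG.
- by move=> _ _; rewrite integral0.
Qed.

Lemma integrable_cst_sq (M : R) : lam2.-integrable sq (EFin \o (fun=> M)).
Proof.
apply/integrableP; split; first exact: measurable_cst.
apply: (@le_lt_trans _ _ (`|M|%:E * lam2 sq)%E).
  by rewrite (@integral_cst _ _ _ lam2 _ (@measurable_unit_sq R) `|M|%:E).
by rewrite lam2_unit_sq mule1 ltry.
Qed.

Definition ind (X : Type) (A : set X) (x : X) : R[i] := if x \in A then 1 else 0.

Lemma cmeas_ind d (X : measurableType d) (A : set X) : measurable A -> cmeasurable (ind A).
Proof.
move=> mA; apply: cmeas_if; [|exact: cmeas_cst|exact: cmeas_cst].
by apply: measurable_fun_bool true _; rewrite setTI (_ : _ @^-1` _ = A) //;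
  apply/seteqP; split => x /=; [move=> /set_mem|move=> /mem_set].
Qed.

Lemma ind_setC (X : Type) (A : set X) x : ind (~` A) x = 1 - ind A x.
Proof.
rewrite /ind in_setC; case: (x \in A) => /=; first by rewrite subrr.
by rewrite subr0.
Qed.

Lemma sum_ind_disjoint (X : Type) (F : nat -> set X) k x : trivIset setT F ->
  \sum_(i < k) ind (F i) x = if `[< exists2 i, (i < k)%N & F i x >] then 1 else 0.
Proof.
move=> tF; case: ifPn => [/asboolP[i ik Fi]|/asboolPn h].
  rewrite (bigD1 (Ordinal ik)) //= {1}/ind mem_set // big1 ?addr0 // => j ji.
  rewrite /ind memNset // => Fj; move/eqP: ji; apply; apply/val_inj => /=.
  by apply: tF => //; exists x.
apply: big1 => i _; rewrite /ind memNset // => Fi; apply: h; by exists i.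
Qed.

(** A pi-lambda argument in one variable; the weight w carries the other variable, so that the same
    lemma can be used for each in turn. Disjoint unions pass to the limit by dominated convergence,
    with the constant 1 as majorant. *)
Lemma approx_dynkin d (X : measurableType d) (G : set (set X)) (pr : T2 -> X) w :
  @measurable _ X = <<s G >> -> setI_closed G ->
  measurable_fun setT pr -> cmeasurable w -> (forall p, sqmod (w p) <= 1) ->
  tapprox w -> (forall A, G A -> tapprox (fun p => ind A (pr p) * w p)) ->
  forall A, measurable A -> tapprox (fun p => ind A (pr p) * w p).
Proof.
move=> GE GI mpr mw w1 aw aG A; rewrite GE => sA.
have mi B : measurable B -> cmeasurable (fun p => ind B (pr p) * w p).
  by move=> mB; apply: cmeasM => //; exact: cmeas_comp (cmeas_ind mB) mpr.
apply: (@dynkin_induction _ X G (fun A => tapprox (fun p => ind A (pr p) * w p)) GE GI _ aG _ _ A sA).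
- move: aw; congr tapprox; apply/funext => p.
  by rewrite /ind in_setT mul1r.
- move=> B mB aB.
  have := approx_lin (-1) (mi _ mB) mw aB aw; congr tapprox; apply/funext => p.
  by rewrite ind_setC; ring.
- move=> F mF tF aF.
  have E k p : \sum_(i < k) ind (F i) (pr p) * w p =
      (if `[< exists2 i, (i < k)%N & F i (pr p) >] then 1 else 0) * w p.
    by rewrite -mulr_suml sum_ind_disjoint.
  have mU := bigcupT_measurable _ mF.
  apply: (@approx_lim (fun k p => \sum_(i < k) ind (F i) (pr p) * w p)).
  + by move=> k; apply: cmeas_sum => i; exact: mi.
  + exact: mi.
  + by move=> k; apply: approx_sum => i; [exact: mi|exact: aF].
  apply: (tsq_dominated _ _ (integrable_cst_sq 1)).
  + by move=> k; apply: cmeas_sum => i; exact: mi.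
  + exact: mi.
  + move=> k p _; rewrite E -mulrBl sqmodM mulr_ile1 ?sqmod_ge0 //.
    rewrite /ind; case: asboolP => h; case: ifPn => h';
      rewrite ?subrr ?sqmod0 ?subr0 ?sub0r ?sqmodN ?sqmod1 //.
  apply: aeW => p _.
  have [[i _ Fi]|h] := pselect ((\bigcup_i F i) (pr p)).
    apply: cvg_near_cst; exists i.+1 => // k /= ik.
    rewrite E asboolT; last by exists i.
    by rewrite /ind mem_set; [rewrite subrr sqmod0|exists i].
  apply: cvg_near_cst; apply: nearW => k.
  rewrite E asboolF; first by rewrite /ind memNset // subrr sqmod0.
  by move=> [i _ Fi]; apply: h; exists i.
Qed.

Hypothesis approx_rect : forall A B : set T1, ocitv A -> ocitv B ->
  tapprox (fun p => ind A p.1 * ind B p.2).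

Lemma ind_le1 (X : Type) (A : set X) x : sqmod (ind A x) <= 1.
Proof. by rewrite /ind; case: ifP => _; rewrite ?sqmod1 ?sqmod0. Qed.

Lemma approx_set E : measurable E -> tapprox (ind E).
Proof.
have mO : @measurable _ T1 = <<s @ocitv R >> by [].
have OI : setI_closed (@ocitv R) by exact: ocitvI.
(* The whole line is not a half-open interval; ](-1), 1] replaces it, being indistinguishable from
   it on the unit square. *)
have O11 : @ocitv R `](-1), 1]%classic by exists (-1, 1).
have in11 (x : T1) : `[0, 1]%classic x -> ind `](-1), 1]%classic x = 1.
  rewrite /= in_itv /= => /andP[x0 x1]; rewrite /ind mem_set //= in_itv /= x1.
  by rewrite (lt_le_trans _ x0).
have m1 : measurable_fun setT (fun p : T2 => p.1) by exact: measurable_fst.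
have m2 : measurable_fun setT (fun p : T2 => p.2) by exact: measurable_snd.
have mB B : ocitv B -> measurable (B : set T1) by exact: sub_sigma_algebra.
have step1 A B : measurable A -> ocitv B -> tapprox (fun p => ind A p.1 * ind B p.2).
  move=> mA oB.
  apply: (approx_dynkin mO OI m1 (w := fun p => ind B p.2)) => //.
  - exact: cmeas_comp (cmeas_ind (mB _ oB)) m2.
  - by move=> p; exact: ind_le1.
  - apply: approx_eq_sq (approx_rect O11 oB) => p [p1 _].
    by rewrite in11 // mul1r.
  - by move=> A' oA'; exact: approx_rect.
have step2 A B : measurable A -> measurable B -> tapprox (fun p => ind A p.1 * ind B p.2).
  move=> mA mB'.
  have := @approx_dynkin _ _ _ (fun p => p.2) (fun p => ind A p.1) mO OI m2.
  move=> /(_ _ _ _ _ B mB') H.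
  suff : tapprox (fun p => ind B p.2 * ind A p.1).
    by congr tapprox; apply/funext => p; rewrite mulrC.
  apply: H.
  - exact: cmeas_comp (cmeas_ind mA) m1.
  - by move=> p; exact: ind_le1.
  - apply: approx_eq_sq (step1 _ _ mA O11) => p [_ p2].
    by rewrite in11 // mulr1.
  - move=> B' oB'; have := step1 _ _ mA oB'; congr tapprox.
    by apply/funext => p; rewrite mulrC.
move=> mE.
(* A last application, now with measurable rectangles as generators of the product sigma-algebra and
   weight 1. *)
have := @approx_dynkin _ _ [set A `*` B | A in measurable & B in measurable] id (fun=> 1)
  (@measurable_prod_measurableType _ _ T1 T1).
move=> /(_ _ _ _ _ _ _ E mE) H.
suff : tapprox (fun p => ind E p * 1) by congr tapprox; apply/funext => p; rewrite mulr1.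
apply: H.
- move=> _ _ [A mA [B mB' <-]] [A' mA' [B' mB'' <-]].
  exists (A `&` A'); first exact: measurableI.
  by exists (B `&` B'); [exact: measurableI|rewrite setXI].
- exact: measurable_id.
- exact: cmeas_cst.
- by move=> p; rewrite sqmod1.
- have := step2 setT setT measurableT measurableT; congr tapprox.
  by apply/funext => p; rewrite /ind !in_setT mulr1.
- move=> _ [A mA [B mB' <-]]; have := step2 A B mA mB'; congr tapprox.
  apply/funext => p; rewrite mulr1 /ind in_setX.
  by case: (p.1 \in A); case: (p.2 \in B); rewrite /= ?mulr1 ?mulr0.
Qed.

Import HBNNSimple.

(** Simple functions increase to f from below, so the squared error is dominated by f^2. *)
Lemma approx_ge0 (f : T2 -> R) : measurable_fun setT f -> (forall p, 0 <= f p) ->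
  lam2.-integrable sq (EFin \o (fun p => f p ^+ 2)) -> tapprox (fun p => (f p)%:C).
Proof.
move=> mf f0 if2.
have mef : measurable_fun setT (fun p => (f p)%:E) by exact/measurable_EFinP.
pose f_ := nnsfun_approx measurableT mef.
have f_cvg p : EFin \o f_ ^~ p @ \oo --> (f p)%:E.
  by apply: cvg_nnsfun_approx => // q _; rewrite lee_fin.
have f_le k p : f_ k p <= f p.
  have fc : f_ ^~ p @ \oo --> f p by have /fine_cvg := f_cvg p.
  rewrite -(cvg_lim _ fc) //; apply: nondecreasing_cvgn_le; last by apply/cvg_ex; exists (f p).
  by move=> i j ij; exact/lefP/nd_nnsfun_approx.
have cmC (h : T2 -> R) : measurable_fun setT h -> cmeasurable (fun p => (h p)%:C).
  by move=> mh; split => //=; exact: measurable_cst.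
apply: (@approx_lim (fun k p => (f_ k p)%:C)).
- by move=> k; apply: cmC.
- exact: cmC.
- move=> k.
  have -> : (fun p => (f_ k p)%:C) =
      (fun p => \sum_(y <- finmap.enum_fset (fset_set (range (f_ k)))) y%:C * ind (f_ k @^-1` [set y]) p).
    apply/funext => p.
    have := fimfunE (f_ k) p; rewrite fsbig_finite //= => ->.
    rewrite raddf_sum /=; apply: eq_bigr => y _.
    rewrite rmorphM /= indicE /ind; by case: (p \in _).
  apply: approx_sum => y.
    by apply: cmeasM; [exact: cmeas_cst|exact: cmeas_ind].
  have az : tapprox (fun=> 0) by exact: approxS.
  have mI : measurable (f_ k @^-1` [set y]) by [].
  have := approx_lin (y%:C) (cmeas_ind mI) (cmeas_cst _ 0) (approx_set mI) az.
  by congr tapprox; apply/funext => p; rewrite addr0.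
- apply: (tsq_dominated _ _ if2).
  + by move=> k; apply: cmC.
  + exact: cmC.
  + move=> k p _; rewrite -rmorphB /sqmod /= expr0n addr0 -sqrrN opprB.
    rewrite ler_pXn2r ?nnegrE ?subr_ge0 ?f_le ?f0 //.
    by rewrite gerBl.
  + apply: aeW => p _.
    have h : (f_ k p - f p) @[k --> \oo] --> (0 : R).
      rewrite -(subrr (f p)); apply: cvgB; last exact: cvg_cst.
      by have /fine_cvg := f_cvg p.
    have hh : (f_ k p - f p) * (f_ k p - f p) @[k --> \oo] --> (0 : R).
      by rewrite -[X in _ --> X](mulr0 0); exact: cvgM.
    apply: (@eq_cvgn R _ _ 0 _ hh) => k.
    by rewrite -rmorphB /sqmod /= expr0n addr0 expr2.
Qed.

Lemma approx_all h : cmeasurable h -> (tsq h < +oo)%E -> tapprox h.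
Proof.
move=> [m1 m2] hfin.
have key (f : T2 -> R) : measurable_fun setT f -> (forall p, f p ^+ 2 <= sqmod (h p)) ->
    tapprox (fun p => (f p)%:C).
  move=> mf fh.
  have isq : lam2.-integrable sq (EFin \o (fun p => sqmod (h p))).
    apply/integrableP; split.
      by apply/measurable_EFinP; apply: measurable_funS (cmeas_sqmod (conj m1 m2)).
    by under eq_integral do rewrite /= ger0_norm ?sqmod_ge0 //.
  have ipos (f' : T2 -> R) : measurable_fun setT f' -> (forall p, f' p ^+ 2 <= sqmod (h p)) ->
      lam2.-integrable sq (EFin \o (fun p => f' p ^+ 2)).
    move=> mf' f'h; apply: (@le_integrable _ _ _ lam2 _ (@measurable_unit_sq R) _ (EFin \o (fun p => sqmod (h p)))) => //.
      apply/measurable_EFinP; apply: measurable_funS (measurable_funX 2 mf') => //.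
    move=> p _ /=; rewrite lee_fin !ger0_norm ?sqr_ge0 ?sqmod_ge0 //.
  have le2 (x y : R) : 0 <= x <= `|y| -> x ^+ 2 <= y ^+ 2.
    move=> /andP[x0 xy]; rewrite -[leRHS]real_normK ?num_real //.
    by rewrite lerXn2r ?nnegrE.
  pose fp p := Num.max (f p) 0; pose fn p := Num.max (- f p) 0.
  have mp : measurable_fun setT fp by apply: measurable_maxr => //; exact: measurable_cst.
  have mn : measurable_fun setT fn.
    by apply: measurable_maxr; [exact: measurable_funN|exact: measurable_cst].
  have fp0 p : 0 <= fp p by rewrite le_max lexx orbT.
  have fn0 p : 0 <= fn p by rewrite le_max lexx orbT.
  have ap : tapprox (fun p => (fp p)%:C).
    apply: approx_ge0 => //; apply: ipos => // p; apply: le_trans (fh p).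
    by apply: le2; rewrite fp0 /= ge_max ler_norm normr_ge0.
  have an : tapprox (fun p => (fn p)%:C).
    apply: approx_ge0 => //; apply: ipos => // p; apply: le_trans (fh p).
    by apply: le2; rewrite fn0 /= ge_max normr_ge0 andbT -normrN ler_norm.
  have cmC (k : T2 -> R) : measurable_fun setT k -> cmeasurable (fun p => (k p)%:C).
    by move=> mh; split => //=; exact: measurable_cst.
  have := approx_lin (-1) (cmC _ mn) (cmC _ mp) an ap; congr tapprox; apply/funext => p.
  rewrite mulN1r addrC -rmorphB; congr (_%:C); rewrite /fp /fn.
  case: (leP 0 (f p)) => f0.
    by rewrite max_r ?oppr_le0 // subr0.
  by rewrite sub0r max_l ?opprK // oppr_ge0 ltW.
have a1 := key _ m1 (fun p => sqmod_Re (h p)).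
have a2 := key _ m2 (fun p => sqmod_Im (h p)).
have cmC (k : T2 -> R) : measurable_fun setT k -> cmeasurable (fun p => (k p)%:C).
  by move=> mh; split => //=; exact: measurable_cst.
have := approx_lin 'i%C (cmC _ m2) (cmC _ m1) a2 a1; congr tapprox; apply/funext => p.
by case: (h p) => a b; simpc.
Qed.

End Approx.

(** * Trigonometric approximation of intervals *)

Section StepPolynomial.
Variable R : realType.

Lemma bernoulli_le (t : R) k : 0 <= t <= 1 -> 1 - k%:R * t <= (1 - t) ^+ k.
Proof.
move=> /andP[t0 t1]; elim: k => [|k IH]; first by rewrite mul0r subr0 expr0.
have s0 : 0 <= 1 - t by rewrite subr_ge0.
rewrite exprS; apply: le_trans (ler_wpM2l s0 IH).
have k0 : 0 <= k%:R :> R by [].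
have : 0 <= k%:R * t * t by rewrite !mulr_ge0.
rewrite -natr1; nra.
Qed.

Lemma bernoulli_ge (t : R) k : 0 <= t -> 1 + k%:R * t <= (1 + t) ^+ k.
Proof.
move=> t0; elim: k => [|k IH]; first by rewrite mul0r addr0 expr0.
have s0 : 0 <= 1 + t by rewrite addr_ge0.
rewrite exprS; apply: le_trans (ler_wpM2l s0 IH).
have : 0 <= k%:R * t * t by rewrite !mulr_ge0.
rewrite -natr1; nra.
Qed.

(* Brosowski--Deutsch: these polynomials tend to 1 on [0, 1/2) and to 0 on (1/2, 1]. *)
Definition stepp k (s : R) : R := (1 - s ^+ k) ^+ (2 ^ k).

Lemma stepp_01 k s : 0 <= s <= 1 -> 0 <= stepp k s <= 1.
Proof.
move=> /andP[s0 s1]; have sk : 0 <= 1 - s ^+ k <= 1.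
  by rewrite subr_ge0 exprn_ile1 //= gerBl exprn_ge0.
by case/andP: sk => h0 h1; rewrite exprn_ge0 //= exprn_ile1.
Qed.

(** Bernoulli's inequality gives [stepp k s] >= 1 - (2s)^k, and 2s < 1. *)
Lemma stepp_cvg1 s : 0 <= s < 2^-1 -> stepp k s @[k --> \oo] --> (1 : R).
Proof.
move=> /andP[s0 s2].
have h : (1 - (2 * s) ^+ k) @[k --> \oo] --> (1 - 0 : R).
  apply: cvgB; first exact: cvg_cst.
  apply: cvg_expr; rewrite ger0_norm ?mulr_ge0 //; lra.
rewrite subr0 in h.
apply: (@squeeze_cvgr _ _ _ _ (fun k => 1 - (2 * s) ^+ k) (fun=> 1)); [|exact: h|exact: cvg_cst].
apply: nearW => k; have s1 : s <= 1 by lra.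
have /andP[_ ->] : 0 <= stepp k s <= 1 by apply: stepp_01; rewrite s0.
rewrite andbT /stepp.
have sk : 0 <= s ^+ k <= 1 by rewrite exprn_ge0 //= exprn_ile1.
apply: le_trans (bernoulli_le (2 ^ k) sk).
by rewrite exprMn natrX.
Qed.

(** As (1 - s^k)(1 + s^k) <= 1 and (1 + s^k)^(2^k) >= (2s)^k by Bernoulli, [stepp k s] is at most
    (2s)^(-k), and 2s > 1. *)
Lemma stepp_cvg0 s : 2^-1 < s <= 1 -> stepp k s @[k --> \oo] --> (0 : R).
Proof.
move=> /andP[s2 s1].
have s0 : 0 < s by rewrite (lt_trans _ s2).
have h : ((2 * s)^-1 ^+ k) @[k --> \oo] --> (0 : R).
  apply: cvg_expr; rewrite ger0_norm ?invr_ge0 ?mulr_ge0 ?ltW //.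
  rewrite invf_lt1 ?mulr_gt0 //; lra.
apply: (@squeeze_cvgr _ _ _ _ (fun=> 0) (fun k => (2 * s)^-1 ^+ k)); [|exact: cvg_cst|exact: h].
apply: nearW => k.
have /andP[-> _] : 0 <= stepp k s <= 1 by apply: stepp_01; rewrite (ltW s0).
rewrite /= /stepp exprVn.
have sk0 : 0 <= s ^+ k by rewrite exprn_ge0 // ltW.
have sk1 : s ^+ k <= 1 by rewrite exprn_ile1 // ltW.
have p0 : 0 < (2 * s) ^+ k by rewrite exprn_gt0 // mulr_gt0.
rewrite -[leRHS]div1r ler_pdivlMr //.
apply: (@le_trans _ _ ((1 - s ^+ k) ^+ (2 ^ k) * (1 + s ^+ k) ^+ (2 ^ k))).
  rewrite ler_wpM2l ?exprn_ge0 ?subr_ge0 //.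
  apply: le_trans (bernoulli_ge (2 ^ k) sk0).
  by rewrite exprMn natrX lerDr.
rewrite -exprMn -subr_sqr expr1n exprn_ile1 ?subr_ge0 ?gerBl ?sqr_ge0 //.
by rewrite exprn_ile1.
Qed.

End StepPolynomial.

Section TrigStep.
Variable R : realType.

Inductive trigpoly : (R -> R[i]) -> Prop :=
| trigpoly_e (n : int) : trigpoly (fun x => expi2pi (n%:~R * x))
| trigpoly_lin b f g : trigpoly f -> trigpoly g -> trigpoly (fun x => b * f x + g x)
| trigpoly_zero : trigpoly (fun=> 0).

Lemma trigpolyZ b f : trigpoly f -> trigpoly (fun x => b * f x).
Proof.
move=> tf; have := trigpoly_lin b tf trigpoly_zero; congr trigpoly.
by apply/funext => x; rewrite addr0.
Qed.

Lemma trigpoly_cst b : trigpoly (fun=> b).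
Proof.
have := trigpolyZ b (trigpoly_e 0); congr trigpoly; apply/funext => x.
by rewrite mul0r expi2pi0 mulr1.
Qed.

Lemma trigpolyM f g : trigpoly f -> trigpoly g -> trigpoly (fun x => f x * g x).
Proof.
move=> tf tg; elim: tf => {f} [n|b f f' _ IH _ IH'|].
- elim: tg => {g} [m|b g g' _ IH _ IH'|].
  + have := trigpoly_e (n + m); congr trigpoly; apply/funext => x.
    by rewrite intrD mulrDl expi2piD.
  + have := trigpoly_lin b IH IH'; congr trigpoly; apply/funext => x; ring.
  + have := trigpoly_zero; congr trigpoly; apply/funext => x; by rewrite mulr0.
- have := trigpoly_lin b IH IH'; congr trigpoly; apply/funext => x; ring.
- have := trigpoly_zero; congr trigpoly; apply/funext => x; by rewrite mul0r.
Qed.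

Lemma trigpolyB b f : trigpoly f -> trigpoly (fun x => b - f x).
Proof.
move=> tf; have := trigpoly_lin (-1) tf (trigpoly_cst b); congr trigpoly.
by apply/funext => x; rewrite mulN1r addrC.
Qed.

Lemma trigpolyX k f : trigpoly f -> trigpoly (fun x => f x ^+ k).
Proof.
move=> tf; elim: k => [|k IH].
  by have := trigpoly_cst 1; congr trigpoly; apply/funext => x; rewrite expr0.
by have := trigpolyM tf IH; congr trigpoly; apply/funext => x; rewrite exprS.
Qed.

(* For 0 <= al < be <= 1 and x in (0, 1), arc al be x < 1/2 if and only if al < x < be. *)
Definition arc (al be x : R) : R := (1 - sin (pi * (x - al)) * sin (pi * (be - x))) / 2.

(** By sin A sin B = (cos (A - B) - cos (A + B))/2 with A + B = pi (be - al) constant, only the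
    frequencies -1, 0, 1 occur. The phase c centres the cosine at the midpoint (al + be)/2, and 1/8
    is 1/2 three times. *)
Lemma trigpoly_arc al be : trigpoly (fun x => (arc al be x)%:C).
Proof.
pose c : R[i] := expi2pi (- ((al + be) / 2)).
have t := trigpoly_lin (- 8^-1 * c) (trigpoly_e 1) (trigpoly_lin (- 8^-1 * c^*) (trigpoly_e (-1))
  (trigpoly_cst ((1 + 2^-1 * cos (pi * (be - al))) / 2)%:C)).
move: t; congr trigpoly; apply/funext => x.
rewrite /c -expi2piN -!mulrA -!expi2piD opprK /expi2pi.
have -> : 2 * pi * (- ((al + be) / 2) + 1%:~R * x) = pi * (x - al) - pi * (be - x).
  by rewrite mulr1z; field.
have -> : 2 * pi * ((al + be) / 2 + (-1)%:~R * x) = - (pi * (x - al) - pi * (be - x)).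
  by rewrite mulrN1z; field.
have -> : pi * (be - al) = pi * (x - al) + pi * (be - x) by ring.
rewrite cosN sinN /arc cosB cosD.
set A := cos _ * cos _; set B := sin (pi * (x - al)) * _.
have -> : (- 8^-1 : R[i]) = (- 8^-1)%:C by rewrite rmorphN fmorphV rmorph_nat.
by simpc; congr (_ +i* _); field.
Qed.

Lemma arc_01 al be x : 0 <= arc al be x <= 1.
Proof.
have := sin_max (pi * (x - al)); have := sin_max (pi * (be - x)).
rewrite /arc !ler_norml => /andP[a b] /andP[c d].
by rewrite divr_ge0 ?ler_pdivrMr //=; nra.
Qed.

Lemma sin_pi_gt0 (t : R) : 0 < t < 1 -> 0 < sin (pi * t).
Proof.
move=> /andP[t0 t1]; apply: sin_gt0_pi.
by rewrite mulr_gt0 ?pi_gt0 //= gtr_pMr ?pi_gt0.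
Qed.

Lemma sin_pi_lt0 (t : R) : -1 < t < 0 -> sin (pi * t) < 0.
Proof.
move=> /andP[t0 t1]; rewrite -oppr_gt0 -sinN -mulrN; apply: sin_pi_gt0.
by rewrite oppr_gt0 t1 ltrNl.
Qed.

Lemma stepp_arc_cvg al be x : 0 <= al -> al < be -> be <= 1 -> 0 < x < 1 ->
  x != al -> x != be ->
  stepp k (arc al be x) @[k --> \oo] --> (if al < x < be then 1 else 0 : R).
Proof.
move=> a0 ab b1 /andP[x0 x1] xa xb.
have /andP[c0 c1] := arc_01 al be x.
case: ifPn => [/andP[h1 h2]|].
  apply: stepp_cvg1; rewrite c0 /= /arc.
  have y0 : 0 < sin (pi * (x - al)) * sin (pi * (be - x)).
    by apply: mulr_gt0; apply: sin_pi_gt0; apply/andP; split; lra.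
  by rewrite ltr_pdivrMr // mulVf //; lra.
rewrite negb_and -!leNgt => h.
apply: stepp_cvg0; rewrite c1 andbT /arc.
suff y0 : sin (pi * (x - al)) * sin (pi * (be - x)) < 0.
  by rewrite ltr_pdivlMr // mulVf //; lra.
case/orP: h => h.
  have {}h : x < al by rewrite lt_neqAle xa.
  rewrite nmulr_rlt0; first by apply: sin_pi_gt0; apply/andP; split; lra.
  by apply: sin_pi_lt0; apply/andP; split; lra.
have {}h : be < x by rewrite lt_neqAle eq_sym xb.
rewrite pmulr_rlt0; first by apply: sin_pi_lt0; apply/andP; split; lra.
by apply: sin_pi_gt0; apply/andP; split; lra.
Qed.

End TrigStep.

(** * Density of the range of [W0] *)

Section Density.
Variables (R : realType) (N : int).
Hypothesis N0 : N != 0.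
Local Notation T1 := (measurableTypeR R).
Local Notation T2 := (T1 * T1)%type.
Local Notation NR := (N%:~R : R).
Local Notation lam2 := (@lam2 R).
Local Notation sq := (@unit_sq R).
Local Notation W0 := (@W0 R N).
Implicit Types (g h : T2 -> R[i]) (u : R -> R[i]).

Lemma cbumpy_nice u : cbumpy u -> nice u.
Proof. by move=> /cbumpy_schwartz /schwartz_nice. Qed.

Lemma cbumpy0 : cbumpy (fun _ : R => 0 : R[i]).
Proof. by split; exact: bumpy_zero. Qed.

(** Functions whose component under [opP 0] is known to come from a bump. They approximate every
    square-integrable function on the unit square; applying the bounded [opP 0], which fixes
    functions of period 1/N, turns this into density of the range of [W0]. *)
Definition testfun : set (T2 -> R[i]) :=
  [set g | qp N g /\ exists2 u, cbumpy u & opP N 0 g = W0 u].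

Lemma testfun_meas g : testfun g -> cmeasurable g.
Proof. by move=> [[]]. Qed.

Lemma W0_lin (c : R[i]) u u' : cbumpy u -> cbumpy u' ->
  W0 (fun x => c * u x + u' x) = fun p => c * W0 u p + W0 u' p.
Proof.
move=> bu bu'; have [du _] := cbumpy_nice bu; have [du' _] := cbumpy_nice bu'.
by apply: WB_lin => //; exact: bdd_dlt0.
Qed.

Lemma testfun_lin b g h : testfun g -> testfun h -> testfun (fun p => b * g p + h p).
Proof.
move=> [qg [u bu gu]] [qh [u' bu' hu']]; split; first exact: qp_lin.
exists (fun x => b * u x + u' x); first exact: cbumpy_lin.
by rewrite (good_lin (good_opP R N0 0)) gu hu' W0_lin.
Qed.

Lemma opP0_id g : qp0 N g -> opP N 0 g = g.
Proof.
move=> g0; have := opP_X N0 0 0 g0.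
by rewrite subrr dvdz0 opX0.
Qed.

Lemma W00 : W0 (fun=> 0) = fun=> 0.
Proof.
apply/funext => p; apply: has_csumZ_eq; have := has_csumZ0 R; congr has_csumZ.
by apply/funext => k; rewrite /wterm mulr0 mul0r.
Qed.

Lemma testfun_zero : testfun (fun=> 0).
Proof.
split; first exact: qp_zero.
exists (fun=> 0); first exact: cbumpy0.
by rewrite W00 opP0_id //; exact: qp0_zero.
Qed.

(** For f = e(m a), the bump is placed at m + N [ga, de], so that X_m W_0 u is a sum over k = m + q
    N of bumps in c + q. For c in [0, 1] and a bump supported in [0, 1], only q = 0 survives. *)
Lemma testfun_product (f : R -> R[i]) ga de k : trigpoly f -> 0 <= ga -> de <= 1 ->
  exists2 g, testfun g & forall p, sq p -> g p = f p.1 * (bumpf ga de k p.2)%:C.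
Proof.
move=> tf g0 d1; elim: tf => {f} [m|b f f' _ [g Tg Eg] _ [g' Tg' Eg']|].
- pose u x : R[i] := (bumpf ga de k ((x - m%:~R) / NR))%:C.
  have k0 : k.+1%:R != 0 :> R by rewrite pnatr_eq0.
  have bu : cbumpy u.
    split; last exact: bumpy_zero.
    have := @bumpy_atom R 1 1 (k.+1%:R / NR) (- (k.+1%:R / NR * m%:~R) - k.+1%:R * ga)
      (- (k.+1%:R / NR)) (k.+1%:R / NR * m%:~R + k.+1%:R * de) _.
    have ss : k.+1%:R / NR * - (k.+1%:R / NR) < 0.
      by rewrite mulrN oppr_lt0 -expr2 exprn_even_gt0 //= mulf_neq0 // invr_eq0 NR0.
    move=> /(_ ss); congr bumpy; apply/funext => x; rewrite /u /= /bumpf.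
    by congr (hp _ _ * hp _ _); ring.
  have [du _] := cbumpy_nice bu.
  exists (opX N m (W0 u)).
    split; first by apply: (good_qp (good_opX R N m)); case: (W0_qp0 N0 (cbumpy_nice bu)).
    have q0 := W0_qp0 N0 (cbumpy_nice bu).
    (* [opP 0] kills X_m W_0 u unless N divides m, and then X_m is the identity. *)
    exists (if (N %| m - 0)%Z then u else fun=> 0).
      by case: ifP => _; [exact: bu|exact: cbumpy0].
    rewrite opP_X //; case: ifP => H; last by rewrite W00.
    by rewrite (@opX_mod R N N0 m 0) ?opX0 //; case: q0.
  move=> p [_ p2]; move: p2; rewrite /= in_itv /= => /andP[c0 c1].
  have h1 := opX_W0 N0 m p du.
  have h2 := @has_csumZ_single R (wterm N (fun j => dlt R N (j - m)) u p) m _.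
  rewrite -(has_csumZ_eq h1) (has_csumZ_eq (h2 _)).
    rewrite /wterm /dlt subrr dvdz0 mul1r mulrC /u; congr (_ * (bumpf _ _ _ _)%:C).
    by field; exact: NR0.
  move=> j jm; rewrite /wterm /dlt; case: ifP => [/dvdzP[q jq]|_]; last by rewrite !mul0r.
  rewrite mul1r /u bump_out ?mul0r //.
  have -> : (j%:~R + NR * p.2 - m%:~R) / NR = p.2 + q%:~R.
    rewrite addrAC -intrB jq intrM; field; exact: NR0.
  have q0 : q != 0 by apply: contraNneq jm => q0; move: jq; rewrite q0 mul0r => /eqP; rewrite subr_eq0.
  apply/negP => /andP[l1 l2].
  have [q1|q1] : 1 <= q \/ q <= -1 by lia.
    have : (1%:~R : R) <= q%:~R by rewrite ler_int.
    by rewrite mulr1z => ?; lra.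
  have : (q%:~R : R) <= (-1)%:~R by rewrite ler_int.
  by rewrite mulrN1z => ?; lra.
- exists (fun p => b * g p + g' p); first exact: testfun_lin.
  by move=> p sp; rewrite Eg // Eg' //; ring.
- exists (fun=> 0); first exact: testfun_zero.
  by move=> p _; rewrite mul0r.
Qed.

Lemma lam2_line1 (x : R) : {ae lam2, forall p, p.1 != x}.
Proof.
exists ([set x] `*` setT); split.
- by apply: measurableX.
- rewrite (_ : lam2 _ = (lebesgue_measure [set x] * lebesgue_measure (@setT T1))%E).
    by rewrite lebesgue_measure_set1 mul0e.
  exact: product_measure1E.
- by move=> p /= /negP; rewrite negbK => /eqP.
Qed.

Lemma lam2_line2 (x : R) : {ae lam2, forall p, p.2 != x}.
Proof.
exists (setT `*` [set x]); split.
- by apply: measurableX.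
- rewrite (_ : lam2 _ = (lebesgue_measure (@setT T1) * lebesgue_measure [set x])%E).
    by rewrite lebesgue_measure_set1 mule0.
  exact: product_measure1E.
- by move=> p /= /negP; rewrite negbK => /eqP.
Qed.

Lemma bump_meas ga de k : cmeasurable (fun p : T2 => (bumpf ga de k p.2)%:C).
Proof.
have [_ m] : nice (fun x => (bumpf ga de k x)%:C).
  apply: cbumpy_nice; split; last exact: bumpy_zero.
  have ss : k.+1%:R * - k.+1%:R < 0 :> R by rewrite mulrN oppr_lt0 mulr_gt0.
  have := @bumpy_atom R 1 1 k.+1%:R (- k.+1%:R * ga) (- k.+1%:R) (k.+1%:R * de) ss.
  congr bumpy; apply/funext => x; rewrite /= /bumpf.
  by congr (hp _ _ * hp _ _); ring.
exact: (cmeas_comp m measurable_snd).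
Qed.

Lemma trigpoly_meas (f : R -> R[i]) : trigpoly f -> cmeasurable (fun p : T2 => f p.1).
Proof.
elim => {f} [m|b f f' _ IH _ IH'|]; first exact: cmeas_expi_fst.
  by apply: cmeasD => //; apply: cmeasM => //; exact: cmeas_cst.
exact: cmeas_cst.
Qed.

Lemma trigpoly_stepp k (al be : R) : trigpoly (fun x => (stepp k (arc al be x))%:C).
Proof.
have := trigpolyX (2 ^ k) (trigpolyB 1 (trigpolyX k (trigpoly_arc al be))).
by congr trigpoly; apply/funext => x; rewrite /stepp rmorphXn rmorphB rmorph1 rmorphXn.
Qed.

Lemma approx_ocitv (A B : set T1) : ocitv A -> ocitv B ->
  tapprox testfun (fun p => ind R A p.1 * ind R B p.2).
Proof.
move=> [[a b] _ <-] [[c d] _ <-] /=.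
(* Clipping to the unit square changes the target only on boundary lines and meets the constraints
   of [stepp_arc_cvg] and [testfun_product]. *)
pose al := Num.max a 0; pose be := Num.min b 1.
pose ga := Num.max c 0; pose de := Num.min d 1.
set tgt := fun p : T2 => _.
have mtgt : cmeasurable tgt.
  apply: cmeasM.
    apply: (cmeas_comp (cmeas_ind R _) measurable_fst); exact: measurable_itv.
  apply: (cmeas_comp (cmeas_ind R _) measurable_snd); exact: measurable_itv.
have a0 : 0 <= al by rewrite le_max lexx orbT.
have b1 : be <= 1 by rewrite ge_min lexx orbT.
have c0 : 0 <= ga by rewrite le_max lexx orbT.
have d1 : de <= 1 by rewrite ge_min lexx orbT.
have tgtE p : sq p -> p.1 != al -> p.1 != be -> p.2 != ga -> p.2 != de ->
    tgt p = ((if al < p.1 < be then 1 else 0) * (if ga < p.2 < de then 1 else 0) : R)%:C.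
  move=> [/= + +]; rewrite !in_itv /= => /andP[x0 x1] /andP[y0 y1] n1 n2 n3 n4.
  have aux (l r x : R) : 0 <= x -> x <= 1 -> x != Num.max l 0 -> x != Num.min r 1 ->
      ind R `]l, r]%classic x = (if Num.max l 0 < x < Num.min r 1 then 1 else 0 : R)%:C.
    move=> h0 h1 hl hr; rewrite /ind.
    have -> : (x \in `]l, r]%classic) = (Num.max l 0 < x < Num.min r 1).
      rewrite mem_setE in_itv /=.
      have -> : (Num.max l 0 < x) = (Num.max l 0 <= x) by rewrite lt_neqAle eq_sym hl.
      have -> : (x < Num.min r 1) = (x <= Num.min r 1) by rewrite lt_neqAle hr.
      rewrite ge_max h0 le_min h1 !andbT; congr (_ && _).
      rewrite [RHS]le_eqVlt; case: eqVneq => // lx.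
      by move: hl; rewrite -lx max_l ?eqxx // lx.
    by case: ifP.
  by rewrite /tgt (aux a b) // (aux c d) // -rmorphM.
have FF : Filter (almost_everywhere lam2) by apply: ae_filter_ringOfSetsType.
(* The approximants need not converge to the target on the edges of the clipped rectangle, and [arc]
   detects the interval only for a strictly inside (0, 1). *)
have ae_lines : {ae lam2, forall p, [/\ p.1 != al /\ p.1 != be, p.1 != 0 /\ p.1 != 1 &
    p.2 != ga /\ p.2 != de]}.
  have h1 : {ae lam2, forall p, p.1 != al /\ p.1 != be}.
    by apply: filterS2 (lam2_line1 al) (lam2_line1 be) => p.
  have h2 : {ae lam2, forall p, p.1 != 0 /\ p.1 != 1}.
    by apply: filterS2 (lam2_line1 0) (lam2_line1 1) => p.
  have h3 : {ae lam2, forall p, p.2 != ga /\ p.2 != de}.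
    by apply: filterS2 (lam2_line2 ga) (lam2_line2 de) => p.
  by apply: filterS3 h1 h2 h3.
have [ab|ab] := ltP al be; last first.
  (* the rectangle is then negligible *)
  apply: (approx_lim (h_ := fun _ _ => 0) (@testfun_meas)).
  - by move=> _; exact: cmeas_cst.
  - exact: mtgt.
  - by move=> _; apply: approxS; exact: testfun_zero.
  apply: (@tsq_dominated R (fun _ _ => 0) tgt (fun=> 1) _ mtgt (integrable_cst_sq (1 : R))).
  - by move=> _; exact: cmeas_cst.
  - move=> _ p _; rewrite sub0r sqmodN sqmodM mulr_ile1 ?sqmod_ge0 ?ind_le1 //.
  apply: filterS ae_lines => p [[n1 n2] _ [n3 n4]] sp; rewrite tgtE // ifF ?mul0r ?subrr ?sqmod0; first exact: cvg_cst.
  apply/negbTE; rewrite negb_and -!leNgt; have [//|h] := leP p.1 al.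
  by rewrite (le_trans ab) // ltW.
pose hk k (p : T2) := (stepp k (arc al be p.1))%:C * (bumpf ga de k p.2)%:C.
have mhk k : cmeasurable (hk k).
  by apply: cmeasM; [exact: (trigpoly_meas (trigpoly_stepp k al be))|exact: bump_meas].
apply: (approx_lim (h_ := hk) (@testfun_meas)); [exact: mhk|exact: mtgt| |].
- move=> k; have [g Tg Eg] := testfun_product k (trigpoly_stepp k al be) c0 d1.
  by apply: approx_eq_sq (approxS Tg) => p sp; rewrite Eg.
(* The majorant 4 is 2 (1 + 1), from [sqmodB] with both moduli at most 1. *)
apply: (tsq_dominated mhk mtgt (integrable_cst_sq (4 : R))).
- move=> k p _; apply: le_trans (sqmodB _ _) _.
  have h1 : sqmod (hk k p) <= 1.
    rewrite /hk sqmodM mulr_ile1 ?sqmod_ge0 // /sqmod /= expr0n addr0.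
      by have /andP[? ?] := stepp_01 k (arc_01 al be p.1); rewrite exprn_ile1.
    by have /andP[? ?] := bump_01 ga de k p.2; rewrite exprn_ile1.
  have h2 : sqmod (tgt p) <= 1.
    by rewrite /tgt sqmodM mulr_ile1 ?sqmod_ge0 ?ind_le1.
  by have := lerD h1 h2; lra.
apply: filterS ae_lines => p [[n1 n2] [n0 n0'] [n3 n4]] sp; rewrite tgtE //.
have x01 : 0 < p.1 < 1.
  move: sp => [/= + _]; rewrite in_itv /= => /andP[x0 x1].
  by rewrite !lt_neqAle x0 x1 eq_sym n0 n0'.
set T : R := (if al < p.1 < be then 1 else 0) * (if ga < p.2 < de then 1 else 0).
have h : (stepp k (arc al be p.1) * bumpf ga de k p.2 - T) @[k --> \oo] --> (T - T : R).
  apply: cvgB; last exact: cvg_cst.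
  by apply: cvgM; [exact: stepp_arc_cvg|exact: bump_cvg].
rewrite subrr in h.
have hh : (stepp k (arc al be p.1) * bumpf ga de k p.2 - T) *
    (stepp k (arc al be p.1) * bumpf ga de k p.2 - T) @[k --> \oo] --> (0 * 0 : R).
  exact: cvgM.
rewrite mulr0 in hh.
apply: (@eq_cvgn R _ _ 0 _ hh) => k.
by rewrite /hk -rmorphM -rmorphB /sqmod /= expr0n addr0 expr2.
Qed.

Lemma W0_dense g e : qp0 N g -> lq N g -> 0 < e ->
  exists2 u, cbumpy u & (tsq (fun p => (g p - W0 u p)%R) < e%:E)%E.
Proof.
move=> g0 lg e0; have gP := good_opP R N0 0; have [_ _ [K K0 hK]] := gP.
have [mg _ _] := lg.1.
have := approx_all (@testfun_meas) (@testfun_lin) testfun_zero approx_ocitv mg lg.2.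
have e1 : 0 < e / (K + 1) by rewrite divr_gt0 // ltr_wpDl.
move=> /(_ _ e1) [h [qh [u bu hu]] he]; exists u => //.
(* Both terms are values of [opP 0], so the error is the image of g - h under it. *)
have -> : (fun p => g p - W0 u p) = opP N 0 (fun p => g p - h p).
  have -> : (fun p => g p - h p) = (fun p => (-1) * h p + g p).
    by apply/funext => p; rewrite mulN1r addrC.
  rewrite (good_lin gP) hu (opP0_id g0); apply/funext => p.
  by rewrite mulN1r addrC.
apply: le_lt_trans (hK _ (qpB lg.1 qh)) _.
apply: (@le_lt_trans _ _ (K%:E * (e / (K + 1))%:E)%E).
  by rewrite lee_wpmul2l ?lee_fin // ltW.
rewrite -EFinM lte_fin mulrA ltr_pdivrMr ?ltr_wpDl // mulrC ltr_pM2l //.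
by rewrite ltrDl.
Qed.

End Density.

(** * The range of the Weil--Brezin map *)

Section Tiling.
Variable R : realType.
Local Notation T1 := (measurableTypeR R).
Local Notation lam := (@lebesgue_measure R).

Lemma integral_tile (h : R -> \bar R) (b : R) m :
  measurable_fun setT (h : T1 -> \bar R) -> (forall x, (0 <= h x)%E) ->
  (\int[lam]_(x in `[b, (b + m%:R)%R]) h x =
   \sum_(i < m) \int[lam]_(x in `[0%R, 1%R]) h (x + (b + i%:R))%R)%E.
Proof.
move=> mh h0; elim: m => [|m IH].
  by rewrite big_ord0 addr0 set_itv1 integral_set1.
have hm : b <= b + m%:R by rewrite lerDl.
have hm1 : b + m%:R <= b + m.+1%:R by rewrite lerD2l ler_nat.
rewrite (integral_split hm hm1) // IH big_ord_recr /=; congr (_ + _)%E.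
rewrite (integral_interval_shift 0 1 (b + m%:R)) //.
by rewrite add0r (_ : 1 + (b + m%:R) = b + m.+1%:R) // -natr1; ring.
Qed.

(** Orthogonality of the characters of Z/m. [sum_root] is applied with m in the role of N, so m = 0
    is split off. *)
Lemma discrete_parseval (m : nat) (x : 'I_m -> R[i]) :
  \sum_(j < m) sqmod (\sum_(i < m) x i * expi2pi (i%:R * j%:R / m%:R)) =
  m%:R * \sum_(i < m) sqmod (x i).
Proof.
case: m x => [|m] x; first by rewrite big_ord0 mul0r.
have m0 : m.+1%:Z != 0 by [].
apply: complexI; rewrite rmorphM rmorph_nat !rmorph_sum /=.
under eq_bigr => j _.
  rewrite -mul_conj rmorph_sum mulr_suml.
  under eq_bigr => i _ do rewrite mulr_sumr.
  over.
rewrite exchange_big /= mulr_sumr; apply: eq_bigr => i _.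
rewrite exchange_big /= (bigD1 i) //= [X in _ + X]big1 ?addr0 => [|k ki].
  under eq_bigr => j _ do rewrite mul_conj sqmodM sqmod_expi mulr1.
  by rewrite sumr_const card_ord mulr_natl.
have := sum_root R m0 (i%:Z - k%:Z).
rewrite (@dvdz_ord m.+1%:Z i k) eq_sym (negbTE ki) => h.
transitivity (x i * (x k)^* * \sum_(r < `|m.+1%:Z|)
   expi2pi ((i%:Z - k%:Z)%:~R * r%:R / m.+1%:Z%:~R)).
  rewrite mulr_sumr; apply: eq_bigr => j _.
  rewrite rmorphM /= -expi2piN mulrACA -expi2piD; congr (_ * expi2pi _).
  by rewrite intrB -!pmulrn; field; rewrite addrC natr1 pnatr_eq0.
by rewrite h mulr0.
Qed.

End Tiling.

(** * The norm of [W0 u] for compactly supported u *)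

Section Isometry.
Variables (R : realType) (N : int).
Hypothesis N0 : N != 0.
Local Notation T1 := (measurableTypeR R).
Local Notation T2 := (T1 * T1)%type.
Local Notation NR := (N%:~R : R).
Local Notation n := (`|N|%N).
Local Notation lam := (@lebesgue_measure R).
Implicit Types (u : R -> R[i]).

Lemma le_normNR (x : R) : `|x| <= `|NR * x|.
Proof.
by rewrite normrM ler_peMl // -intr_norm ler1z -gtz0_ge1 normr_gt0 //.
Qed.

(** The surviving indices are q N, with argument N (q + c). Since |N (q + c)| >= |q + c| and c is in
    [0, 1], this leaves the support unless -Q <= q < Q. *)
Lemma W0_finite u (Q : nat) a c : (forall x, Q%:R <= `|x| -> u x = 0) -> 0 <= c <= 1 ->
  W0 N u (a, c) = \sum_(i < (Q + Q)%N)
    u (NR * (c + (- Q%:R + i%:R))) * expi2pi (NR * (- Q%:R + i%:R) * a).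
Proof.
move=> uQ /andP[c0 c1]; apply: has_csumZ_eq.
pose k0 (i : 'I_(Q + Q)) : int := N * (i%:Z - Q%:Z).
have := @has_csumZ_sum _ _ (index_enum 'I_(Q + Q))
  (fun i k => if k == k0 i then wterm N (dlt R N) u (a, c) k else 0) _
  (fun i => has_csumZ_single (k0 := k0 i) _).
rewrite /=.
move=> H.
have {}H := H (fun i k (e : k != k0 i) => ifN _ _ e).
rewrite (_ : \sum_(i < Q + Q) _ = \sum_(i < Q + Q)
   (if k0 i == k0 i then wterm N (dlt R N) u (a, c) (k0 i) else 0)).
  move: H; congr has_csumZ; apply/funext => k.
  have [/dvdzP[q kq]|nk] := boolP (N %| k)%Z; last first.
    rewrite big1 ?/wterm /dlt ?(negbTE nk) ?mul0r // => i _.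
    by case: eqP nk => // ->; rewrite /k0 dvdz_mulr ?dvdzz.
  have [qQ|qQ] := boolP ((- Q%:Z <= q) && (q < Q%:Z)).
    have iQ : (`|(q + Q%:Z)%R| < Q + Q)%N by lia.
    have kE : k = k0 (Ordinal iQ).
      rewrite /k0 /= kq gez0_abs; first by rewrite addrK mulrC.
      by lia.
    rewrite (bigD1 (Ordinal iQ)) //= -kE eqxx big1 ?addr0 // => i /eqP ni.
    case: eqP => // e; case: ni; apply: val_inj => /=.
    have : k0 i = k0 (Ordinal iQ) by rewrite -e.
    by move=> /(mulfI N0) /=; lia.
  rewrite big1 => [|i _].
    rewrite /wterm uQ ?mulr0 ?mul0r //= kq intrM -[q%:~R * _]mulrC -mulrDr.
    apply: le_trans (le_normNR _).
    move: qQ; rewrite negb_and -ltNge -leNgt => /orP[h|h].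
      have h2 : (q%:~R : R) <= - Q%:R - 1.
        have : q <= - Q%:Z - 1 by lia.
        by rewrite -(ler_int R) intrB intrN -pmulrn.
      by have := ler0n R Q; move=> ?; rewrite ler0_norm; lra.
    have h2 : Q%:R <= q%:~R :> R by rewrite -(ler_int R) -pmulrn in h.
    by have := ler0n R Q; move=> ?; rewrite ger0_norm; lra.
  case: eqP => // e; move/negP: qQ; case.
  have : q = i%:Z - Q%:Z by apply: (mulfI N0); rewrite -/(k0 i) -e kq mulrC.
  by have := ltn_ord i; lia.
apply: eq_bigr => i _; rewrite eqxx /wterm /dlt /k0 dvdz_mulr ?dvdzz // mul1r /=.
rewrite intrM intrB -!pmulrn; congr (u _ * expi2pi _); ring.
Qed.

(** For c in [0, 1] at most m = 2Q frequencies occur in a, all multiples of N. Averaging over the m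
    translations by j/(mN), which do not change [tsq], removes the cross terms by
    [discrete_parseval]. The remaining integrals over c tile the line, and |N| comes from the
    substitution x = N y. *)
Lemma W0_isometry u : nice u -> (exists2 M : R, 0 <= M & forall x, M <= `|x| -> u x = 0) ->
  (\int[lam]_x (sqmod (u x))%:E = n%:R%:E * tsq (W0 N u))%E.
Proof.
move=> nu [M M0 uM]; have [_ mu] := nu.
have [[mW W1 _] _] := W0_qp0 N0 nu.
pose Q := (Num.truncn M).+1.
have uQ x : Q%:R <= `|x| -> u x = 0.
  by move=> h; apply: uM; apply: le_trans h; apply/ltW/truncnS_gt.
pose m := (Q + Q)%N.
have m0 : m%:R != 0 :> R by rewrite pnatr_eq0.
pose h y := (sqmod (u (NR * y)))%:E.
have mh : measurable_fun setT (h : T1 -> \bar R).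
  by apply: cmeas_esqmod; apply: (cmeas_comp mu); exact: measurable_funM.
have h0 y : (0 <= h y)%E by rewrite lee_fin sqmod_ge0.
have mhi i : measurable_fun setT ((fun c => h (c + (- Q%:R + i%:R))%R) : T1 -> \bar R).
  by apply: (measurableT_comp mh); exact: measurable_funD.
have NR0 : NR != 0 by rewrite intr_eq0.
have E1 : (\int[lam]_y h y = (n%:R^-1)%:E * \int[lam]_x (sqmod (u x))%:E)%E.
  have := @ge0_integral_affine R NR 0 (fun x => (sqmod (u x))%:E) NR0 (cmeas_esqmod mu).
  rewrite -intr_norm -abszE -pmulrn => <- => [|x]; last by rewrite lee_fin sqmod_ge0.
  by apply: eq_integral => y _; rewrite addr0.
have E2 : (\int[lam]_y h y = \int[lam]_(c in `[0%R, 1%R]) \sum_(i < m) h (c + (- Q%:R + i%:R))%R)%E.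
  rewrite ge0_integral_sum // => [|i]; last first.
    exact: measurable_funS (mhi i).
  rewrite -integral_tile // [RHS]integral_mkcond.
  apply: eq_integral => y _; rewrite /patch; case: ifPn => // /negP yQ.
  rewrite /h uQ ?sqmod0 //; apply: le_trans (le_normNR _).
  rewrite leNgt; apply/negP; rewrite ltr_norml => /andP[l1 l2]; apply: yQ.
  by rewrite inE /= in_itv /= (ltW l1) /= natrD addKr ltW.
have E3 j : tsq (W0 N u) = tsq (fun p => W0 N u (p.1 + j%:R / (m%:R * NR), p.2)).
  symmetry; rewrite /tsq; apply: (@integral_shift_fst R (j%:R / (m%:R * NR)) (fun p => (sqmod (W0 N u p))%:E)).
  - exact: cmeas_esqmod.
  - by move=> p; rewrite lee_fin sqmod_ge0.
  - by move=> a c; rewrite W1.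
have E4 : (m%:R%:E * tsq (W0 N u) = m%:R%:E * \int[lam]_y h y)%E.
  transitivity (\sum_(j < m) tsq (W0 N u))%E.
    by rewrite sumr_const card_ord mule_natl.
  rewrite (eq_bigr (fun j : 'I_m => tsq (fun p => W0 N u (p.1 + j%:R / (m%:R * NR), p.2)))); last first.
    by move=> j _; exact: E3.
  have ms (j : 'I_m) : measurable_fun (@unit_sq R) (fun p : T2 => (sqmod (W0 N u (p.1 + j%:R / (m%:R * NR), p.2)))%:E).
    apply: (measurable_funS measurableT) => //; apply: cmeas_esqmod; apply: (cmeas_comp mW).
    by apply: measurable_fun_pair => //=; exact: measurable_funD.
  rewrite /tsq -ge0_integral_sum //; last first.
  - by move=> j p _; rewrite lee_fin sqmod_ge0.
  - exact: measurable_unit_sq.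
  rewrite E2 -ge0_integralZl //; last first.
  - by move=> c _; apply: sume_ge0.
  - by apply: emeasurable_sum => i; exact: measurable_funS (mhi i).
  pose H (p : T2) := (m%:R%:E * \sum_(i < m) h (p.2 + (- Q%:R + i%:R))%R)%E.
  transitivity (\int[lam2 (R:=R)]_(p in unit_sq (R:=R)) H p)%E.
    apply: eq_integral => -[a c]; rewrite inE => -[_ /= c01].
    rewrite /H /h !sumEFin -EFinM /=; congr EFin.
    pose x (i : 'I_m) := u (NR * (c + (- Q%:R + i%:R))) * expi2pi (NR * (- Q%:R + i%:R) * a).
    transitivity (m%:R * \sum_(i < m) sqmod (x i)); last first.
      by congr (_ * _); apply: eq_bigr => i _; rewrite sqmodM sqmod_expi mulr1.
    rewrite -discrete_parseval; apply: eq_bigr => j _.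
    rewrite (W0_finite _ uQ); last by move: c01; rewrite in_itv /=.
    (* The unimodular factor e(Qj/m) removes the offset -Q of the frequencies, as
       [discrete_parseval] counts from 0. *)
    rewrite -[LHS]mulr1 -[X in _ * X = _](sqmod_expi (Q%:R * j%:R / m%:R)) -sqmodM mulr_suml; congr sqmod.
    apply: eq_bigr => i _; rewrite /x -!mulrA; congr (_ * _).
    by rewrite -!expi2piD; congr expi2pi; field; rewrite NR0 /= pnatr_eq0.
  have mH : measurable_fun setT H.
    apply: measurable_funeM; apply: emeasurable_sum => i.
    exact: (measurableT_comp (mhi i) measurable_snd).
  rewrite integral_lam22 //; try exact: (measurable_I01 R); last first.
    by move=> p; apply: mule_ge0; [rewrite lee_fin|apply: sume_ge0].
  apply: eq_integral => c _.
  rewrite /H /= integral_cst //; exact: (etrans (congr1 (mule _) (lebesgue_I01 R)) (mule1 _)).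
have E5 : tsq (W0 N u) = (\int[lam]_y h y)%E.
  have e : ((m%:R^-1)%:E * (m%:R%:E * tsq (W0 N u)) = (m%:R^-1)%:E * (m%:R%:E * \int[lam]_y h y))%E by rewrite E4.
  by rewrite !muleA -EFinM mulVf // !mul1e in e.
rewrite E5 E1 muleA -EFinM divff ?mul1e //.
by rewrite pnatr_eq0 absz_eq0.
Qed.

End Isometry.

(** * Completeness of L^2(R) *)

Section RieszFischer.
Variable R : realType.
Local Notation T1 := (measurableTypeR R).
Local Notation lam := (@lebesgue_measure R).

(** With r k = 2b/2^k, the tail of the geometric series, a - r increases and a + r decreases; their
    common limit is squeezed between them, which also gives the rate. *)
Lemma geometric_limit (a : nat -> R) (b : R) : 0 <= b ->
  (forall k, `|a k.+1 - a k| <= b / 2 ^+ k) ->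
  a @ \oo --> limn a /\ forall k, `|a k - limn a| <= 2 * b / 2 ^+ k.
Proof.
move=> b0 ha; pose r k := 2 * b / 2 ^+ k.
have r0 k : 0 <= r k by rewrite divr_ge0 ?mulr_ge0 ?exprn_ge0.
have rS k : r k.+1 = b / 2 ^+ k by rewrite /r exprS; field; rewrite expf_neq0.
have rE k : r k = b / 2 ^+ k + r k.+1 by rewrite rS /r; ring.
have nx : nondecreasing_seq (fun k => a k - r k).
  apply/nondecreasing_seqP => k; move: (ha k); rewrite ler_norml => /andP[h _].
  by rewrite (rE k); lra.
have ny k m : (k <= m)%N -> a m + r m <= a k + r k.
  elim: m => [|m IH]; first by rewrite leqn0 => /eqP ->.
  rewrite leq_eqVlt => /orP[/eqP -> //|/IH h]; apply: le_trans h.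
  move: (ha m); rewrite ler_norml => /andP[_ h].
  by rewrite (rE m); lra.
have ub k m : a m - r m <= a k + r k.
  apply: (@le_trans _ _ (a (maxn k m) - r (maxn k m))); first by apply: nx; exact: leq_maxr.
  apply: le_trans (ny k (maxn k m) (leq_maxl _ _)).
  by have := r0 (maxn k m); lra.
have cx : cvgn (fun k => a k - r k).
  by apply: nondecreasing_is_cvgn => //; exists (a 0 + r 0) => _ [m _ <-]; exact: ub.
pose l := limn (fun k => a k - r k).
have lk k : `|a k - l| <= r k.
  rewrite distrC ler_norml; apply/andP; split.
    by have := nondecreasing_cvgn_le nx cx k; rewrite -/l /=; lra.
  have : l <= a k + r k by apply: limr_le => //; apply: nearW => m; exact: ub.
  by lra.
have rc : r k @[k --> \oo] --> (2 * b * 0 : R).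
  have -> : (fun k => r k) = (fun k => 2 * b * (2^-1) ^+ k).
    by apply/funext => k; rewrite /r exprVn.
  apply: cvgM; first exact: cvg_cst.
  by apply: cvg_expr; rewrite ger0_norm // invf_lt1 // ltr1n.
rewrite mulr0 in rc.
have ac : a @ \oo --> l.
  apply: (@squeeze_cvgr _ _ _ _ (fun k => l - r k) (fun k => l + r k)).
  - apply: nearW => k; have := lk k; rewrite ler_norml => /andP[h1 h2].
    by apply/andP; split; lra.
  - by rewrite -[X in _ --> X]subr0; apply: cvgB => //; exact: cvg_cst.
  - by rewrite -[X in _ --> X]addr0; apply: cvgD => //; exact: cvg_cst.
by rewrite (cvg_lim _ ac).
Qed.

(** The rate 8^(-k) is fast enough that the sum D of the squared increments with weights 4^k has
    integral at most 1. Where D is finite, |u_(k+1) - u_k| <= sqrt(D)/2^k, hence pointwise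
    convergence with |u_k - f|^2 <= 8 D/4^k, where 8 is 2 components times 2 squared. Integrating
    this bound gives convergence in mean. *)
Lemma riesz_fischer (u : nat -> T1 -> R[i]) :
  (forall k, cmeasurable (u k)) ->
  (\int[lam]_x (sqmod (u 0%N x))%:E < +oo)%E ->
  (forall k, (\int[lam]_x (sqmod (u k.+1 x - u k x)%R)%:E <= ((2 * 8 ^+ k)^-1)%:E)%E) ->
  exists2 f, L2R f & L2R_cvg u f.
Proof.
move=> mu u0 hu.
have md k : cmeasurable (fun x => u k.+1 x - u k x) by exact: cmeasB.
pose t k x : \bar R := ((4 ^+ k)%:E * (sqmod (u k.+1 x - u k x)%R)%:E)%E.
have t0 k x : (0 <= t k x)%E by rewrite /t -EFinM lee_fin mulr_ge0 ?exprn_ge0 ?sqmod_ge0.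
have mt k : measurable_fun setT (t k) by apply: measurable_funeM; exact: cmeas_esqmod.
pose D x := (\sum_(0 <= k <oo) t k x)%E.
have D0 x : (0 <= D x)%E by apply: nneseries_ge0.
have mD : measurable_fun setT (D : T1 -> \bar R).
  by apply: ge0_emeasurable_sum.
have iD : (\int[lam]_x D x <= 1%:E)%E.
  rewrite integral_nneseries //.
  have := @epsilon_trick R (fun=> 0%E) 1 xpredT (fun=> lexx _) ler01.
  rewrite [X in (_ <= X + _)%E]eseries0 // add0e; apply: le_trans.
  apply: lee_nneseries => [k _ _|k _]; first by apply: integral_ge0.
  rewrite /= add0e (_ : 1 / (2 ^ k.+1)%:R = (2 * 2 ^+ k)^-1); last first.
    by rewrite div1r natrX exprS.
  rewrite /t ge0_integralZl //; last 2 first.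
  - exact: cmeas_esqmod.
  - by move=> x _; rewrite lee_fin sqmod_ge0.
  apply: le_trans (lee_wpmul2l _ (hu k)) _; first by rewrite lee_fin exprn_ge0.
  rewrite -EFinM lee_fin (_ : 8 = 2 * 4 :> R) ?exprMn; last by rewrite -natrM.
  have p2 : 2 ^+ k != 0 :> R by rewrite expf_neq0.
  have p4 : 4 ^+ k != 0 :> R by rewrite expf_neq0.
  rewrite le_eqVlt; apply/orP; left; apply/eqP; field.
  by rewrite p2 p4.
pose E (x : T1) : bool := (D x < +oo)%E.
have mE : measurable_fun setT E by apply: measurable_fun_lte => //; exact: measurable_cst.
(* Where D is infinite f is set to 0, and the bound by 8 D/4^k holds trivially there. *)
pose f (x : T1) : R[i] := if E x then limn (fun k => complex.Re (u k x)) +i* limn (fun k => complex.Im (u k x)) else 0.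
have tD k x : (t k x <= D x)%E.
  have := @nneseries_lim_ge R (t^~ x) xpredT 0%N k.+1 (fun n _ _ => t0 n x).
  apply: le_trans; rewrite big_nat_recr //= leeDr //; exact: sume_ge0.
have key x : E x -> 
  [/\ (fun k => complex.Re (u k x)) @ \oo --> complex.Re (f x),
      (fun k => complex.Im (u k x)) @ \oo --> complex.Im (f x) &
      forall k, sqmod (u k x - f x) <= 8 / 4 ^+ k * fine (D x)].
  move=> Ex; set B := fine (D x).
  have DB : D x = B%:E by rewrite fineK // ge0_fin_numE.
  have B0 : 0 <= B by rewrite fine_ge0.
  have sB k : sqmod (u k.+1 x - u k x) <= (Num.sqrt B / 2 ^+ k) ^+ 2.
    rewrite expr_div_n sqr_sqrtr // -exprM mulnC exprM (_ : 2 ^+ 2 = 4 :> R); last by rewrite -natrX.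
    by rewrite ler_pdivlMr ?exprn_gt0 // mulrC -lee_fin EFinM -DB; exact: tD.
  have s0 k : 0 <= Num.sqrt B / 2 ^+ k by rewrite divr_ge0 ?sqrtr_ge0 ?exprn_ge0.
  have [r1 r2] : (fun k => complex.Re (u k x)) @ \oo --> limn (fun k => complex.Re (u k x)) /\ forall k, `|complex.Re (u k x) - limn (fun k => complex.Re (u k x))| <= 2 * Num.sqrt B / 2 ^+ k.
    apply: geometric_limit; first exact: sqrtr_ge0.
    move=> k; rewrite -ler_sqr ?nnegrE // real_normK ?num_real //.
    apply: le_trans (sB k); apply: le_trans (sqmod_Re _).
    by case: (u k.+1 x) => ? ?; case: (u k x).
  have [i1 i2] : (fun k => complex.Im (u k x)) @ \oo --> limn (fun k => complex.Im (u k x)) /\ forall k, `|complex.Im (u k x) - limn (fun k => complex.Im (u k x))| <= 2 * Num.sqrt B / 2 ^+ k.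
    apply: geometric_limit; first exact: sqrtr_ge0.
    move=> k; rewrite -ler_sqr ?nnegrE // real_normK ?num_real //.
    apply: le_trans (sB k); apply: le_trans (sqmod_Im _).
    by case: (u k.+1 x) => ? ?; case: (u k x).
  rewrite /f Ex; split => // k.
  have -> : 8 / 4 ^+ k * B = 2 * (2 * Num.sqrt B / 2 ^+ k) ^+ 2.
    rewrite expr_div_n exprMn sqr_sqrtr // -exprM mulnC exprM (_ : 2 ^+ 2 = 4 :> R); last by rewrite -natrX.
    by ring.
  have q (y : R) : `|y| <= 2 * Num.sqrt B / 2 ^+ k -> y ^+ 2 <= (2 * Num.sqrt B / 2 ^+ k) ^+ 2.
    by move=> h; rewrite -[y ^+ 2]real_normK ?num_real // ler_sqr ?nnegrE // -mulrA mulr_ge0.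
  have := lerD (q _ (r2 k)) (q _ (i2 k)); have e2 (y : R) : y + y = 2 * y by ring.
  rewrite [X in _ <= X]e2.
  by rewrite /sqmod; case: (u k x).
have mf : cmeasurable f.
  apply: (cmeas_lim (F_ := fun k x => if E x then u k x else 0)).
  - by move=> k; apply: cmeas_if => //; exact: cmeas_cst.
  - move=> x; rewrite /f; case Ex: (E x); last exact: cvg_cst.
    by have [h _ _] := key _ Ex; move: h; rewrite /f Ex.
  - move=> x; rewrite /f; case Ex: (E x); last exact: cvg_cst.
    by have [_ h _] := key _ Ex; move: h; rewrite /f Ex.
have bnd k : (\int[lam]_x (sqmod (u k x - f x)%R)%:E <= (8 / 4 ^+ k)%:E)%E.
  have c0 : 0 < 8 / 4 ^+ k :> R by rewrite divr_gt0 // exprn_gt0.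
  apply: (@le_trans _ _ (\int[lam]_x ((8 / 4 ^+ k)%:E * D x))%E); last first.
    rewrite ge0_integralZl ?lee_fin ?(ltW c0) //.
    rewrite -[leRHS]mule1 lee_wpmul2l // lee_fin; exact: ltW.
  apply: ge0_le_integral => //.
  - by move=> x _; rewrite lee_fin sqmod_ge0.
  - by apply: cmeas_esqmod; exact: cmeasB.
  - exact: measurable_funeM.
  move=> x _; case Ex: (E x).
    have [_ _ /(_ k)] := key _ Ex; rewrite -lee_fin EFinM fineK // ge0_fin_numE //.
  move: Ex => /negbT; rewrite -leNgt leye_eq => /eqP ->.
  by rewrite gt0_muley ?leey // lte_fin.
exists f.
  split=> //.
  apply: (@le_lt_trans _ _ (\int[lam]_x (2%:E * (sqmod (u 0%N x - f x)%R)%:E + 2%:E * (sqmod (u 0%N x))%:E))%E).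
    apply: ge0_le_integral => //.
    - by move=> x _; rewrite lee_fin sqmod_ge0.
    - exact: cmeas_esqmod.
    - apply: emeasurable_funD; apply: measurable_funeM; apply: cmeas_esqmod => //; exact: cmeasB.
    move=> x _; rewrite -!EFinM -EFinD lee_fin -mulrDr.
    have := sqmodB (u 0%N x) (u 0%N x - f x).
    by rewrite (addrC (sqmod (u 0%N x))); congr (sqmod _ <= _); ring.
  have m0 : cmeasurable (fun x => u 0%N x - f x) by exact: cmeasB.
  rewrite ge0_integralD //; last 4 first.
  - by move=> x _; rewrite -!EFinM lee_fin mulr_ge0 // sqmod_ge0.
  - by apply: measurable_funeM; apply: cmeas_esqmod.
  - by move=> x _; rewrite -!EFinM lee_fin mulr_ge0 // sqmod_ge0.
  - by apply: measurable_funeM; apply: cmeas_esqmod.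
  rewrite ge0_integralZl //; last 2 first.
  - exact: cmeas_esqmod.
  - by move=> x _; rewrite lee_fin sqmod_ge0.
  rewrite ge0_integralZl //; last 2 first.
  - exact: cmeas_esqmod.
  - by move=> x _; rewrite lee_fin sqmod_ge0.
  apply: lte_add_pinfty; apply: lte_mul_pinfty => //.
  by apply: le_lt_trans (bnd 0%N) _; rewrite ltry.
have cc : (fun k => (8 / 4 ^+ k : R)%:E) @ \oo --> 0%E.
  apply: cvg_EFin; first exact: nearW.
  have -> : fine \o (fun k => (8 / 4 ^+ k : R)%:E) = (fun k => 8 * (4^-1) ^+ k).
    by apply/funext => k; rewrite /= exprVn.
  rewrite -[X in _ --> X](mulr0 8); apply: cvgM; first exact: cvg_cst.
  by apply: cvg_expr; rewrite ger0_norm // invf_lt1 // ltr1n.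
apply: (@squeeze_cvge _ _ _ _ (fun=> 0%E) _ (fun k => (8 / 4 ^+ k)%:E)) => //; last exact: cvg_cst.
by apply: nearW => k; rewrite bnd andbT; apply: integral_ge0 => x _; rewrite lee_fin sqmod_ge0.
Qed.

End RieszFischer.

Section Image.
Variables (R : realType) (N : int).
Hypothesis N0 : N != 0.
Local Notation T1 := (measurableTypeR R).
Local Notation T2 := (T1 * T1)%type.
Local Notation n := (`|N|%N).

(** The coefficient phi divided by the constant of the map is approximated by [W0 (u k)]; the
    isometry makes the u k converge in L^2(R), and the limit is the required preimage. *)
Lemma VS_sub_HNd d (chi : int -> R[i]) : (0 < d)%N -> per N (char_at_quot N d chi) ->
  VS N [:: char_at_quot N d chi] `<=` HNd N d chi.
Proof.
set v := char_at_quot N d chi => d0 pv F VF.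
have HF := VS_HN N0 VF.
case: VF => mF [phi_ [hphi Fphi]].
have [q0 l0] := hphi 0%N; set phi := phi_ 0%N in q0 l0.
have c0 := wconst_neq0 R N0 d0; set c := wconst R N d in c0.
pose psi p := c^-1 * phi p.
have qpsi : qp0 N psi by exact: qp0Z.
have lpsi : lq N psi by exact: lqZ.
have nR : 0 < n%:R :> R by rewrite ltr0n absz_gt0.
(* Chosen so that |N| times 2 (e_k + e_(k+1)), at most 4 |N| e_k, equals at most 1/(2 8^k), the rate
   asked by [riesz_fischer]. *)
pose e k : R := (8 * n%:R * 8 ^+ k)^-1.
have e0 k : 0 < e k by rewrite invr_gt0 !mulr_gt0 ?exprn_gt0.
have eS k : e k.+1 <= e k.
  rewrite lef_pV2 ?posrE ?mulr_gt0 ?exprn_gt0 // ler_pM2l ?mulr_gt0 //.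
  by rewrite ler_weXn2l // ler1n.
have [u hu] : {u : nat -> T1 -> R[i] & forall k, cbumpy (u k) /\ (tsq (fun p => (psi p - W0 N (u k) p)%R) < (e k)%:E)%E}.
  apply: (@choice _ _ (fun k (u : T1 -> R[i]) => cbumpy u /\ (tsq (fun p => (psi p - W0 N u p)%R) < (e k)%:E)%E)) => k.
  by have [w bw hw] := W0_dense N0 qpsi lpsi (e0 k); exists w.
have bu k : cbumpy (u k) by case: (hu k).
have nu k := cbumpy_nice (bu k).
have mW k : cmeasurable (W0 N (u k)) by have [[]] := W0_qp0 N0 (nu k).
have mpsi : cmeasurable psi by have [[]] := qpsi.
have iso w : cbumpy w -> (\int[@lebesgue_measure R]_x (sqmod (w x))%:E = n%:R%:E * tsq (W0 N w))%E.
  by move=> bw; apply: W0_isometry => //; [exact: cbumpy_nice|exact: cbumpy_support].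
have [f Lf uf] : exists2 f, L2R f & L2R_cvg u f.
  apply: riesz_fischer; first by move=> k; case: (nu k).
    rewrite iso //; apply: lte_mul_pinfty; rewrite ?lee_fin //.
    rewrite (@eq_tsq _ _ (fun p => psi p - (psi p - W0 N (u 0%N) p))); last first.
      by move=> p; congr sqmod; ring.
    apply: le_lt_trans (tsqB mpsi (cmeasB mpsi (mW 0%N))) _.
    apply: lte_mul_pinfty; rewrite ?lee_fin // lte_add_pinfty //; first by case: lpsi.
    by apply: lt_trans (hu 0%N).2 _; rewrite ltry.
  move=> k.
  have bd : cbumpy (fun x => u k.+1 x - u k x).
    have := cbumpy_lin (-1) (bu k) (bu k.+1); congr cbumpy; apply/funext => x.
    by rewrite mulN1r addrC.
  rewrite iso //.
  have -> : W0 N (fun x => u k.+1 x - u k x) = fun p => (psi p - W0 N (u k) p) - (psi p - W0 N (u k.+1) p).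
    have -> : (fun x => u k.+1 x - u k x) = (fun x => (-1) * u k x + u k.+1 x).
      by apply/funext => x; rewrite mulN1r addrC.
    by rewrite W0_lin //; apply/funext => p; ring.
  apply: (@le_trans _ _ (n%:R%:E * (2%:E * ((e k)%:E + (e k)%:E)))%E).
    apply: lee_wpmul2l; rewrite ?lee_fin //.
    apply: le_trans (tsqB (cmeasB mpsi (mW k)) (cmeasB mpsi (mW k.+1))) _.
    apply: lee_wpmul2l; rewrite ?lee_fin //; apply: leeD; first exact: ltW (hu k).2.
    by apply: le_trans (ltW (hu k.+1).2) _; rewrite lee_fin.
  rewrite -EFinD -!EFinM lee_fin /e le_eqVlt; apply/orP; left; apply/eqP.
  by field; rewrite expf_neq0 ?gt_eqF.
exists f; split => //; exists u; split => [k||] //; first exact: cbumpy_schwartz.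
have gS := @good_opS R N v; have [_ lS [K K0 bS]] := gS.
have E k : heis_sqnorm (fun x => weil_brezin N d chi (u k) x - F x) =
    tsq (opS N v (fun p => (- c) * (psi p - W0 N (u k) p))).
  have qd : qp N (fun p => - c * (psi p - W0 N (u k) p)).
    by apply: qpZ; apply: qpB; [case: qpsi|case: (W0_qp0 N0 (nu k))].
  have [mS _ _] := good_qp gS qd.
  rewrite -(@heis_sqnorm_hlift R N) //.
  apply: eq_heis_sqnorm.
  - apply: cmeasB => //; rewrite weil_brezinE; apply: hlift_meas.
    apply: cmeasM; first exact: cmeas_cst.
    rewrite WB_opS //; last by case: (nu k).
    by have [] := good_qp gS (W0_qp0 N0 (nu k)).1.
  - exact: hlift_meas.
  - apply: filterS Fphi => x ->.
    rewrite weil_brezinE WB_opS //; last by case: (nu k).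
    rewrite /hlift -mulrBr; congr (_ * _).
    rewrite /synth big_ord1 -/phi /opS mulr_sumr -sumrB; apply: eq_bigr => r _ /=.
    rewrite /opX /psi -/c /cf /= -/v; field.
    by rewrite c0.
have q k : (heis_sqnorm (fun x => (weil_brezin N d chi (u k) x - F x)%R) <= (K * sqmod c * e k)%:E)%E.
  have qd : qp N (fun p => psi p - W0 N (u k) p).
    by apply: qpB; [case: qpsi|case: (W0_qp0 N0 (nu k))].
  rewrite E; apply: le_trans (bS _ (qpZ _ qd)) _.
  rewrite tsqM ?sqmodN; last by case: qd.
  rewrite -mulrA !EFinM; apply: lee_wpmul2l; rewrite ?lee_fin //.
  by apply: lee_wpmul2l; rewrite ?lee_fin ?sqmod_ge0 // ltW // (hu k).2.
apply: (@squeeze_cvge _ _ _ _ (fun=> 0%E) _ (fun k => (K * sqmod c * e k)%:E)); last 2 first.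
- exact: cvg_cst.
- apply: cvg_EFin; first exact: nearW.
  have -> : fine \o (fun k => (K * sqmod c * e k)%:E) = (fun k => K * sqmod c * (8 * n%:R)^-1 * (8^-1) ^+ k).
    by apply/funext => k; rewrite /= exprVn /e (invfM (8 * n%:R)) mulrA.
  rewrite -[X in _ --> X](mulr0 (K * sqmod c * (8 * n%:R)^-1)); apply: cvgM; first exact: cvg_cst.
  by apply: cvg_expr; rewrite ger0_norm // invf_lt1 // ltr1n.
by apply: nearW => k; rewrite q andbT; apply: integral_ge0 => x _; rewrite lee_fin sqmod_ge0.
Qed.

End Image.

(** * Dirichlet characters *)

Section Residues.

Lemma dvdzBC (d a b : int) : (d %| a - b)%Z = (d %| b - a)%Z.
Proof. by rewrite -[b - a]opprB rpredN. Qed.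

Lemma dvdzB_trans (b d a c : int) : (d %| a - b)%Z -> (d %| b - c)%Z -> (d %| a - c)%Z.
Proof. by move=> h1 h2; rewrite -(subrK b a) -addrA rpredD. Qed.

Lemma coprimez_congr (e t k : int) : (e %| t - k)%Z -> coprimez t e = coprimez k e.
Proof.
move=> /dvdzP[q /eqP]; rewrite subr_eq => /eqP ->.
by rewrite /coprimez ![gcdz _ e]gcdzC gcdzMDl.
Qed.

(** Take t = k + e m with m the part of M prime to k. A prime divisor of M either divides k, and
    then neither e nor m, or divides m and not k; in both cases it does not divide t. For k = 0 the
    hypothesis forces e = 1. *)
Lemma unit_lift (e M : nat) (k : int) : (0 < M)%N -> coprimez k e%:Z ->
  exists2 t : int, (e%:Z %| t - k)%Z & coprimez t M%:Z.
Proof.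
move=> M0; have [-> c0|k0 ck] := eqVneq k 0.
  exists 1; last by rewrite /coprimez gcd1z.
  by move: c0; rewrite /coprimez gcd0z dvdzE => /eqP[] /eqP; rewrite absz_nat => /eqP ->.
pose m := (M`_(\pi(`|k|%N))^')%N.
exists (k + e%:Z * m%:Z); first by rewrite addrAC subrr add0r dvdz_mulr ?dvdzz.
have k0' : (0 < `|k|)%N by rewrite absz_gt0.
have km : coprimez k m%:Z.
  rewrite coprimezE coprime_pi' ?absz_nat ?part_gt0 //; exact: part_pnat.
rewrite -(partnC \pi(`|k|%N) M0) -/m PoszM coprimezMr; apply/andP; split; last first.
  by rewrite (@coprimez_congr m%:Z _ k) // addrAC subrr add0r dvdz_mull ?dvdzz.
have ct : coprimez (k + e%:Z * m%:Z) k.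
  rewrite /coprimez gcdzC addrC gcdzDr -[gcdz _ _ == 1]/(coprimez k (e%:Z * m%:Z)).
  by rewrite coprimezMr ck km.
have [t0|t0] := eqVneq (k + e%:Z * m%:Z) 0.
  rewrite t0 /coprimez gcd0z absz_nat.
  move: ct; rewrite t0 /coprimez gcd0z => /eqP[] k1.
  by rewrite k1 part_p'nat //; apply/pnatP => // p _ _; rewrite inE /= in_nil.
rewrite coprimezE absz_nat coprime_sym.
apply: (@pnat_coprime \pi(`|k|%N)); first exact: part_pnat.
rewrite -coprime_pi' ?absz_gt0 //.
by rewrite -coprimezE coprimez_sym.
Qed.

End Residues.

Section Characters.
Variable R : realType.
Implicit Types (chi psi : int -> R[i]) (d e f g : nat).

Lemma dirichlet_congr d chi (k t : int) : dirichlet_char d chi -> (d%:Z %| t - k)%Z -> chi t = chi k.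
Proof. by move=> [_ _ _ pc _]; exact: per_mod. Qed.

Lemma dirichlet_restr f d chi : dirichlet_char f chi -> (0 < d)%N -> (f %| d)%N ->
  dirichlet_char d (char_restr d chi).
Proof.
move=> dc d0 fd; have [f0 c1 cM cP cu] := dc; split => //.
- by rewrite /char_restr /coprimez gcd1z eqxx.
- move=> m n; rewrite /char_restr coprimezMl.
  by case: (coprimez m d); case: (coprimez n d); rewrite ?cM ?mul0r ?mulr0.
- move=> n; rewrite /char_restr (@coprimez_congr d%:Z (n + d%:Z) n); last first.
    by rewrite addrAC subrr add0r dvdzz.
  case: ifP => // _; apply: (dirichlet_congr dc).
  by rewrite addrAC subrr add0r dvdzE !absz_nat.
- move=> n; rewrite /char_restr; case: ifPn => [c|_]; last by rewrite eqxx.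
  by rewrite cu; apply: coprimez_dvdr c.
Qed.

Lemma char_restr_comp f d chi : (f %| d)%N -> char_restr d (char_restr f chi) = char_restr d chi.
Proof.
move=> fd; apply/funext => n; rewrite /char_restr; case: ifP => // c.
by rewrite ifT //; apply: coprimez_dvdr c.
Qed.

Lemma char_restr_id d chi : dirichlet_char d chi -> char_restr d chi = chi.
Proof.
move=> [_ _ _ _ cu]; apply/funext => n; rewrite /char_restr; case: ifPn => //.
by rewrite -cu negbK => /eqP.
Qed.

Lemma primitive_inducing d chi : dirichlet_char d chi ->
  exists f psi, [/\ (f %| d)%N, primitive_char f psi & chi = char_restr d psi].
Proof.
elim/ltn_ind: d chi => d IH chi dc.
have [p|np] := pselect (primitive_char d chi).
  by exists d, chi; split=> //; rewrite char_restr_id.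
have [e [psi [ed led de E]]] : exists e psi, [/\ (e %| d)%N, (e < d)%N, dirichlet_char e psi & chi = char_restr d psi].
  apply: contrapT => H; apply: np; split=> // e psi ed led de E.
  by apply: H; exists e, psi.
have [f [psi0 [fe p0 E0]]] := IH e led psi de.
exists f, psi0; split=> //; first exact: dvdn_trans ed.
by rewrite E E0 char_restr_comp.
Qed.

(** A residue prime to g lifts to one prime to f by [unit_lift]; the hypothesis says that chi does
    not depend on the lift, so it defines a character mod g. *)
Lemma char_descent f g chi : dirichlet_char f chi -> (g %| f)%N ->
  (forall s t, coprimez s f%:Z -> coprimez t f%:Z -> (g%:Z %| s - t)%Z -> chi s = chi t) ->
  exists2 psi, dirichlet_char g psi & chi = char_restr f psi.
Proof.
move=> dc gf H; have [f0 c1 cM cP cu] := dc.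
have g0 : (0 < g)%N by exact: dvdn_gt0 gf.
have gt (k : int) : exists t, coprimez k g%:Z -> (g%:Z %| t - k)%Z /\ coprimez t f%:Z.
  have [ck|_] := boolP (coprimez k g%:Z); last by exists 0.
  by have [t h1 h2] := unit_lift f0 ck; exists t.
have [U hU] := choice gt.
pose psi k := if coprimez k g%:Z then chi (U k) else 0.
have psiE k t : coprimez t f%:Z -> (g%:Z %| t - k)%Z -> psi k = chi t.
  move=> ct gtk.
  have cg : coprimez k g%:Z.
    by rewrite -(coprimez_congr gtk); apply: coprimez_dvdr ct.
  rewrite /psi cg; have [h1 h2] := hU _ cg; apply: H => //.
  by apply: (dvdzB_trans h1); rewrite dvdzBC.
have cgf k : coprimez k f%:Z -> coprimez k g%:Z by apply: coprimez_dvdr.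
exists psi; last first.
  apply/funext => k; rewrite /char_restr; case: ifPn => [c|].
    by rewrite (psiE k k) // subrr dvdz0.
  by rewrite -cu negbK => /eqP.
split=> //.
- by rewrite (psiE 1 1) ?subrr ?dvdz0 // /coprimez gcd1z.
- move=> m n; have [cm|cm] := boolP (coprimez m g%:Z); last first.
    by rewrite /psi coprimezMl (negbTE cm) mul0r.
  have [cn|cn] := boolP (coprimez n g%:Z); last first.
    by rewrite /psi coprimezMl (negbTE cn) andbF mulr0.
  have [m1 m2] := hU _ cm; have [n1 n2] := hU _ cn.
  rewrite (psiE m (U m)) // (psiE n (U n)) // -cM; apply: psiE.
    by rewrite coprimezMl m2 n2.
  apply: (@dvdzB_trans (m * U n)); first by rewrite -mulrBl dvdz_mulr.
  by rewrite -mulrBr dvdz_mull.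
- move=> n; have E : coprimez (n + g%:Z) g%:Z = coprimez n g%:Z.
    by apply: coprimez_congr; rewrite addrAC subrr add0r dvdzz.
  have [cn|cn] := boolP (coprimez n g%:Z); last by rewrite /psi E (negbTE cn).
  have [n1 n2] := hU _ cn; rewrite (psiE n (U n)) //; apply: psiE => //.
  by rewrite opprD addrA rpredB // dvdzz.
- move=> n; rewrite /psi; case: ifPn => [cn|_]; last by rewrite eqxx.
  by rewrite cu; have [_ ->] := hU _ cn.
Qed.

(** If chi mod f1 and chi' mod f2 agree on integers prime to d, then chi depends only on residues
    mod gcd(f1, f2). Primitivity gives f1 | f2, and by symmetry the moduli agree. *)
Lemma primitive_unique d f f' chi chi' : (0 < d)%N -> (f %| d)%N -> (f' %| d)%N ->
  primitive_char f chi -> primitive_char f' chi' ->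
  char_restr d chi = char_restr d chi' -> (f, chi) = (f', chi').
Proof.
move=> d0.
have agree (c c' : int -> R[i]) (t : int) : char_restr d c = char_restr d c' -> coprimez t d%:Z -> c t = c' t.
  by move=> /(congr1 (@^~ t)); rewrite /char_restr => + ct; rewrite ct.
have half f1 f2 (c c' : int -> R[i]) : (f1 %| d)%N -> (f2 %| d)%N -> primitive_char f1 c -> primitive_char f2 c' ->
    char_restr d c = char_restr d c' -> (f1 %| f2)%N.
  move=> f1d f2d [dc pc] [dc' _] E.
  have f10 : (0 < f1)%N by case: dc.
  apply/gcdn_idPl; apply/eqP; rewrite eqn_leq dvdn_leq ?dvdn_gcdl //= leqNgt; apply/negP => lt.
  have [|psi dpsi] := @char_descent f1 (gcdn f1 f2) c dc (dvdn_gcdl _ _).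
    move=> s0 t0 cs0 ct0 g0.
    have [s sd cs] := unit_lift d0 cs0; have [t td ct] := unit_lift d0 ct0.
    rewrite -(dirichlet_congr dc sd) -(dirichlet_congr dc td).
    have gst : (gcdz f1%:Z f2%:Z %| s - t)%Z.
      have gd : (gcdz f1%:Z f2%:Z %| f1%:Z)%Z by exact: dvdz_gcdl.
      apply: (dvdzB_trans (dvdz_trans gd sd)).
      by apply: (dvdzB_trans g0); rewrite dvdzBC; exact: dvdz_trans td.
    have [a [b ab]] := Bezoutz f1%:Z f2%:Z.
    have /dvdzP[q hq] := gst.
    (* The Chinese remainder theorem: w is t mod f1 and s mod f2, which is possible as gcd(f1, f2)
       divides s - t. *)
    pose w := t + q * a * f1%:Z.
    have ws : (f2%:Z %| w - s)%Z.
      apply/dvdzP; exists (- (q * b)); rewrite /w.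
      have -> : t = s - q * (a * f1%:Z + b * f2%:Z) by rewrite ab -hq; ring.
      by ring.
    have wt : (f1%:Z %| w - t)%Z.
      by apply/dvdzP; exists (q * a); rewrite /w; ring.
    have wl : coprimez w (lcmn f1 f2)%:Z.
      have c1 : coprimez w f1%:Z.
        by rewrite (coprimez_congr wt); apply: coprimez_dvdr ct.
      have c2 : coprimez w f2%:Z.
        by rewrite (coprimez_congr ws); apply: coprimez_dvdr cs.
      have : coprimez w (f1%:Z * f2%:Z) by rewrite coprimezMr c1 c2.
      by apply: coprimez_dvdr; rewrite /= dvdn_lcm dvdn_mulr // dvdn_mull.
    (* w is moved within its class mod lcm(f1, f2) to be prime to d, where chi and chi' may be
       compared: chi t = chi v = chi' v = chi' s = chi s. *)
    have [v vl cv] := unit_lift d0 wl.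
    have vw1 : (f1%:Z %| v - w)%Z by apply: dvdz_trans vl; rewrite dvdzE /= dvdn_lcml.
    have vw2 : (f2%:Z %| v - w)%Z by apply: dvdz_trans vl; rewrite dvdzE /= dvdn_lcmr.
    have vt : (f1%:Z %| v - t)%Z by exact: dvdzB_trans wt.
    have vs : (f2%:Z %| v - s)%Z by exact: dvdzB_trans ws.
    rewrite -(dirichlet_congr dc vt) (agree _ _ _ E cs) (agree _ _ _ E cv).
    by rewrite (dirichlet_congr dc' vs).
  exact: (pc _ _ (dvdn_gcdl f1 f2) lt dpsi).
move=> fd f'd p p' E.
have ff : f = f' by apply/eqP; rewrite eqn_dvd (half _ _ _ _ fd f'd p p' E) (half _ _ _ _ f'd fd p' p (esym E)).
subst f'; congr pair; apply/funext => k.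
case: p p' => [dc _] [dc' _].
have [ck|ck] := boolP (coprimez k f%:Z); last first.
  have [_ _ _ _ cu] := dc; have [_ _ _ _ cu'] := dc'.
  by move: (cu k) (cu' k); rewrite (negbTE ck) => /negbFE/eqP -> /negbFE/eqP ->.
have [t td ct] := unit_lift d0 ck.
by rewrite -(dirichlet_congr dc td) -(dirichlet_congr dc' td); exact: agree E ct.
Qed.

End Characters.

(** * The sequences chi(nd/N) and their scalar products *)

Section Quotients.
Variables (R : realType) (N : int).
Hypothesis N0 : N != 0.
Local Notation n := (`|N|%N).
Implicit Types (chi psi v w : int -> R[i]) (d f : nat) (e k q : int).

Lemma codivisor d : (d %| n)%N -> exists e : int, N = e * d%:Z.
Proof.
move=> dn; have : (d%:Z %| N)%Z by rewrite dvdzE absz_nat.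
by move=> /dvdzP.
Qed.

Lemma caq_mul d w e q : N = e * d%:Z -> char_at_quot N d w (e * q) = w q.
Proof.
move=> E; rewrite /char_at_quot (_ : e * q * d%:Z = q * N); last by rewrite E; ring.
by rewrite dvdz_mull ?dvdzz // mulzK.
Qed.

Lemma caq_ndvd d w e k : N = e * d%:Z -> ~~ (e %| k)%Z -> char_at_quot N d w k = 0.
Proof.
move=> E ek; rewrite /char_at_quot {1}E dvdz_mul2r ?(negbTE ek) //.
by apply: contraNneq N0 => d0; rewrite E d0 mulr0.
Qed.

Lemma divisor_gt0 d : (d %| n)%N -> (0 < d)%N.
Proof. by apply: dvdn_gt0; rewrite absz_gt0. Qed.

Lemma caq_per d chi : (d %| n)%N -> dirichlet_char d chi -> per N (char_at_quot N d chi).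
Proof.
move=> dn [_ _ _ cP _] k; have [e E] := codivisor dn.
have [/dvdzP[q ->]|ek] := boolP (e %| k)%Z; last first.
  rewrite !(caq_ndvd _ E) // [in X in (_ %| X)%Z]E rpredDr //.
  by rewrite dvdz_mulr ?dvdzz.
by rewrite [in X in _ + X]E mulrC -mulrDr !(caq_mul _ _ E) cP.
Qed.

Lemma caq_mulr d chi (t k : int) : (d %| n)%N -> dirichlet_char d chi -> coprimez t N ->
  char_at_quot N d chi (t * k) = chi t * char_at_quot N d chi k.
Proof.
move=> dn [_ _ cM _ _] ct; have [e E] := codivisor dn.
have [/dvdzP[q ->]|ek] := boolP (e %| k)%Z.
  by rewrite [q * e]mulrC mulrCA !(caq_mul _ _ E) cM.
rewrite !(caq_ndvd _ E) ?mulr0 // Gauss_dvdzr // coprimez_sym.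
by apply: coprimez_dvdr ct; rewrite E abszM dvdn_mulr.
Qed.

(** With N = e d, the support consists of k = e q with q prime to d, where gcd(k, N) = |e|. So a
    single point of the support determines d. *)
Lemma caq_support d chi k : (d %| n)%N -> dirichlet_char d chi ->
  char_at_quot N d chi k != 0 -> (gcdn `|k| n * d = n)%N.
Proof.
move=> dn [_ _ _ _ cu]; have [e E] := codivisor dn.
have [/dvdzP[q ->]|ek] := boolP (e %| k)%Z; last by rewrite (caq_ndvd _ E) ?eqxx.
rewrite mulrC (caq_mul _ _ E) cu => /eqP[c].
by rewrite E !abszM absz_nat -muln_gcdr c muln1.
Qed.

Lemma caq_support_inj d d' chi psi k : (d %| n)%N -> (d' %| n)%N ->
  dirichlet_char d chi -> dirichlet_char d' psi ->
  char_at_quot N d chi k != 0 -> char_at_quot N d' psi k != 0 -> d = d'.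
Proof.
move=> dn d'n dc dc' h h'.
have E : (gcdn `|k| n * d = gcdn `|k| n * d')%N by rewrite (caq_support dn dc h) (caq_support d'n dc' h').
move/eqP: E; rewrite eqn_pmul2l ?gcdn_gt0 ?absz_gt0 ?N0 ?orbT // => /eqP.
by [].
Qed.

Lemma dotv_self v : per N v -> (exists k, v k != 0) -> dotv N v v != 0.
Proof.
move=> pv [k vk]; have [r kr] := ord_residue N0 k.
have -> : dotv N v v = (\sum_(r < n) sqmod (v r))%:C.
  by rewrite rmorph_sum; apply: eq_bigr => s _; rewrite mul_conj.
apply: contraNneq vk => /(congr1 (@complex.Re R)) /= /eqP; rewrite psumr_eq0 => [/allP/(_ r)|s _]; last exact: sqmod_ge0.
by rewrite mem_index_enum (per_mod pv kr) => /(_ isT) /eqP /sqmod_eq0 ->.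
Qed.

Lemma caq_nz d chi : (d %| n)%N -> dirichlet_char d chi -> exists k, char_at_quot N d chi k != 0.
Proof.
move=> dn [_ c1 _ _ _]; have [e E] := codivisor dn.
by exists (e * 1); rewrite (caq_mul _ _ E) c1 oner_neq0.
Qed.

Lemma sum_unit_shift (t : int) w : coprimez t N -> per N w ->
  \sum_(r < n) w (t * r%:Z) = \sum_(r < n) w r%:Z.
Proof.
move=> ct pw.
have [s hs] := choice (fun r : 'I_n => ord_residue N0 (t * r%:Z)).
have si : injective s.
  move=> r r' E; apply/eqP; rewrite -(@dvdz_ord N).
  have : (N %| t * r%:Z - t * r'%:Z)%Z.
    by apply: (dvdzB_trans (hs r)); rewrite E dvdzBC.
  by rewrite -mulrBr Gauss_dvdzr // coprimez_sym.
rewrite [RHS](reindex_inj si); apply: eq_bigr => r _.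
exact: per_mod.
Qed.

(** Multiplication by t permutes the residues mod N, so it is unitary for [dotv]: the product is
    multiplied by a conj b, and |b| = 1 with a conj b = 1 would give a = b. *)
Lemma dotv_eigen (t : int) (a b : R[i]) v w : coprimez t N -> per N v -> per N w ->
  (forall k, v (t * k) = a * v k) -> (forall k, w (t * k) = b * w k) ->
  sqmod b = 1 -> a != b -> dotv N v w = 0.
Proof.
move=> ct pv pw va wb b1 ab.
have pf : per N (fun k => v k * (w k)^*) by move=> k; rewrite pv pw.
have : (a * b^*) * dotv N v w = dotv N v w.
  rewrite -[RHS](sum_unit_shift ct pf) mulr_sumr; apply: eq_bigr => r _.
  by rewrite va wb rmorphM /=; ring.
move/eqP; rewrite -subr_eq0 -{2}[dotv N v w]mul1r -mulrBl mulf_eq0 => /orP[|/eqP //].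
rewrite subr_eq0 => /eqP E; case/eqP: ab.
by rewrite -[a]mulr1 -[1]/(1%:C) -b1 -mul_conj mulrCA E mulr1.
Qed.

Lemma dirichlet_sqmod d chi t : dirichlet_char d chi -> coprimez t d%:Z -> sqmod (chi t) = 1.
Proof.
move=> dc; have [d0 c1 cM cP cu] := dc => ct.
have cX m : chi (t ^+ m) = chi t ^+ m.
  by elim: m => [|m IH]; rewrite ?expr0 // exprS cM IH exprS.
have E : chi t ^+ totient d = 1.
  rewrite -cX -c1; apply: (dirichlet_congr dc).
  have ctm : coprime `|(t %% d%:Z)%Z| d.
    move: ct; rewrite -(@coprimez_congr d%:Z (t %% d%:Z)%Z t) ?coprimezE ?absz_nat //.
    by rewrite dvdzBC {1}(divz_eq t d%:Z) addrK dvdz_mull ?dvdzz.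
  have := cyclic.Euler_exp_totient ctm => H.
  rewrite -eqz_mod_dvd -modzXm.
  have -> : (t %% d%:Z)%Z = `|(t %% d%:Z)%Z|%N%:Z.
    by rewrite gez0_abs // modz_ge0 // -lt0n.
  rewrite -[_%:Z]natz -natrX natz modz_nat H.
  by rewrite -modz_nat.
have t0 : (0 < totient d)%N by rewrite totient_gt0.
have : sqmod (chi t) ^+ totient d = 1.
  rewrite -[RHS](sqmod1 R) -E; elim: (totient d) => [|m IH]; first by rewrite !expr0 sqmod1.
  by rewrite !exprS sqmodM IH.
by move/eqP; rewrite pexpr_eq1 ?sqmod_ge0 // => /eqP.
Qed.

Lemma caq_ortho_div d d' chi psi : (d %| n)%N -> (d' %| n)%N -> d <> d' ->
  dirichlet_char d chi -> dirichlet_char d' psi ->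
  dotv N (char_at_quot N d chi) (char_at_quot N d' psi) = 0.
Proof.
move=> dn d'n dd dc dc'; apply: big1 => r _.
have [->|h] := eqVneq (char_at_quot N d chi r) 0; first by rewrite mul0r.
have [->|h'] := eqVneq (char_at_quot N d' psi r) 0; first by rewrite conjC0 mulr0.
by case: dd; exact: caq_support_inj h h'.
Qed.

(** The characters differ at some k prime to d. A lift t of k prime to N acts on the two sequences
    by chi t and psi t, which are distinct. *)
Lemma caq_ortho_char d chi psi : (d %| n)%N -> dirichlet_char d chi -> dirichlet_char d psi ->
  chi <> psi -> dotv N (char_at_quot N d chi) (char_at_quot N d psi) = 0.
Proof.
move=> dn dc dp ne.
have [k kne] : exists k, chi k <> psi k.
  by apply: contrapT => H; apply: ne; apply/funext => k; apply: contrapT => h; apply: H; exists k.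
have ck : coprimez k d%:Z.
  apply: contrapT => /negP nc; apply: kne.
  have [_ _ _ _ cu] := dc; have [_ _ _ _ cu'] := dp.
  by move: (cu k) (cu' k); rewrite (negbTE nc) => /negbFE/eqP -> /negbFE/eqP ->.
have n0 : (0 < n)%N by rewrite absz_gt0.
have [t td ct] := unit_lift n0 ck.
have ctN : coprimez t N by move: ct; rewrite !coprimezE absz_nat.
apply: (@dotv_eigen t (chi t) (psi t)) => //.
- exact: caq_per.
- exact: caq_per.
- by move=> m; exact: caq_mulr.
- by move=> m; exact: caq_mulr.
- by apply: (dirichlet_sqmod dp); rewrite (coprimez_congr td).
- by rewrite (dirichlet_congr dc td) (dirichlet_congr dp td); apply/eqP.
Qed.

(* For a given k only d' = N/gcd(k, N) contributes to the right-hand side. *)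
Lemma caq_hecke f d chi (m k : int) : m != 0 -> (f %| d)%N -> (d %| n)%N -> dirichlet_char f chi ->
  char_at_quot N d (char_restr d chi) (m * k) =
  \sum_(d' <- divisors n)
    (if [&& (d %| d')%N, (d'%:Z %| m * d%:Z)%Z & coprimez (m * d%:Z %/ d'%:Z)%Z d%:Z]
     then chi (m * d%:Z %/ d'%:Z)%Z else 0) * char_at_quot N d' (char_restr d' chi) k.
Proof.
move=> m0 fd dn dc; have [f0 _ cM _ _] := dc.
have n0 : (0 < n)%N by rewrite absz_gt0.
have d0 := divisor_gt0 dn.
have g0 : (0 < gcdn `|k| n)%N by rewrite gcdn_gt0 n0 orbT.
have [e E] := codivisor dn.
pose d1 := (n %/ gcdn `|k| n)%N.
have d1g : (d1 * gcdn `|k| n)%N = n by rewrite divnK // dvdn_gcdr.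
have d1n : (d1 %| n)%N by rewrite -d1g dvdn_mulr.
have d10 := divisor_gt0 d1n.
have [e1 E1] := codivisor d1n.
have e1g : `|e1|%N = gcdn `|k| n.
  apply/eqP; rewrite -(eqn_pmul2r d10) [X in _ == X]mulnC d1g.
  by rewrite [X in _ == `|X|%N]E1 abszM.
have /dvdzP[q kq] : (e1 %| k)%Z by rewrite dvdzE e1g dvdn_gcdl.
have e10 : e1 != 0 by rewrite -absz_gt0 e1g.
have cq : coprimez q d1%:Z.
  rewrite coprimezE absz_nat /coprime -(eqn_pmul2l g0) -e1g muln_gcdr muln1 -abszM.
  by rewrite [e1 * q]mulrC -kq e1g [X in gcdn _ X]mulnC d1g.
rewrite (bigD1_seq d1) ?divisors_uniq //=; last by rewrite -dvdn_divisors.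
rewrite [X in _ + X]big1_seq ?addr0; last first.
  move=> d' /andP[d'1]; rewrite -dvdn_divisors // => d'n.
  case: ifPn => [/and3P[dd' _ _]|_]; last by rewrite mul0r.
  have [->|h] := eqVneq (char_at_quot N d' (char_restr d' chi) k) 0; first by rewrite mulr0.
  have dc' := dirichlet_restr dc (divisor_gt0 d'n) (dvdn_trans fd dd').
  have := caq_support d'n dc' h; rewrite -{2}d1g mulnC => /eqP.
  by rewrite eqn_pmul2r // (negbTE d'1).
have -> : char_at_quot N d1 (char_restr d1 chi) k = chi q.
  by rewrite kq mulrC (caq_mul _ _ E1) /char_restr cq.
(* Since q is prime to d1, e divides m k exactly when d1 divides m d; otherwise both sides
   vanish. *)
have [d1m|d1m] := boolP (d1%:Z %| m * d%:Z)%Z; last first.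
  rewrite andbF mul0r (caq_ndvd _ E) //.
  have dz : d%:Z != 0 by rewrite -absz_gt0 absz_nat.
  rewrite -(@dvdz_mul2r d%:Z) // -E E1 kq.
  rewrite (_ : m * (q * e1) * d%:Z = e1 * (q * (m * d%:Z))); last by ring.
  by rewrite dvdz_mul2l // Gauss_dvdzr // coprimez_sym.
set s := (m * d%:Z %/ d1%:Z)%Z.
have hs : m * d%:Z = s * d1%:Z by rewrite divzK.
have me : m * e1 = s * e.
  apply: (@mulIf _ d%:Z); first by rewrite -absz_gt0 absz_nat.
  by rewrite mulrAC hs -mulrA -[d1%:Z * e1]mulrC -E1 E; ring.
rewrite kq (_ : m * (q * e1) = e * (s * q)); last by rewrite mulrCA me; ring.
rewrite (caq_mul _ _ E) /char_restr coprimezMl /=.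
have [cs|cs] := boolP (coprimez s d%:Z); last by rewrite andbF mul0r.
have dd1 : (d %| d1)%N.
  have : (d%:Z %| s * d1%:Z)%Z by rewrite -hs dvdz_mull ?dvdzz.
  by rewrite Gauss_dvdzr // coprimez_sym.
by rewrite dd1 (coprimez_dvdr _ cq) //= cM.
Qed.

End Quotients.

(** * Expansion of periodic functions in characters *)

Section Sums.
Variable R : realType.
Implicit Types (A B : set (int -> R[i])) (w x : int -> R[i]).

(** Finite sums without scalars: in each application the set A already contains the multiples it
    needs. *)
Inductive sumof A : (int -> R[i]) -> Prop :=
| sumof_nil : sumof A (fun=> 0)
| sumof_cons x w : A x -> sumof A w -> sumof A (fun k => x k + w k).

Lemma sumof_add A w w' : sumof A w -> sumof A w' -> sumof A (fun k => w k + w' k).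
Proof.
move=> Aw Aw'; elim: Aw => [|x v Ax _ IH].
  by under eq_fun do rewrite add0r.
by under eq_fun do rewrite -addrA; exact: sumof_cons.
Qed.

Lemma sumof_one A x : A x -> sumof A x.
Proof.
move=> Ax; have := sumof_cons Ax (sumof_nil A); congr sumof.
by apply/funext => k; rewrite addr0.
Qed.

Lemma sumof_big A (I : Type) (s : seq I) (x : I -> int -> R[i]) :
  (forall i, sumof A (x i)) -> sumof A (fun k => \sum_(i <- s) x i k).
Proof.
move=> Ax; elim: s => [|i s IH].
  by under eq_fun do rewrite big_nil; exact: sumof_nil.
by under eq_fun do rewrite big_cons; exact: sumof_add.
Qed.

Lemma sumof_bind A B w : sumof A w -> (forall x, A x -> sumof B x) -> sumof B w.
Proof.
move=> Aw AB; elim: Aw => [|x v Ax _ IH]; first exact: sumof_nil.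
by apply: sumof_add => //; exact: AB.
Qed.

Lemma sumof_map A B (F : (int -> R[i]) -> int -> R[i]) w :
  F (fun=> 0) = (fun=> 0) -> (forall x y, F (fun k => x k + y k) = (fun k => F x k + F y k)) ->
  (forall x, A x -> B (F x)) -> sumof A w -> sumof B (F w).
Proof.
move=> F0 FD AB; elim=> [|x v Ax _ IH]; first by rewrite F0; exact: sumof_nil.
by rewrite FD; apply: sumof_cons => //; exact: AB.
Qed.

End Sums.

Section UnitFunctions.
Variables (R : realType) (d : nat).
Hypothesis d0 : (0 < d)%N.
Implicit Types (w x : int -> R[i]) (t : nat).
Local Notation phi := (totient d).

Definition unit_fun w := (forall k, w (k + d%:Z) = w k) /\
  (forall k, ~~ coprimez k d%:Z -> w k = 0).

Definition eigen_for (ts : seq nat) w := forall t, t \in ts ->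
  exists l, forall k, w (t%:Z * k) = l * w k.

(** The projection onto the eigenvalue e(r/phi) of w(k) -> w(tk), an operator whose phi-th power is
    the identity by Euler's theorem. *)
Definition eigen_part t r w (k : int) : R[i] :=
  (phi%:R)^-1 * \sum_(j < phi) expi2pi (- (j%:R * r%:R / phi%:R)) * w (t%:Z ^+ j * k).

Lemma phi_gt0 : (0 < phi)%N.
Proof. by rewrite totient_gt0. Qed.

Lemma phiR0 : phi%:R != 0 :> R.
Proof. by rewrite pnatr_eq0 -lt0n phi_gt0. Qed.

Lemma phiC0 : phi%:R != 0 :> R[i].
Proof. by rewrite pnatr_eq0 -lt0n phi_gt0. Qed.

Lemma unit_fun_congr w j k : unit_fun w -> (d%:Z %| j - k)%Z -> w j = w k.
Proof. by move=> [pw _]; exact: per_mod. Qed.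

Lemma eigen_part_unit t r w : coprime t d -> unit_fun w -> unit_fun (eigen_part t r w).
Proof.
move=> ct [pw zw]; split=> [k|k ck]; rewrite /eigen_part.
  congr (_ * _); apply: eq_bigr => j _; congr (_ * _).
  apply: unit_fun_congr => //.
  by rewrite mulrDr addrAC subrr add0r dvdz_mull ?dvdzz.
rewrite big1 ?mulr0 // => j _; rewrite zw ?mulr0 // coprimezMl negb_and ck orbT.
by [].
Qed.

Lemma eigen_part_keep t r w (s : nat) l : (forall k, w (s%:Z * k) = l * w k) ->
  forall k, eigen_part t r w (s%:Z * k) = l * eigen_part t r w k.
Proof.
move=> ws k; rewrite /eigen_part [RHS]mulrCA; congr (_ * _); rewrite mulr_sumr.
by apply: eq_bigr => j _; rewrite mulrCA ws mulrCA.
Qed.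

Lemma power_phi t w k : coprime t d -> unit_fun w -> w (t%:Z ^+ phi * k) = w k.
Proof.
move=> ct uw; apply: unit_fun_congr => //.
rewrite -{2}[k]mul1r -mulrBl dvdz_mulr // -eqz_mod_dvd.
rewrite -[t%:Z]natz -natrX natz modz_nat (cyclic.Euler_exp_totient ct).
by rewrite -modz_nat.
Qed.

Lemma eigen_part_eigen t r w k : coprime t d -> unit_fun w ->
  eigen_part t r w (t%:Z * k) = expi2pi (r%:R / phi%:R) * eigen_part t r w k.
Proof.
move=> ct uw; rewrite /eigen_part [RHS]mulrCA; congr (_ * _); rewrite mulr_sumr.
pose f j := expi2pi (- (j%:R * r%:R / phi%:R)) * w (t%:Z ^+ j * k).
have fS j : expi2pi (- (j%:R * r%:R / phi%:R)) * w (t%:Z ^+ j * (t%:Z * k)) =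
    expi2pi (r%:R / phi%:R) * f j.+1.
  rewrite /f exprSr -(mulrA (t%:Z ^+ j)) [RHS]mulrA -expi2piD -natr1; congr (expi2pi _ * _).
  by field; exact: phiR0.
have fphi : f phi = f 0%N.
  rewrite /f power_phi // expr0 mul1r !mul0r oppr0 expi2pi0 mul1r.
  by rewrite mulrAC divff ?phiR0 // mul1r expi2piN expi2pi_nat conjC1 mul1r.
transitivity (\sum_(j < phi) expi2pi (r%:R / phi%:R) * f j.+1).
  by apply: eq_bigr => j _; exact: fS.
rewrite -!mulr_sumr; congr (_ * _).
suff : \sum_(j < phi) f j.+1 = \sum_(j < phi) f j by [].
have := phi_gt0; case: phi fphi => // m fm _.
by rewrite big_ord_recr [RHS]big_ord_recl /= fm addrC.
Qed.

Lemma sum_eigen_part t w k : \sum_(r < phi) eigen_part t r w k = w k.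
Proof.
rewrite /eigen_part -mulr_sumr exchange_big /=.
have phi0 : phi%:Z != 0 by rewrite -absz_gt0 absz_nat phi_gt0.
rewrite (bigD1 (Ordinal phi_gt0)) //= [X in _ + X]big1 ?addr0 => [|j j0].
  under eq_bigr => r _ do rewrite mul0r mul0r oppr0 expi2pi0 mul1r expr0 mul1r.
  by rewrite sumr_const card_ord -[w k *+ _]mulr_natl mulKf ?phiC0.
rewrite -mulr_suml.
have := sum_root R phi0 (- j%:Z); rewrite rpredN -[j%:Z]subr0.
rewrite (@dvdz_ord phi%:Z j (Ordinal phi_gt0)) (negbTE j0) => h.
rewrite (_ : \sum_(i < phi) _ = 0) ?mul0r // -[RHS]h.
by apply: eq_bigr => r _; rewrite subr0 intrN !mulNr.
Qed.

(** Simultaneous diagonalization, one t at a time: the operators commute, so projecting for a new t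
    keeps the eigenvalue relations already obtained. *)
Lemma sumof_eigen (ts : seq nat) w : (forall t, t \in ts -> coprime t d) -> unit_fun w ->
  sumof [set x | unit_fun x /\ eigen_for ts x] w.
Proof.
elim: ts => [|t ts IH] ct uw; first by apply: sumof_one.
have {}IH := IH (fun s sts => ct s (mem_behead (s := t :: ts) sts)) uw.
apply: sumof_bind IH _ => x [ux ex].
have tt : coprime t d by apply: ct; rewrite mem_head.
rewrite (_ : x = fun k => \sum_(r < phi) eigen_part t r x k); last first.
  by apply/funext => k; rewrite sum_eigen_part.
apply: sumof_big => r; apply: sumof_one; split; first exact: eigen_part_unit.
move=> s; rewrite inE => /orP[/eqP ->|sts].
  by exists (expi2pi (r%:R / phi%:R)) => k; exact: eigen_part_eigen.
by have [l hl] := ex s sts; exists l; exact: eigen_part_keep.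
Qed.

(** The eigenvalue at t is w(t)/w(1), and eigenvalues multiply, so w/w(1) is a character. If w(1) =
    0, the relation w(k k) w(1) = w(k)^2 forces w = 0. *)
Lemma eigen_char w : unit_fun w -> eigen_for [seq t <- iota 0 d | coprime t d] w ->
  (exists c chi, dirichlet_char d chi /\ w = (fun k => c * chi k)) \/ w = fun=> 0.
Proof.
move=> uw ew; have [pw zw] := uw.
have prop (t k : int) : w (t * k) * w 1 = w t * w k.
  have [ct|ct] := boolP (coprimez t d%:Z); last first.
    rewrite (zw t ct) mul0r zw ?mul0r // coprimezMl negb_and ct.
    by [].
  have dz : d%:Z != 0 by rewrite -absz_gt0 absz_nat.
  have m0 := modz_ge0 t dz.
  pose s := `|(t %% d%:Z)%Z|%N.
  have sE : s%:Z = (t %% d%:Z)%Z by rewrite gez0_abs.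
  have st : (d%:Z %| t - s%:Z)%Z by rewrite sE {1}(divz_eq t d%:Z) addrK dvdz_mull ?dvdzz.
  have [|l hl] := ew s.
    rewrite mem_filter mem_iota /= add0n; apply/andP; split.
      by move: ct; rewrite (coprimez_congr st) coprimezE !absz_nat.
    by rewrite -ltz_nat sE ltz_pmod // ltz_nat.
  have E k' : w (t * k') = l * w k'.
    by rewrite -hl; apply: unit_fun_congr => //; rewrite -mulrBl dvdz_mulr.
  by rewrite E -[in RHS](mulr1 t) E; ring.
have [w10|w10] := eqVneq (w 1) 0.
  right; apply/funext => k; apply/eqP.
  by have := prop k k; rewrite w10 mulr0 => /esym/eqP; rewrite mulf_eq0 orbb.
left; exists (w 1), (fun k => (w 1)^-1 * w k); split; last first.
  by apply/funext => k; rewrite mulVKf.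
have chiM (m k : int) : (w 1)^-1 * w (m * k) = (w 1)^-1 * w m * ((w 1)^-1 * w k).
  by apply: (mulIf w10); rewrite /= -[LHS]mulrA prop; field.
split=> //.
- by rewrite mulVf.
- by move=> k; rewrite pw.
- move=> k; have [ck|ck] := boolP (coprimez k d%:Z); last by rewrite (zw k ck) mulr0 eqxx.
  have [[a b] /= ab] := coprimezP _ _ ck.
  apply/eqP => h; have := chiM a k; rewrite h mulr0 => /eqP.
  rewrite (@unit_fun_congr w (a * k) 1) ?mulVf ?oner_eq0 //.
  by rewrite -ab opprD addrA subrr sub0r rpredN dvdz_mull ?dvdzz.
Qed.

Lemma sumof_char w : unit_fun w ->
  sumof [set x | exists c chi, dirichlet_char d chi /\ x = fun k => c * chi k] w.
Proof.
move=> uw; have ct t : t \in [seq t <- iota 0 d | coprime t d] -> coprime t d.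
  by rewrite mem_filter => /andP[].
apply: sumof_bind (sumof_eigen ct uw) _ => x [ux ex].
have [[c [chi [dc ->]]]|->] := eigen_char ux ex; last exact: sumof_nil.
by apply: sumof_one; exists c, chi.
Qed.

End UnitFunctions.

Section Completeness.
Variables (R : realType) (N : int).
Hypothesis N0 : N != 0.
Local Notation n := (`|N|%N).

(** With d = N/gcd(r, N) up to sign and r = e q, the indicator of the class of r mod N is the
    sequence attached to the indicator of the unit q mod d, which expands in characters mod d. *)
Lemma sumof_dlt (r : int) : sumof [set x | exists (c : R[i]) d chi,
   [/\ (d %| n)%N, dirichlet_char d chi & x = fun k => c * char_at_quot N d chi k]]
  (fun k => dlt R N (k - r)).
Proof.
have n0 : (0 < n)%N by rewrite absz_gt0.
have g0 : (0 < gcdn `|r| n)%N by rewrite gcdn_gt0 n0 orbT.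
pose d := (n %/ gcdn `|r| n)%N.
have dg : (d * gcdn `|r| n)%N = n by rewrite divnK // dvdn_gcdr.
have dn : (d %| n)%N by rewrite -dg dvdn_mulr.
have d0 := divisor_gt0 N0 dn.
have [e E] := codivisor dn.
have eg : `|e|%N = gcdn `|r| n.
  apply/eqP; rewrite -(eqn_pmul2r d0) [X in _ == X]mulnC dg.
  by rewrite [X in _ == `|X|%N]E abszM.
have /dvdzP[q rq] : (e %| r)%Z by rewrite dvdzE eg dvdn_gcdl.
have e0 : e != 0 by rewrite -absz_gt0 eg.
have cq : coprimez q d%:Z.
  rewrite coprimezE absz_nat /coprime -(eqn_pmul2l g0) -eg muln_gcdr muln1 -abszM.
  by rewrite [e * q]mulrC -rq eg [X in gcdn _ X]mulnC dg.
pose w (k : int) : R[i] := if (d%:Z %| k - q)%Z then 1 else 0.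
have uw : unit_fun d w.
  split=> k; rewrite /w; first by rewrite addrAC rpredDr ?dvdzz.
  by move=> nk; rewrite ifN //; apply: contra nk => h; rewrite (coprimez_congr h).
have -> : (fun k => dlt R N (k - r)) = char_at_quot N d w.
  apply/funext => k; have [/dvdzP[p ->]|ek] := boolP (e %| k)%Z.
    rewrite [p * e]mulrC (caq_mul N0 _ _ E) /w /dlt rq [q * e]mulrC -mulrBr.
    by rewrite {1}E dvdz_mul2l.
  rewrite (caq_ndvd N0 _ E) // /dlt ifN //; apply: contra ek => h.
  have er : (e %| r)%Z by rewrite rq dvdz_mull ?dvdzz.
  have eN : (e %| N)%Z by rewrite E dvdz_mulr ?dvdzz.
  by rewrite -(subrK r k) rpredD // (dvdz_trans eN).
apply: (sumof_map (F := char_at_quot N d) _ _ _ (sumof_char d0 uw)).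
- by apply/funext => k; rewrite /char_at_quot if_same.
- by move=> x y; apply/funext => k; rewrite /char_at_quot; case: ifP => // _; rewrite addr0.
- move=> x [c [chi [dc ->]]]; exists c, d, chi; split=> //.
  by apply/funext => k; rewrite /char_at_quot; case: ifP => // _; rewrite mulr0.
Qed.

End Completeness.

(** * Hecke operators *)

Section AffinePeriodic.
Variable R : realType.
Local Notation T1 := (measurableTypeR R).
Local Notation T2 := (T1 * T1)%type.
Local Notation lam := (@lebesgue_measure R).
Local Notation I01 := (`[0%R, 1%R]%classic : set T1).

(** The affine image of [0, 1] lies in M consecutive unit intervals starting at be - |al|, as M >= 2
    |al|. The constant is crude but independent of be, so it serves all the translates in a Hecke
    sum. *)
Lemma integral_periodic_affine (al : R) : al != 0 -> exists2 K : R, 0 <= K &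
  forall (be : R) (h : R -> \bar R), measurable_fun setT (h : T1 -> \bar R) ->
  (forall x, (0 <= h x)%E) -> (forall x, h (x + 1)%R = h x) ->
  (\int[lam]_(x in I01) h (al * x + be)%R <= K%:E * \int[lam]_(x in I01) h x)%E.
Proof.
move=> al0; pose M := (Num.truncn (2 * `|al|)).+1.
exists (`|al|^-1 * M%:R); first by rewrite mulr_ge0 // invr_ge0.
move=> be h mh h0 hp; pose b := be - `|al|.
have aM : 2 * `|al| <= M%:R by apply/ltW/truncnS_gt.
pose J : set T1 := `[b, (b + M%:R)%R]%classic.
have mJ : measurable J by exact: measurable_itv.
have mhJ : measurable_fun setT (h \_ J).
  by apply/measurable_restrict => //; rewrite setTI; exact: measurable_funS mh.
have hJ0 x : (0 <= (h \_ J) x)%E by rewrite /patch; case: ifP.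
have H1 : (\int[lam]_x (h \_ J) (al * x + be)%R = (`|al|^-1)%:E * \int[lam]_x (h \_ J) x)%E.
  exact: ge0_integral_affine.
have H2 : (\int[lam]_x (h \_ J) x = M%:R%:E * \int[lam]_(x in I01) h x)%E.
  rewrite -integral_mkcond integral_tile //.
  under eq_bigr => i _ do rewrite integral_periodic_shift //.
  by rewrite sumr_const card_ord mule_natl.
rewrite EFinM -muleA -H2 -H1 integral_mkcond.
apply: ge0_le_integral => //.
- by move=> x _; rewrite /patch; case: ifP.
- apply/measurable_restrict => //; rewrite setTI.
  apply: (measurable_funS measurableT) => //.
  exact: (measurableT_comp mh (measurable_affine al be)).
- exact: (measurableT_comp mhJ (measurable_affine al be)).
move=> x _; rewrite {1}/patch; case: ifPn => // /set_mem; rewrite /= in_itv /= => /andP[x0 x1].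
rewrite /patch ifT // inE /J /= in_itv /=.
have : `|al * x| <= `|al| by rewrite normrM (ger0_norm x0) ler_piMr.
by rewrite ler_norml /b => /andP[l1 l2]; apply/andP; split; lra.
Qed.

Lemma measurable_inner_integral (h : T2 -> \bar R) : measurable_fun setT h ->
  (forall p, (0 <= h p)%E) ->
  measurable_fun setT (fun a : T1 => \int[lam]_(c in I01) h (a, c))%E.
Proof.
move=> mh h0; have mS : measurable ([set: T1] `*` I01) by apply: measurableX => //; exact: measurable_itv.
pose k := h \_ ([set: T1] `*` I01).
have mk : measurable_fun setT k.
  by apply/measurable_restrict => //; rewrite setTI; exact: measurable_funS mh.
have k0 p : (0 <= k p)%E by rewrite /k /patch; case: ifP.
have := @measurable_fun_fubini_tonelli_F _ _ _ _ R lam k mk k0.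
congr measurable_fun; apply/funext => a; rewrite /fubini_F [RHS]integral_mkcond.
apply: eq_integral => c _; rewrite /k /patch.
by congr (if _ then _ else _); apply/idP/idP; rewrite !inE; [move=> []|].
Qed.

Lemma tsq_affine_bound (al ga : R) : al != 0 -> ga != 0 -> exists2 K : R, 0 <= K &
  forall (be : R) (g : T2 -> R[i]), cmeasurable g ->
  (forall a c, sqmod (g (a + 1, c)) = sqmod (g (a, c))) ->
  (forall a c, sqmod (g (a, c + 1)) = sqmod (g (a, c))) ->
  (tsq (fun p => g (al * p.1 + be, ga * p.2)%R) <= K%:E * tsq g)%E.
Proof.
move=> al0 ga0; have [K K0 hK] := integral_periodic_affine al0.
have [K' K0' hK'] := integral_periodic_affine ga0.
exists (K' * K); first exact: mulr_ge0.
move=> be g mg g1 g2.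
have mI := @measurable_I01 R.
pose f (p : T2) := (sqmod (g p))%:E.
have mf : measurable_fun setT f by exact: cmeas_esqmod.
have f0 p : (0 <= f p)%E by rewrite lee_fin sqmod_ge0.
have m1 : measurable_fun setT (fun p : T2 => (al * p.1 + be : T1)).
  exact: (measurableT_comp (measurable_affine al be) measurable_fst).
have m2 : measurable_fun setT (fun p : T2 => (ga * p.2 : T1)).
  by apply: measurable_funM => //; exact: measurable_snd.
have mf1 : measurable_fun setT (fun p : T2 => f (al * p.1 + be, p.2)%R).
  by apply: (measurableT_comp mf); apply: measurable_fun_pair => //; exact: measurable_snd.
have mf12 : measurable_fun setT (fun p : T2 => f (al * p.1 + be, ga * p.2)%R).
  by apply: (measurableT_comp mf); apply: measurable_fun_pair.
have sw : measurable_fun setT (fun p : T2 => (p.2, p.1) : T2).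
  by apply: measurable_fun_pair; [exact: measurable_snd|exact: measurable_fst].
have step1 : (tsq (fun p => g (al * p.1 + be, ga * p.2)%R) <= K'%:E * tsq (fun p => g (al * p.1 + be, p.2)%R))%E.
  rewrite /tsq (integral_lam21 mI mI mf12) // (integral_lam21 mI mI mf1) //.
  rewrite -ge0_integralZl //; last 2 first.
  - exact: (measurable_funS measurableT (@subsetT _ _) (measurable_inner_integral mf1 (fun p => f0 _))).
  - by move=> a _; apply: integral_ge0.
  apply: ge0_le_integral => //.
  - by move=> a _; apply: integral_ge0.
  - exact: (measurable_funS measurableT (@subsetT _ _) (measurable_inner_integral mf12 (fun p => f0 _))).
  - apply: measurable_funeM.
    exact: (measurable_funS measurableT (@subsetT _ _) (measurable_inner_integral mf1 (fun p => f0 _))).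
  move=> a _; have := hK' 0 (fun c => f (al * a + be, c)%R).
  under eq_integral do rewrite addr0; apply => //.
    exact: (measurableT_comp mf (pair1_measurable (al * a + be : T1))).
  by move=> c; rewrite /f g2.
have step2 : (tsq (fun p => g (al * p.1 + be, p.2)%R) <= K%:E * tsq g)%E.
  rewrite /tsq (integral_lam22 mI mI mf1) // (integral_lam22 mI mI mf) //.
  have msf1 := measurableT_comp mf1 sw.
  have msf := measurableT_comp mf sw.
  rewrite -ge0_integralZl //; last 2 first.
  - exact: (measurable_funS measurableT (@subsetT _ _) (measurable_inner_integral msf (fun p => f0 _))).
  - by move=> a _; apply: integral_ge0.
  apply: ge0_le_integral => //.
  - by move=> a _; apply: integral_ge0.
  - exact: (measurable_funS measurableT (@subsetT _ _) (measurable_inner_integral msf1 (fun p => f0 _))).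
  - apply: measurable_funeM.
    exact: (measurable_funS measurableT (@subsetT _ _) (measurable_inner_integral msf (fun p => f0 _))).
  move=> c _; apply: (hK be (fun a => f (a, c))) => //.
    exact: (measurableT_comp mf (pair2_measurable (c : T1))).
  by move=> a; rewrite /f g1.
apply: le_trans step1 _; rewrite EFinM -muleA; apply: lee_wpmul2l step2.
by rewrite lee_fin.
Qed.

End AffinePeriodic.

Section HeckeTorus.
Variables (R : realType) (N : int).
Hypothesis N0 : N != 0.
Variable m : int.
Hypothesis m0 : m != 0.
Local Notation T1 := (measurableTypeR R).
Local Notation T2 := (T1 * T1)%type.
Local Notation NR := (N%:~R : R).
Local Notation mR := (m%:~R : R).
Local Notation n := (`|N|%N).
Implicit Types (g h : T2 -> R[i]) (v w : int -> R[i]).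

Definition opT g : T2 -> R[i] := fun p =>
  (`|m|%N%:R)^-1 * \sum_(j < `|m|%N) g ((p.1 + j%:R) / mR, mR * p.2).

Lemma mR0 : mR != 0.
Proof. by rewrite intr_eq0. Qed.

Lemma hecke_hlift g : hecke m (hlift N g) = hlift N (opT g).
Proof.
apply/funext => -[[a c] z]; rewrite /hecke /hlift /opT /= mulrCA; congr (_ * _).
by rewrite mulr_sumr.
Qed.

Lemma hecke_point (j : nat) (x : heis R) : ((x.1.1 + j%:R) / mR, mR * x.1.2, x.2) =
  shear_affine mR^-1 (j%:R / mR) mR 0 0 0 x.
Proof.
rewrite /shear_affine mulrDl !mul0r !addr0; congr (_, _, _).
by rewrite [mR^-1 * _]mulrC.
Qed.

Lemma heckeE (F : heis_fun R) x : hecke m F x = (`|m|%N%:R)^-1 *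
  \sum_(j < `|m|%N) F (shear_affine mR^-1 (j%:R / mR) mR 0 0 0 x).
Proof.
case: x => [[a c] z]; rewrite /hecke; congr (_ * _); apply: eq_bigr => j _.
by rewrite -hecke_point.
Qed.

Lemma hecke_meas (F : heis_fun R) : cmeasurable F -> cmeasurable (hecke m F).
Proof.
move=> mF; have -> : hecke m F = fun x => (`|m|%N%:R)^-1 *
    \sum_(j < `|m|%N) F (shear_affine mR^-1 (j%:R / mR) mR 0 0 0 x).
  by apply/funext => x; exact: heckeE.
apply: cmeasM; first exact: cmeas_cst.
apply: cmeas_sum => j; apply: (cmeas_comp mF); exact: measurable_shear_affine.
Qed.

Lemma hecke_ae (F G : heis_fun R) : ae_same F G -> ae_same (hecke m F) (hecke m G).
Proof.
move=> FG.
have : {ae haar R, forall x, forall j : nat,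
    F (shear_affine mR^-1 (j%:R / mR) mR 0 0 0 x) = G (shear_affine mR^-1 (j%:R / mR) mR 0 0 0 x)}.
  apply: ae_forall_count => j.
  by apply: (@haar_ae_shear_affine R mR^-1 (j%:R / mR) mR 0 0 0 (fun x => F x = G x)); rewrite ?invr_eq0 ?mR0.
apply: filterS => x H; rewrite !heckeE; congr (_ * _).
by apply: eq_bigr => j _; exact: H.
Qed.

Lemma opT_lin (I : Type) (s : seq I) (b : I -> R[i]) (G : I -> T2 -> R[i]) :
  opT (fun p => \sum_(i <- s) b i * G i p) = fun p => \sum_(i <- s) b i * opT (G i) p.
Proof.
apply/funext => p; rewrite /opT exchange_big /= mulr_sumr.
by apply: eq_bigr => i _; rewrite -mulr_sumr mulrCA.
Qed.

Lemma opT_qp g : qp N g -> qp N (opT g).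
Proof.
move=> qg; have [mg g1 g2] := qg; split.
- apply: cmeasM; first exact: cmeas_cst.
  apply: cmeas_sum => j; apply: (cmeas_comp mg); apply: measurable_fun_pair => /=.
    by apply: measurable_funM => //; apply: measurable_funD => //; exact: measurable_fst.
  by apply: measurable_funM => //; exact: measurable_snd.
- move=> a c; rewrite /opT /=; congr (_ * _).
  pose f (j : nat) := g ((a + j%:R) / mR, mR * c).
  have fS : f `|m|%N = f 0%N.
    rewrite /f addr0 mulrDl.
    have -> : (`|m|%N%:R : R) / mR = (sgz m)%:~R.
      by apply: (mulIf mR0); rewrite divfK ?mR0 // -intrM -abszEsg -pmulrn.
    by have := qp_int N0 (a / mR) (mR * c) (sgz m) 0 qg; rewrite addr0 mulr0 mul0r oppr0 expi2pi0 mul1r.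
  transitivity (\sum_(j < `|m|%N) f j.+1).
    by apply: eq_bigr => j _; rewrite /f -addrA [1 + _]addrC natr1.
  suff : \sum_(j < `|m|%N) f j.+1 = \sum_(j < `|m|%N) f j by [].
  have : (0 < `|m|)%N by rewrite absz_gt0.
  case: `|m|%N fS => // k fk _.
  by rewrite big_ord_recr [RHS]big_ord_recl /= fk addrC.
- move=> a c; rewrite /opT /= mulrCA; congr (_ * _); rewrite mulr_sumr.
  apply: eq_bigr => j _; rewrite mulrDr mulr1.
  have := qp_int N0 ((a + j%:R) / mR) (mR * c) 0 m qg; rewrite addr0 => ->.
  congr (_ * _); rewrite -[RHS](expi2piDz _ (- (N * j%:Z))); congr expi2pi.
  by rewrite intrN intrM -pmulrn; field; exact: mR0.
Qed.

Lemma opT_lq g : lq N g -> lq N (opT g).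
Proof.
move=> [qg fg]; split; first exact: opT_qp.
have [mg g1 g2] := qg.
have [|K K0 hK] := @tsq_affine_bound R mR^-1 mR _ mR0; first by rewrite invr_eq0 mR0.
have mG (j : nat) : cmeasurable (fun p : T2 => g ((p.1 + j%:R) / mR, mR * p.2)).
  apply: (cmeas_comp mg); apply: measurable_fun_pair => /=.
    by apply: measurable_funM => //; apply: measurable_funD => //; exact: measurable_fst.
  by apply: measurable_funM => //; exact: measurable_snd.
have bG (j : nat) : (tsq (fun p : T2 => g ((p.1 + j%:R) / mR, mR * p.2)%R) < +oo)%E.
  rewrite (@eq_tsq R _ (fun p => g (mR^-1 * p.1 + j%:R / mR, mR * p.2))); last first.
    by move=> p; congr (sqmod (g (_, _))); rewrite mulrDl mulrC.
  apply: le_lt_trans (hK _ g mg _ _) _.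
  - by move=> a c; rewrite g1.
  - exact: (qp_sqmod_snd qg).
  by rewrite lte_mul_pinfty ?lee_fin.
rewrite tsqM; last by apply: cmeas_sum => j; exact: mG.
apply: lte_mul_pinfty; rewrite ?lee_fin ?sqmod_ge0 //.
apply: le_lt_trans (@tsq_sum R 'I_`|m|%N (index_enum _)
  (fun j p => g ((p.1 + j%:R) / mR, mR * p.2)) (fun j => mG j)) _.
apply: lte_mul_pinfty; rewrite ?lee_fin ?exprn_ge0 //.
by apply: lte_sum_pinfty => j _; exact: bG.
Qed.

(** The phase e(m s (a + j)/m) = e(s a) e(s j) loses its second factor, and m c + m s/N = m (c +
    s/N). *)
Lemma opT_X (s : int) g : opT (opX N (m * s) g) = opX N s (opT g).
Proof.
apply/funext => p; rewrite /opT /opX /= [RHS]mulrCA; congr (_ * _).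
rewrite mulr_sumr; apply: eq_bigr => j _; congr (_ * g (_, _)).
  rewrite -[RHS](expi2piDz _ (s * j%:Z)); congr expi2pi.
  by rewrite !intrM -pmulrn; field; exact: mR0.
by rewrite intrM; field; exact: NR0.
Qed.

Lemma opP_opX (r s : int) g : opP N r (opX N s g) = opX N s (opP N (r - s) g).
Proof.
apply/funext => p; rewrite /opX /opP /= [RHS]mulrCA; congr (_ * _).
rewrite mulr_sumr; apply: eq_bigr => j _; rewrite /opY /= !mulrA; congr (_ * _).
by rewrite -!expi2piD; congr expi2pi; rewrite intrB -pmulrn; field; exact: NR0.
Qed.

(** Moving a by m/N multiplies T_m X_k g by e(k/N), whereas a value of [opP 0] has period 1/N and so
    also m/N. As e(k/N) is not 1, the projection vanishes. *)
Lemma opT_opX_neq k g : qp0 N g -> ~~ (N %| k)%Z -> opP N 0 (opT (opX N k g)) = fun=> 0.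
Proof.
move=> [qg g0] Nk.
have qX : qp N (opX N k g) := good_qp (good_opX R N k) qg.
pose h := opT (opX N k g); have qh : qp N h by exact: opT_qp.
pose f a c := opP N 0 h (a, c).
have f1 a c : f (a + NR^-1) c = f a c.
  by rewrite /f opP_eigen // mul0r expi2pi0 mul1r.
have fn (j : nat) a c : f (a + j%:R / NR) c = f a c.
  elim: j a => [|j IH] a; first by rewrite mul0r addr0.
  by rewrite -natr1 mulrDl mul1r addrA f1.
have fm a c : f (a + mR / NR) c = f a c.
  case: m => j; first by rewrite -pmulrn fn.
  by rewrite NegzE intrN -pmulrn -[LHS](fn j.+1) mulNr subrK.
have hm a c : h (a + mR / NR, c) = expi2pi (k%:~R / NR) * h (a, c).
  rewrite /h /opT /= [RHS]mulrCA; congr (_ * _); rewrite mulr_sumr; apply: eq_bigr => j _.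
  rewrite /opX /= [RHS]mulrA -expi2piD.
  have E : (a + mR / NR + j%:R) / mR = (a + j%:R) / mR + NR^-1.
    by field; rewrite mR0 NR0.
  by rewrite E g0; congr (expi2pi _ * _); field; rewrite mR0 NR0.
have fe a c : f (a + mR / NR) c = expi2pi (k%:~R / NR) * f a c.
  rewrite /f /opP [RHS]mulrCA; congr (_ * _); rewrite mulr_sumr; apply: eq_bigr => j _.
  by rewrite /opY /= addrAC hm mulrCA.
apply/funext => -[a c]; rewrite -/h -/(f a c).
have : (expi2pi (k%:~R / NR) - 1) * f a c = 0 by rewrite mulrBl mul1r -fe fm subrr.
move/eqP; rewrite mulf_eq0 => /orP[|/eqP //].
rewrite subr_eq0 => /eqP H; case/negP: Nk.
have [q /(congr1 ( *%R^~ NR))] := expi2pi_eq1 H.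
rewrite divfK ?NR0 // -intrM => /eqP; rewrite eqr_int => /eqP ->.
by rewrite dvdz_mull ?dvdzz.
Qed.

(** The component of index s of T_m X_r g is [opP 0] of T_m X_(r - ms) g, which is zero unless r is
    m s mod N. So T_m replaces v by v(m .) and acts on the coefficient separately. *)
Lemma opT_opS v g : per N v -> qp0 N g ->
  opT (opS N v g) = opS N (fun k => v (m * k)) (opP N 0 (opT g)).
Proof.
move=> pv g0; have [qg _] := g0.
have qT := opT_qp (good_qp (@good_opS R N v) qg).
apply/funext => p; rewrite -(sum_opXA N0 p qT) /opS; apply: eq_bigr => s _.
suff -> : opA N s (opT (opS N v g)) = fun p => v (m * s%:Z) * opP N 0 (opT g) p.
  by rewrite /opX mulrCA.
rewrite /opS opT_lin (good_linsum _ _ _ (good_opA R N0 s)); apply/funext => q.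
have E (r : 'I_n) : opA N s (opT (opX N r g)) q = dlt R N (m * s%:Z - r%:Z) * opP N 0 (opT g) q.
  rewrite /opA -[X in opP N X]add0r -[X in opP N (0 + X)]opprK -opP_opX -opT_X opX_add.
  rewrite mulrN /dlt; case: ifPn => h.
    rewrite mul1r (@opX_mod R N N0 _ 0) ?opX0 //.
    by rewrite subr0 addrC dvdzBC.
  by rewrite opT_opX_neq ?mul0r //; apply: contra h; rewrite addrC dvdzBC.
rewrite (per_sum N0 _ pv) mulr_suml; apply: eq_bigr => r _.
by rewrite E mulrA.
Qed.

End HeckeTorus.

(** * The decomposition *)

Section Decomposition.
Variables (R : realType) (N : int).
Hypothesis N0 : N != 0.
Local Notation T1 := (measurableTypeR R).
Local Notation T2 := (T1 * T1)%type.
Local Notation n := (`|N|%N).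

Lemma n_gt0 : (0 < n)%N.
Proof. by rewrite absz_gt0. Qed.

Lemma HNd_VS d (chi : int -> R[i]) : (d %| n)%N -> dirichlet_char d chi ->
  HNd N d chi = VS N [:: char_at_quot N d chi].
Proof.
move=> dn dc; have pc := caq_per N0 dn dc.
apply/seteqP; split; last exact: (VS_sub_HNd N0 (divisor_gt0 N0 dn) pc).
apply: HNd_sub_VS => //; last exact: schwartz_nice.
by apply: dotv_self => //; exact: caq_nz.
Qed.

Lemma vortho_one v : per N v -> (exists k, v k != 0) -> vortho N [:: v : int -> R[i]].
Proof. by move=> pv nv [|i] [|j] //= _ _; exact: dotv_self. Qed.

Section OneCharacter.
Variables (f : nat) (chi : int -> R[i]).
Hypotheses (fn : (f %| n)%N) (pc : primitive_char f chi).

Definition caqr d := char_at_quot N d (char_restr d chi).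
Definition levels := [seq d <- divisors n | (f %| d)%N].

Lemma mem_levels d : between_divisors N f d <-> d \in levels.
Proof.
rewrite mem_filter -dvdn_divisors ?n_gt0 //; split; first by move=> [-> ->].
by move=> /andP[].
Qed.

Lemma levels_char d : between_divisors N f d -> dirichlet_char d (char_restr d chi).
Proof.
by move=> [fd dn]; case: pc => dc _; exact: (dirichlet_restr dc (divisor_gt0 N0 dn) fd).
Qed.

Lemma levels_VS d : between_divisors N f d -> HNd N d (char_restr d chi) = VS N [:: caqr d].
Proof. by move=> bd; apply: HNd_VS; [case: bd|exact: levels_char]. Qed.

Lemma vortho_level d : between_divisors N f d -> vortho N [:: caqr d].
Proof.
move=> bd; have dc := levels_char bd; have dn := bd.2.
by apply: vortho_one; [exact: caq_per|exact: caq_nz].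
Qed.

Lemma vortho_levels : vortho N (map caqr levels).
Proof.
move=> i j; rewrite size_map => il jl; rewrite /cf !(nth_map 0%N) //.
have bi : between_divisors N f (nth 0%N levels i) by apply/mem_levels; exact: mem_nth.
have bj : between_divisors N f (nth 0%N levels j) by apply/mem_levels; exact: mem_nth.
case: eqVneq => [ij|ij].
  by subst j; apply: (dotv_self N0); [exact: (caq_per N0 bi.2 (levels_char bi))|exact: (caq_nz N0 bi.2 (levels_char bi))].
apply: caq_ortho_div => //; [exact: bi.2|exact: bj.2| |exact: levels_char|exact: levels_char].
by apply/eqP; rewrite nth_uniq // filter_uniq // divisors_uniq.
Qed.

Lemma HNchi_VS : HNchi N f chi = VS N (map caqr levels).
Proof.
apply: (@HN_sum_VS R N N0 nat _ _ caqr); first exact: vortho_levels.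
  exact: mem_levels.
exact: levels_VS.
Qed.

Lemma HNchi_closed : HN_closed_subspace N (HNchi N f chi).
Proof. by rewrite HNchi_VS; apply: VS_closed => //; exact: vortho_levels. Qed.

Lemma HNchi_opS d (phi : T2 -> R[i]) : between_divisors N f d -> qp0 N phi -> lq N phi ->
  HNchi N f chi (hlift N (opS N (caqr d) phi)).
Proof.
move=> bd q0 l0; rewrite HNchi_VS.
have dl : d \in levels by apply/mem_levels.
have il : (index d levels < size levels)%N by rewrite index_mem.
suff : VS N [:: caqr d] (hlift N (opS N (caqr d) phi)).
  apply: (@VS_mem R N (map caqr levels) (caqr d) (index d levels)); first by rewrite size_map.
  by rewrite /cf (nth_map 0%N) // nth_index.
split; first by apply: hlift_meas; have [] := good_qp (@good_opS R N (caqr d)) q0.1.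
exists (fun=> phi); split=> //.
by apply: aeW => x; congr (hlift _ _ x); apply/funext => p; rewrite /synth big_ord1.
Qed.

Lemma HNchi_hecke (m : int) F : m != 0 -> HNchi N f chi F -> HNchi N f chi (hecke m F).
Proof.
move=> m0; rewrite [in X in X -> _]HNchi_VS => -[mF [phi [hphi Fphi]]].
have [dc _] := pc.
have hm := hecke_meas m mF.
rewrite HNchi_VS; apply: (@VS_ae R N _ (hlift N (opT m (synth N (map caqr levels) phi)))) => //; last first.
  by rewrite -hecke_hlift; exact: hecke_ae.
rewrite -HNchi_VS.
pose psi i := opP N 0 (opT m (phi i)).
have lT i : lq N (opT m (phi i)) by apply: opT_lq => //; exact: (hphi i).2.
have p0 i : qp0 N (psi i).
  by have := opA_qp0 N0 0 (lT i).1; rewrite /opA oppr0 opX0.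
have l0 i : lq N (psi i) by exact: lq_good (good_opP R N0 0) (lT i).
(* The coefficients of [caq_hecke]. They vanish unless d | d', so every level d' that occurs is
   still a multiple of f: this is the invariance. *)
pose co d d' : R[i] := if [&& (d %| d')%N, (d'%:Z %| m * d%:Z)%Z & coprimez (m * d%:Z %/ d'%:Z)%Z d%:Z]
     then chi (m * d%:Z %/ d'%:Z)%Z else 0.
have -> : hlift N (opT m (synth N (map caqr levels) phi)) = fun x =>
    \sum_(i < size (map caqr levels)) \sum_(d' <- divisors n)
      (if d' \in levels then hlift N (opS N (caqr d') (fun p => co (nth 0%N levels i) d' * psi i p)) x else 0).
  have -> : synth N (map caqr levels) phi = fun p =>
      \sum_(i < size (map caqr levels)) 1 * opS N (cf (map caqr levels) i) (phi i) p.
    by apply/funext => p; apply: eq_bigr => i _; rewrite mul1r.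
  rewrite opT_lin; apply/funext => x; rewrite /hlift mulr_sumr; apply: eq_bigr => i _.
  rewrite mul1r; have il : (i < size levels)%N by rewrite -(size_map caqr levels) ltn_ord.
  have bi : between_divisors N f (nth 0%N levels i) by apply/mem_levels; exact: mem_nth.
  rewrite /cf (nth_map 0%N) // opT_opS //; last 2 first.
  - exact: caq_per bi.2 (levels_char bi).
  - exact: (hphi i).1.
  rewrite -/(psi i) /opS.
  transitivity (\sum_(d' <- divisors n) expi2pi (N%:~R * x.2) *
     (\sum_(r < n) caqr d' r * (co (nth 0%N levels i) d' * opX N r (psi i) x.1))).
    rewrite -mulr_sumr exchange_big /=; congr (_ * _); apply: eq_bigr => r _.
    rewrite /caqr (caq_hecke N0 _ m0 bi.1 bi.2 dc) mulr_suml.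
    by apply: eq_bigr => d' _; rewrite -mulrA; exact: mulrCA.
  apply: eq_big_seq => d' d'n; case: ifPn => dl.
    congr (_ * _); apply: eq_bigr => r _; congr (_ * _).
    by rewrite /opX mulrCA.
  rewrite big1 ?mulr0 // => r _; rewrite /co ifN ?mul0r ?mulr0 //.
  apply: contra dl => /andP[dd' _]; apply/mem_levels; split.
    exact: dvdn_trans bi.1 dd'.
  by move: d'n; rewrite -dvdn_divisors ?n_gt0.
apply: (closed_subspace_sum _ HNchi_closed) => i.
apply: (closed_subspace_sum _ HNchi_closed) => d'.
case: (boolP (d' \in levels)) => [/mem_levels bd|_]; last by case: HNchi_closed.
by apply: HNchi_opS => //; [exact: qp0Z|exact: lqZ].
Qed.

End OneCharacter.

Lemma HN_closed : HN_closed_subspace N (@HN R N).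
Proof.
split=> //.
- apply: (HN_of_lift N0 (cmeas_cst _ 0) (lq_zero R N)).
  by apply: aeW => x; rewrite /hlift mulr0.
- move=> b F G /HN_liftP[mF [g lg Fg]] /HN_liftP[mG [h lh Gh]].
  apply: (HN_of_lift N0 _ (lq_lin b lg lh)).
    by apply: cmeasD => //; apply: cmeasM => //; exact: cmeas_cst.
  by apply: filterS2 Fg Gh => x -> ->; rewrite /hlift mulrDr; congr (_ + _); rewrite mulrCA.
Qed.

(** At different levels the supports are disjoint. At a common level d the two restricted characters
    are distinct by [primitive_unique], hence orthogonal. *)
Lemma HNchi_orthogonal f chi f' chi' (F G : heis_fun R) :
  (f %| n)%N -> primitive_char f chi -> (f' %| n)%N -> primitive_char f' chi' ->
  (f, chi) <> (f', chi') -> HNchi N f chi F -> HNchi N f' chi' G -> heis_inner F G = 0.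
Proof.
move=> fn pc fn' pc' ne; rewrite (HNchi_VS pc) (HNchi_VS pc').
apply: VS_orthogonal => // i j; rewrite !size_map => il jl; rewrite /cf !(nth_map 0%N) //.
set d := nth 0%N (levels f) i; set d' := nth 0%N (levels f') j.
have bi : between_divisors N f d by apply/mem_levels; exact: mem_nth.
have bj : between_divisors N f' d' by apply/mem_levels; exact: mem_nth.
have dc := levels_char pc bi; have dc' := levels_char pc' bj.
have [dd|dd] := eqVneq d d'; last first.
  by apply: caq_ortho_div => //; [exact: bi.2|exact: bj.2|exact/eqP].
rewrite -dd in bj dc' *; apply: caq_ortho_char => //; first exact: bi.2.
move=> E; apply: ne.
exact: (primitive_unique (divisor_gt0 N0 bi.2) bi.1 bj.1 pc pc' E).
Qed.

(** Equality is required at every point, so that summands can be collected without tracking null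
    sets. *)
Definition decomposed (h : T2 -> R[i]) := exists (k : nat) (i : 'I_k -> nat * (int -> R[i]))
  (G : 'I_k -> heis_fun R),
  (forall a, primitive_index N (i a) /\ HNchi N (i a).1 (i a).2 (G a)) /\
  forall x, hlift N h x = \sum_(a < k) G a x.

Lemma decomposed_zero : decomposed (fun=> 0).
Proof.
exists 0%N, (fun=> (0%N, fun=> 0)), (fun _ _ => 0); split; first by case.
by move=> x; rewrite big_ord0 /hlift mulr0.
Qed.

Lemma decomposedD g h : decomposed g -> decomposed h -> decomposed (fun p => g p + h p).
Proof.
move=> [k [i [G [hG EG]]]] [l [j [H [hH EH]]]].
exists (k + l)%N, (fun a => match fintype.split a with inl b => i b | inr c => j c end),
  (fun a => match fintype.split a with inl b => G b | inr c => H c end); split.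
  by move=> a; case: fintype.split.
move=> x; rewrite /hlift mulrDr -/(hlift N g x) -/(hlift N h x) EG EH big_split_ord /=.
congr (_ + _); apply: eq_bigr => b _.
  by rewrite -[fintype.lshift l b]/(fintype.unsplit (inl b)) fintype.unsplitK.
by rewrite -[fintype.rshift k b]/(fintype.unsplit (inr b)) fintype.unsplitK.
Qed.

Lemma decomposed_sum (I : Type) (s : seq I) (h : I -> T2 -> R[i]) :
  (forall i, decomposed (h i)) -> decomposed (fun p => \sum_(i <- s) h i p).
Proof.
move=> dh; elim: s => [|i s IH].
  by under eq_fun do rewrite big_nil; exact: decomposed_zero.
by under eq_fun do rewrite big_cons; exact: decomposedD.
Qed.

(** X_r is the synthesis for the indicator of the class of r, which [sumof_dlt] expands in sequences
    chi(nd/N); each chi is induced by a primitive character, which names the summand. *)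
Lemma decomposed_opX (r : 'I_n) phi : qp0 N phi -> lq N phi -> decomposed (opX N r phi).
Proof.
move=> q0 l0.
have -> : opX N r phi = opS N (fun k => dlt R N (k - r%:Z)) phi.
  apply/funext => p; rewrite /opS (bigD1 r) //= big1 => [|s sr].
    by rewrite addr0 /dlt subrr dvdz0 mul1r.
  by rewrite /dlt (dvdz_ord s r) (negbTE sr) mul0r.
elim: (sumof_dlt R N0 r) => [|x w [c [d [chi [dn dc ->]]]] _ IH].
  rewrite (_ : opS N _ phi = fun=> 0); first exact: decomposed_zero.
  by apply/funext => p; apply: big1 => s _; rewrite mul0r.
rewrite (_ : opS N _ phi = fun p => opS N (char_at_quot N d chi) (fun p => c * phi p) p + opS N w phi p); last first.
  apply/funext => p; rewrite /opS -big_split; apply: eq_bigr => s _ /=.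
  by rewrite mulrDl /opX; congr (_ + _); rewrite [RHS]mulrCA; ring.
apply: decomposedD => //.
have [f [psi [fd pp Echi]]] := primitive_inducing dc.
exists 1%N, (fun=> (f, psi)), (fun=> hlift N (opS N (char_at_quot N d chi) (fun p => c * phi p))).
split; last by move=> y; rewrite big_ord1.
move=> _; split; first by split=> //=; exact: dvdn_trans dn.
rewrite Echi; apply: HNchi_opS => //; [exact: qp0Z|exact: lqZ].
Qed.

Lemma HN_decomposition : @HN R N = HN_sum N (@primitive_index R N) (fun p => HNchi N p.1 p.2).
Proof.
apply/seteqP; split=> F; last by case.
move=> HF; split=> //; have [mF [g lg Fg]] := HN_liftP HF.
have [k [i [G [hG EG]]]] : decomposed (fun p => \sum_(r < n) opX N r (opA N r g) p).
  apply: decomposed_sum => r; apply: decomposed_opX; first exact: opA_qp0 lg.1.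
  exact: lq_good (good_opA R N0 r) lg.
exists k, i, G; split=> //; apply: filterS Fg => x ->.
by rewrite -EG /hlift sum_opXA //; exact: lg.1.
Qed.

End Decomposition.

Theorem theorem5p7 (R : realType) (N : int) (hN : N != 0) :
  [/\ forall (f : nat) (chi : int -> R[i]),
        (f %| `|N|)%N -> primitive_char f chi ->
        orthogonal_direct_sum N (HNchi N f chi) (between_divisors N f)
          (fun d => HNd N d (char_restr d chi)),
      orthogonal_direct_sum N (@HN R N) (@primitive_index R N)
        (fun p => HNchi N p.1 p.2)
    & forall (f : nat) (chi : int -> R[i]),
        (f %| `|N|)%N -> primitive_char f chi ->
        forall m : int, m != 0 ->
        forall F, HNchi N f chi F -> HNchi N f chi (hecke m F)].
Proof.
split.
- move=> f chi fn pc; split=> //.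
  + exact: HNchi_closed.
  + move=> d bd; rewrite (levels_VS hN pc bd); apply: VS_closed => //.
    exact: (vortho_level hN pc bd).
  + move=> d d' bd bd' dd F G; rewrite (levels_VS hN pc bd) (levels_VS hN pc bd').
    apply: VS_orthogonal => // -[|i] [|j] //= _ _.
    apply: caq_ortho_div => //; [exact: bd.2|exact: bd'.2| |].
      exact: levels_char bd.
    exact: levels_char bd'.
- split.
  + exact: HN_closed.
  + by move=> [f chi] [/= fn pc]; exact: HNchi_closed.
  + move=> [f chi] [f' chi'] [/= fn pc] [/= fn' pc'] ne F G.
    exact: HNchi_orthogonal.
  + exact: HN_decomposition.
- by move=> f chi fn pc m m0 F; exact: HNchi_hecke.
Qed.
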